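(* Let $d\ge 2$ and let $K$ be a convex body in $\mathbb{R}^d$ with $C^1$ boundary. Then for every function $h:\mathbb{R}\to\mathbb{R}$ with continuous derivative such that $h(0)=0$, \[ \int\limits_{G\cap K\neq\emptyset} h(|G\cap K|)\,\mu_{d,1}(\mathrm{d}G)=\frac{1}{(d-1)\omega_d}\int\limits_{(\partial K)^2}\frac{h'(|x_1-x_2|)}{|x_1-x_2|^{d-2}}\cos\alpha_1\cos\alpha_2\cos\phi_0\,\sigma(\mathrm{d}x_1)\,\sigma(\mathrm{d}x_2). \] Here, for $x_1,x_2\in\partial K$, $\alpha_i$ ($i=1,2$) is the angle between the line through $x_1,x_2$ (containing the chord $[x_1,x_2]$) and its orthogonal projection onto the tangent hyperplane of $\partial K$ at $x_i$, and $\phi_0$ is the angle between the orthogonal projections of the normal vectors of $\partial K$ at $x_1$ and at $x_2$ onto the orthogonal complement of the line through $x_1,x_2$.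
   Context: $A_{d,1}$ is the set of affine lines in $\mathbb{R}^d$ with the rigid-motion-invariant Haar measure $\mu_{d,1}$ normalized so that the measure of the set of lines meeting the unit ball $\mathbb{B}^d$ equals $\kappa_{d-1}$, where $\kappa_k$ is the volume of the $k$-dimensional unit ball. $\omega_d=d\kappa_d$ is the surface area of the unit sphere $\mathbb{S}^{d-1}$. $|G\cap K|$ is the length of the chord $G\cap K$. $\sigma$ is the $(d-1)$-dimensional Hausdorff measure on $\partial K$. *)

(* Defs.v *)
From HB Require Import structures.
From mathcomp Require Import all_boot all_order all_algebra.
From mathcomp Require Import all_classical all_reals all_analysis.
Set Implicit Arguments. Unset Strict Implicit. Unset Printing Implicit Defensive.
Import Order.TTheory GRing.Theory Num.Theory.
Import numFieldNormedType.Exports.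
Local Open Scope classical_set_scope.
Local Open Scope ring_scope.

Section Defs.
Variables (R : realType) (d : nat).
Local Notation V := 'rV[R]_d.

(** Euclidean structure on R^d (the library norm on matrices is the max norm). *)
Definition dotp (u v : V) : R := \sum_(i < d) u 0 i * v 0 i.
Definition enorm (v : V) : R := Num.sqrt (dotp v v).

Definition cos_angle (a b : V) : R :=
  if (a == 0) || (b == 0) then 0 else dotp a b / (enorm a * enorm b).

Definition proj_perp (n v : V) : V := v - dotp v n *: n.

(** volume of the k-dimensional unit ball: kappa_0 = 1, kappa_1 = 2,
    kappa_(k+2) = 2 pi / (k+2) * kappa_k. *)
Fixpoint kappa (k : nat) : R :=
  match k with
  | 0 => 1
  | 1 => 2
  | k'.+2 => (2 * pi / k'.+2%:R) * kappa k'
  end.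

(** surface area of the unit sphere S^(d-1). *)
Definition omega : R := d%:R * kappa d.

(** Euclidean diameter of a (bounded) set; sup of the empty set is 0. *)
Definition ediam (C : set V) : R :=
  sup [set r | exists x y, C x /\ C y /\ r = enorm (x - y)].

(** s-dimensional Hausdorff (outer) measure, normalized so that it agrees with
    s-dimensional Lebesgue measure on s-dimensional affine subspaces. *)
Definition hausdorff_delta (s : nat) (delta : R) (A : set V) : \bar R :=
  ereal_inf [set (\sum_(i <oo) ((kappa s * (ediam (C i) / 2) ^+ s)%:E))%E
            | C in [set C : nat -> set V |
                     A `<=` \bigcup_i C i /\
                     forall i x y, C i x -> C i y -> enorm (x - y) <= delta]].

Definition hausdorff (s : nat) (A : set V) : \bar R :=
  ereal_sup [set hausdorff_delta s delta A | delta in [set e : R | 0 < e]].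

(** Integral of an extended-real function over a set A with respect to an
    outer measure m (Choquet / layer-cake form; for Borel functions and the
    Hausdorff measure this is the usual Lebesgue integral w.r.t. the
    restriction of the measure to the (Borel) set A). *)
Definition ointegral (m : set V -> \bar R) (A : set V) (f : V -> \bar R) : \bar R :=
  ((\int[lebesgue_measure]_(t in [set t : R | (0 <= t)%R])
      m (A `&` [set x | (t%:E < f x)%E]))
   - (\int[lebesgue_measure]_(t in [set t : R | (0 <= t)%R])
      m (A `&` [set x | (t%:E < - f x)%E])))%E.

Definition sigma := hausdorff d.-1.

Definition unit_sphere : set V := [set u | enorm u = 1].

Definition convex_set (K : set V) :=
  forall x y (t : R), K x -> K y -> 0 <= t <= 1 -> K ((1 - t) *: x + t *: y).

Definition convex_body (K : set V) :=
  convex_set K /\ compact K /\ interior K !=set0.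

Definition bdry (K : set V) : set V := closure K `\` interior K.

Definition C1fun (g : V -> R) :=
  forall i : 'I_d, (forall x, derivable g x (delta_mx 0 i)) /\
                   continuous (fun x => derive g x (delta_mx 0 i)).

Definition C1_boundary (K : set V) :=
  forall x, bdry K x ->
    exists r : R, 0 < r /\ exists g : V -> R,
      C1fun g /\ (exists i : 'I_d, derive g x (delta_mx 0 i) != 0) /\
      forall y, enorm (y - x) < r -> (K y <-> g y <= 0).

Definition outer_unit_normal (K : set V) (x n : V) :=
  enorm n = 1 /\ forall y, K y -> dotp n (y - x) <= 0.

Definition line (y u : V) : set V := [set z | exists t : R, z = y + t *: u].
Definition chord_length (K : set V) (y u : V) : R :=
  sup [set t : R | K (y + t *: u)] - inf [set t : R | K (y + t *: u)].

(** integral of f(G) over the affine lines G w.r.t. the motion invariant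
    measure mu_{d,1} (lines meeting the unit ball have measure kappa_{d-1}):
    mu_{d,1} = int_{G(d,1)} int_{L^perp} 1(L + y) dy nu_1(dL), with nu_1
    the normalized invariant measure on directions, parametrized by the
    unit sphere.  Lines are given as (y, u) with u a unit vector, y in u^perp. *)
Definition lines_integral (F : V -> V -> \bar R) : \bar R :=
  ((omega^-1)%:E *
   ointegral sigma unit_sphere
     (fun u => ointegral sigma [set y | dotp y u = 0%R] (fun y => F y u)))%E.

(** integrand of the right-hand side (0 on the diagonal x1 = x2, a null set):
    h'(|x1-x2|) / |x1-x2|^(d-2) * cos a1 * cos a2 * cos phi0, where e is the
    unit direction of the line through x1, x2, a_i is the angle between this
    line and its projection onto the tangent hyperplane n(x_i)^perp, and phi0
    the angle between the projections of n(x1), n(x2) onto e^perp. *)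
Definition chord_integrand (n : V -> V) (h' : R -> R) (x1 x2 : V) : R :=
  if x1 == x2 then 0 else
  let e := (enorm (x2 - x1))^-1 *: (x2 - x1) in
  h' (enorm (x1 - x2)) / enorm (x1 - x2) ^+ (d - 2)
  * cos_angle e (proj_perp (n x1) e)
  * cos_angle e (proj_perp (n x2) e)
  * cos_angle (proj_perp e (n x1)) (proj_perp e (n x2)).

End Defs.

(* Main.v *)
(** Let n be the outer normal and (x)^+ = max(0, x).  Cauchy's formula

      int_bdry(K) (n.u)^+ f dH = int_{u^perp} f (top_u y) dy,

    where top_u y is the last point of K on the line y + R u, turns the integral over lines
    into int_S int_bdry(K) (- n(p).u)^+ h(l(p, u)) dp du, l(p, u) being the length of the
    chord leaving p in direction u.  Exchange the integrals and fix p; write z = x - p and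
    r = |z|.  Polar coordinates around p give

      int_S (- n(p).u)^+ h(l(p, u)) du = int_K h'(r) r^(-d) n(p).(p - x) dx,

    and the field h'(r) r^(-d) (r^2 n(p) - (n(p).z) z) has divergence
    (d - 1) h'(r) r^(-d) n(p).(p - x), so the right-hand side is 1/(d-1) times its flux through
    bdry(K), the integral of h'(r) r^(-d) (r^2 n(p).n(x) - (n(p).z)(n(x).z)), which is the
    product of the three cosines.

    Cauchy's formula is proved by cutting bdry(K) into pieces of almost constant normal, on
    which the projection along u is almost an oblique projection of a hyperplane.  The area
    factor of the latter follows from the fact that H|u^perp x Lebesgue is, by uniqueness of
    translation invariant measures, independent of u; no value of H is ever needed.  The
    divergence theorem and polar coordinates are Cauchy's formula for K along the axes and
    for the unit ball. *)
Require Import Defs.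
From HB Require Import structures.
From mathcomp Require Import all_boot all_order all_algebra.
From mathcomp Require Import all_classical all_reals all_analysis.
From mathcomp Require Import measurable_realfun ring lra.
Set Implicit Arguments. Unset Strict Implicit. Unset Printing Implicit Defensive.
Import Order.TTheory GRing.Theory Num.Theory.
Import numFieldNormedType.Exports.
Local Open Scope classical_set_scope.
Local Open Scope ring_scope.

(** * Euclidean structure *)

(** The boundary is never parametrised and its measure is defined through covers only, so there is
    no area formula to quote; convexity has to replace it. The C^1 hypothesis serves once, to give
    each boundary point a single outer unit normal; compactness then makes the normal continuous
    along the boundary. Where the normal is nearly constant, convexity forces all secants to be
    nearly tangent, so that projections are bi-Lipschitz with constants close to 1. Lines touching
    the body tangentially escape this comparison; they are negligible because every smaller
    homothetic copy of a shadow avoids them. The field of the divergence theorem is singular at [p],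
    a point of the boundary itself. Its scalar factor is therefore replaced by C^1 functions of
    |x-p|^2, and the limit is taken by dominated convergence: in dimension [d.+2], |x-p|^-d is
    integrable on the boundary and |x-p|^-(d+1) on the body. Polar coordinates come from Cauchy's
    formula for the ball, applied with one more factor (n.u)^+ in the integrand: over the directions
    u = e_i and u = -e_i these squares add up to 1. *)

Section Euclid.
Context {R : realType} {n : nat}.
Implicit Types (u v w : 'rV[R]_n) (a : R).

Lemma dotpC u v : dotp u v = dotp v u.
Proof. by apply: eq_bigr => i _; rewrite mulrC. Qed.

Lemma dotpDl u v w : dotp (u + v) w = dotp u w + dotp v w.
Proof. by rewrite /dotp -big_split; apply: eq_bigr => i _; rewrite mxE mulrDl. Qed.

Lemma dotpZl a u v : dotp (a *: u) v = a * dotp u v.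
Proof. by rewrite /dotp mulr_sumr; apply: eq_bigr => i _; rewrite mxE mulrA. Qed.

Lemma dotpDr u v w : dotp w (u + v) = dotp w u + dotp w v.
Proof. by rewrite !(dotpC w) dotpDl. Qed.

Lemma dotpZr a u v : dotp u (a *: v) = a * dotp u v.
Proof. by rewrite !(dotpC u) dotpZl. Qed.

Lemma dotpNl u v : dotp (- u) v = - dotp u v.
Proof. by rewrite -scaleN1r dotpZl mulN1r. Qed.

Lemma dotpNr u v : dotp u (- v) = - dotp u v.
Proof. by rewrite !(dotpC u) dotpNl. Qed.

Lemma dotpBl u v w : dotp (u - v) w = dotp u w - dotp v w.
Proof. by rewrite dotpDl dotpNl. Qed.

Lemma dotpBr u v w : dotp w (u - v) = dotp w u - dotp w v.
Proof. by rewrite dotpDr dotpNr. Qed.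

Lemma dotp0l v : dotp 0 v = 0.
Proof. by rewrite -(scale0r 0) dotpZl mul0r. Qed.

Lemma dotp0r v : dotp v 0 = 0.
Proof. by rewrite dotpC dotp0l. Qed.

Definition dotpE := (dotpDl, dotpDr, dotpNl, dotpNr, dotpZl, dotpZr).

Lemma dotp_ge0 v : 0 <= dotp v v.
Proof. by apply: sumr_ge0 => i _; rewrite -expr2 sqr_ge0. Qed.

Lemma dotp_eq0 v : (dotp v v == 0) = (v == 0).
Proof.
apply/eqP/eqP => [/psumr_eq0P v0|->]; last by rewrite dotp0l.
apply/rowP => i; rewrite mxE; apply/eqP; rewrite -sqrf_eq0 expr2; apply/eqP.
by apply: v0 => // j _; rewrite -expr2 sqr_ge0.
Qed.

Lemma enorm_ge0 v : 0 <= enorm v.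
Proof. exact: sqrtr_ge0. Qed.

Lemma sqr_enorm v : enorm v ^+ 2 = dotp v v.
Proof. by rewrite sqr_sqrtr// dotp_ge0. Qed.

Lemma enorm_eq0 v : (enorm v == 0) = (v == 0).
Proof. by rewrite -sqrf_eq0 sqr_enorm dotp_eq0. Qed.

Lemma enorm0 : enorm (0 : 'rV[R]_n) = 0.
Proof. by apply/eqP; rewrite enorm_eq0. Qed.

Lemma enorm_gt0 v : (0 < enorm v) = (v != 0).
Proof. by rewrite lt0r enorm_eq0 enorm_ge0 andbT. Qed.

Lemma enormZ a v : enorm (a *: v) = `|a| * enorm v.
Proof.
by rewrite /enorm dotpZl dotpZr mulrA -expr2 sqrtrM ?sqr_ge0// sqrtr_sqr.
Qed.

Lemma enormN v : enorm (- v) = enorm v.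
Proof. by rewrite -scaleN1r enormZ normrN1 mul1r. Qed.

Lemma enormC u v : enorm (u - v) = enorm (v - u).
Proof. by rewrite -enormN opprB. Qed.

Lemma dotp_enorm1 v : enorm v = 1 -> dotp v v = 1.
Proof. by move=> v1; rewrite -sqr_enorm v1 expr1n. Qed.

Lemma cauchy_schwarz u v : `|dotp u v| <= enorm u * enorm v.
Proof.
have [->|v0] := eqVneq v 0; first by rewrite dotp0r enorm0 normr0 mulr0.
have vv : 0 < dotp v v by rewrite lt0r dotp_eq0 v0 dotp_ge0.
rewrite -(ler_pXn2r (_ : 0 < 2)%N)// ?nnegrE ?mulr_ge0 ?enorm_ge0//.
rewrite exprMn !sqr_enorm real_normK ?num_real//.
(* This squared norm is v.v times the difference of the two sides of the squared inequality. *)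
have := dotp_ge0 (dotp v v *: u - dotp u v *: v).
rewrite !dotpE (dotpC v u) => H.
rewrite -subr_ge0 -(pmulr_rge0 _ vv).
by apply: le_trans H _; rewrite le_eqVlt; apply/orP; left; apply/eqP; ring.
Qed.

Lemma enormD u v : enorm (u + v) <= enorm u + enorm v.
Proof.
rewrite -(ler_pXn2r (_ : 0 < 2)%N)// ?nnegrE ?addr_ge0 ?enorm_ge0//.
rewrite sqrrD !sqr_enorm !dotpE (dotpC v u).
have := le_trans (ler_norm _) (cauchy_schwarz u v); lra.
Qed.

Lemma enormB u v : enorm (u - v) <= enorm u + enorm v.
Proof. by apply: le_trans (enormD _ _) _; rewrite enormN. Qed.

Lemma coord_enorm v i : `|v 0 i| <= enorm v.
Proof.
rewrite -(ler_pXn2r (_ : 0 < 2)%N)// ?nnegrE ?enorm_ge0//.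
rewrite sqr_enorm real_normK ?num_real// /dotp (bigD1 i)//= -expr2 lerDl.
by apply: sumr_ge0 => j _; rewrite -expr2 sqr_ge0.
Qed.

Lemma enorm_sum v : enorm v <= \sum_i `|v 0 i|.
Proof.
rewrite -(ler_pXn2r (_ : 0 < 2)%N)// ?nnegrE ?enorm_ge0 ?sumr_ge0//.
rewrite sqr_enorm /dotp [leRHS]expr2 mulr_suml; apply: ler_sum => i _.
rewrite -expr2 -real_normK ?num_real// expr2 ler_wpM2l//.
by rewrite (bigD1 i)//= lerDl sumr_ge0.
Qed.

Lemma coord_normr (v : 'rV[R]_n) i : `|v 0 i| <= `|v|.
Proof.
rewrite [leRHS]/Num.norm /= mx_normrE.
by apply/bigmax_geP; right => /=; exists (0, i).
Qed.

Lemma normr_enorm v : `|v| <= enorm v.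
Proof.
rewrite [leLHS]/Num.norm /= mx_normrE; apply/bigmax_leP; split=> [|[i j] _ /=].
  exact: enorm_ge0.
by rewrite (ord1 i) coord_enorm.
Qed.

Lemma enorm_normr v : enorm v <= n%:R * `|v|.
Proof.
apply: le_trans (enorm_sum v) _.
apply: le_trans (ler_sum _ (fun i _ => coord_normr v i)) _.
by rewrite sumr_const card_ord mulr_natl.
Qed.

Lemma dotp_deltal v i : dotp (delta_mx 0 i) v = v 0 i.
Proof.
rewrite /dotp (bigD1 i)//= !mxE !eqxx mul1r big1 ?addr0// => j ji.
by rewrite mxE (negbTE ji) andbF mul0r.
Qed.

Lemma dotp_deltar v i : dotp v (delta_mx 0 i) = v 0 i.
Proof. by rewrite dotpC dotp_deltal. Qed.

Lemma enorm_delta i : enorm (delta_mx 0 i : 'rV[R]_n) = 1.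
Proof. by rewrite /enorm dotp_deltal mxE !eqxx sqrtr1. Qed.

End Euclid.

Section EuclidTopology.
Context {R : realType} {n : nat} {T : topologicalType}.
Implicit Types (f g : T -> 'rV[R]_n).

Lemma continuous_coord i : continuous (fun v : 'rV[R]_n => v 0 i).
Proof. exact: coord_continuous. Qed.

Lemma continuous_rV f : (forall i, continuous (fun x => f x 0 i)) -> continuous f.
Proof.
move=> fc x A [P Px PA].
have H : \forall y \near x, forall k, P 0 k (f y 0 k).
  by apply: filter_forall => k; exact: (fc k x _ (Px 0 k)).
by apply: filterS H => y Hy; apply: PA => i j; rewrite (ord1 i).
Qed.

Lemma continuous_dotp f g : continuous f -> continuous g ->
  continuous (fun x => dotp (f x) (g x)).
Proof.
move=> fc gc; rewrite /dotp.
apply: (@continuous_big R _ +%R 0 xpredT (@add_continuous _) T _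
  (fun i x => f x 0 i * g x 0 i)) => i _ x.
apply: continuousM.
  by apply: (@continuous_comp _ _ _ f (fun v => v 0 i)); [exact: fc|exact: continuous_coord].
by apply: (@continuous_comp _ _ _ g (fun v => v 0 i)); [exact: gc|exact: continuous_coord].
Qed.

Lemma continuous_enorm f : continuous f -> continuous (fun x => enorm (f x)).
Proof.
move=> fc x; apply: (@continuous_comp _ _ _ (fun x => dotp (f x) (f x)) Num.sqrt).
  exact: continuous_dotp.
exact: sqrt_continuous.
Qed.

End EuclidTopology.

Section EuclidCompact.
Context {R : realType} {n : nat}.

Lemma continuous_subr (c : 'rV[R]_n) : continuous (fun y : 'rV[R]_n => y - c : 'rV[R]_n).
Proof.
by move=> y; have := @cvgB _ _ _ (nbhs y) _ id (cst c) y c cvg_id (cvg_cst _); apply.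
Qed.

Lemma closed_enorm_le (c : 'rV[R]_n) (r : R) : closed [set x | enorm (x - c) <= r].
Proof.
rewrite (_ : [set x | _] = (fun x => enorm (x - c)) @^-1` [set y | y <= r])//.
apply: preimage_closed => [x _|].
  by apply: continuous_enorm; exact: continuous_subr.
exact: closed_le.
Qed.

Lemma closed_bounded_compact (A : set 'rV[R]_n) (r : R) :
  closed A -> (forall x, A x -> enorm x <= r) -> compact A.
Proof.
move=> clA Ar; apply: bounded_closed_compact => //.
exists r; split=> [|M rM x Ax]; first exact: num_real.
by apply: le_trans (normr_enorm _) (le_trans (Ar _ Ax) (ltW rM)).
Qed.

Lemma compact_enorm_bounded (A : set 'rV[R]_n) : compact A ->
  exists2 r : R, 0 < r & forall x, A x -> enorm x <= r.
Proof.
move=> /compact_bounded [M [Mreal AM]].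
exists (n%:R * (`|M| + 1) + 1) => [|x Ax].
  by rewrite ltr_wpDl ?mulr_ge0 ?addr_ge0.
apply: le_trans (enorm_normr x) _; rewrite ler_wpDr// ler_wpM2l//.
by apply: AM => //; rewrite (le_lt_trans (ler_norm _))// ltrDl.
Qed.

(** The topology of row vectors comes from the maximum norm; its equivalence with the Euclidean norm
    allows Euclidean balls everywhere below. *)
Lemma nbhs_enorm (x : 'rV[R]_n) (A : set 'rV[R]_n) :
  nbhs x A <-> exists2 r : R, 0 < r & [set y | enorm (y - x) < r] `<=` A.
Proof.
split=> [/nbhs_ballP[r /= r0 rA]|[r r0 rA]].
  exists r => // y yr; apply: rA; rewrite -ball_normE /=.
  by rewrite (le_lt_trans (normr_enorm _))// enormC.
have /(_ x) := @continuous_enorm _ _ _ _ (@continuous_subr x).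
rewrite /continuous_at subrr enorm0 => /cvgr_lt/(_ r r0).
by apply: filterS => y yr; apply: rA.
Qed.

End EuclidCompact.

(** * Borel sets of row vectors *)

(** An opaque identity: the display only labels the sigma-algebra on row vectors, so that it is not
    confused with another one during unification. *)
Definition rV_display : measure_display -> measure_display.
Proof. exact. Qed.

Section BorelRV.
Context {R : realType} {n : nat}.

Let coord (i : 'I_n) (x : 'rV[R]_n) : measurableTypeR R := x 0 i.

Let rV_set0 : g_sigma_preimage coord set0.
Proof. exact: sigma_algebra0. Qed.

Let rV_setC A : g_sigma_preimage coord A -> g_sigma_preimage coord (~` A).
Proof. exact: sigma_algebraC. Qed.

Let rV_bigcup (F : (set 'rV[R]_n)^nat) : (forall i, g_sigma_preimage coord (F i)) ->
  g_sigma_preimage coord (\bigcup_i F i).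
Proof. exact: sigma_algebra_bigcup. Qed.

HB.instance Definition _ := @isMeasurable.Build (rV_display default_measure_display)
  'rV[R]_n (g_sigma_preimage coord) rV_set0 rV_setC rV_bigcup.

Lemma measurable_coord i : measurable_fun [set: 'rV[R]_n] (fun x => x 0 i).
Proof.
move=> _ Y mY; rewrite setTI; apply: sub_sigma_algebra => /=.
rewrite -bigcup_seq/=; exists i => /=; first by rewrite mem_index_enum.
by exists Y => //; rewrite setTI.
Qed.

Lemma measurable_rV d (T : measurableType d) (D : set T) (f : T -> 'rV[R]_n) :
  (forall i, measurable_fun D (fun x => f x 0 i)) -> measurable_fun D f.
Proof.
move=> mf mD; suff : measurable_fun D f by apply.
apply: (@measurability _ _ _ _ _ _
  (\big[setU/set0]_(i < n) preimage_set_system setT (coord i) measurable)) => //.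
move=> _ [B + <-].
rewrite -bigcup_seq => -[i /= _ [C mC <-]].
by rewrite setTI; exact: (mf i mD _ mC).
Qed.

(** The sigma-algebra is generated by the coordinates, so boxes are measurable, and [U] is the union
    of the countably many boxes with rational centre and radius 1/(k+1) that it contains. *)
Lemma open_measurable_rV (U : set 'rV[R]_n) : open U -> measurable U.
Proof.
move=> oU.
pose B (p : 'rV[rat]_n * nat) := [set x : 'rV[R]_n | forall i,
  `|x 0 i - ratr (p.1 0 i)| < p.2.+1%:R^-1].
have mB p : measurable (B p).
  rewrite (_ : B p = \bigcap_(i in [set: 'I_n])
      ((fun x : 'rV[R]_n => x 0 i - ratr (p.1 0 i)) @^-1` ball 0 p.2.+1%:R^-1)).
    apply: fin_bigcap_measurable => // i _; rewrite -[X in measurable X]setTI.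
    apply: (measurable_funB (@measurable_coord i) (measurable_cst _)) => //.
    exact: measurable_ball.
  apply/seteqP; split => x /= H i; first by move=> _; rewrite /ball/= sub0r normrN; exact: H.
  by have := H i I; rewrite /ball/= sub0r normrN.
rewrite (_ : U = \bigcup_(p in [set p | B p `<=` U]) B p).
  rewrite bigcup_mkcond; apply: countable_bigcupT_measurable; first exact: countableP.
  by move=> p; case: ifPn.
apply/seteqP; split => [x Ux|x [p /= pU]]; last exact: pU.
have /nbhs_enorm[r r0 rU] : nbhs x U by exact: open_nbhs_nbhs.
(* A box around a rational centre has width 2/(k+1) in each of the n coordinates, hence lies within
   2n/(k+1) < r of each of its points. Using n+1 covers n = 0. *)
pose k := Num.truncn (2 * n.+1%:R * r^-1).
have kr : k.+1%:R^-1 * (2 * n.+1%:R) < r.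
  rewrite mulrC ltr_pdivrMr ?ltr0n// -ltr_pdivrMl// mulrC.
  by rewrite /k truncnS_gt.
have k0 : 0 < k.+1%:R^-1 :> R by rewrite invr_gt0.
move eE : (k.+1%:R^-1) kr k0 => e kr k0.
have [q qx] : exists q : 'rV[rat]_n, forall i, `|x 0 i - ratr (q 0 i)| < e.
  have H i : exists q : rat, `|x 0 i - ratr q| < e.
    have xx : x 0 i - e < x 0 i + e by lra.
    have [q] := rat_in_itvoo xx; rewrite in_itv/= => /andP[q1 q2].
    by exists q; rewrite ltr_norml; apply/andP; split; lra.
  exists (\row_i projT1 (cid (H i))) => i; rewrite mxE.
  by case: (cid _).
exists (q, k) => /=; last by move=> i /=; rewrite eE; exact: qx.
move=> y /= By; apply: rU => /=.
apply: le_lt_trans kr; apply: le_trans (enorm_sum _) _.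
apply: (@le_trans _ _ (\sum_(i < n) (2 * e))).
  apply: ler_sum => i _; rewrite !mxE.
  have -> : y 0 i - x 0 i = (y 0 i - ratr (q 0 i)) - (x 0 i - ratr (q 0 i)) by lra.
  apply: le_trans (ler_normB _ _) _.
  by have := qx i; have := By i; rewrite /= eE; lra.
by rewrite sumr_const card_ord -(mulr_natr (2 * e) n) (mulrC 2) -mulrA ler_pM2l// ler_pM2l// ler_nat.
Qed.

Lemma closed_measurable_rV (U : set 'rV[R]_n) : closed U -> measurable U.
Proof.
move=> cU; rewrite -(setCK U); apply: measurableC.
by apply: open_measurable_rV; exact: closed_openC.
Qed.

Lemma compact_measurable_rV (U : set 'rV[R]_n) : compact U -> measurable U.
Proof. by move=> /(compact_closed (@norm_hausdorff _ _)); exact: closed_measurable_rV. Qed.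

Lemma continuous_measurable_rV (f : 'rV[R]_n -> R) : continuous f ->
  measurable_fun [set: 'rV[R]_n] f.
Proof.
move=> cf; apply: (measurability _ (RGenOpens.measurableE R)).
move=> _ [_ [a [b ->] <-]]; rewrite setTI; apply: open_measurable_rV.
by apply: open_comp => // x _; exact: cf.
Qed.

End BorelRV.

Section MeasurableOps.
Context {R : realType} {n : nat} {d : measure_display} {T : measurableType d}.
Implicit Types (f g : T -> 'rV[R]_n) (D : set T).

Lemma measurable_coordT f D i : measurable_fun D f -> measurable_fun D (fun x => f x 0 i).
Proof. by move=> mf; apply: (measurableT_comp (@measurable_coord R n i)). Qed.

Lemma measurable_rV_addr f g D : measurable_fun D f -> measurable_fun D g ->
  measurable_fun D (fun x => f x + g x).
Proof.
move=> mf mg; apply: measurable_rV => i.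
under eq_fun do rewrite mxE.
by apply: measurable_funD; exact: measurable_coordT.
Qed.

Lemma measurable_rV_scale (a : T -> R) g D : measurable_fun D a -> measurable_fun D g ->
  measurable_fun D (fun x => a x *: g x).
Proof.
move=> mf mg; apply: measurable_rV => i.
under eq_fun do rewrite mxE.
by apply: measurable_funM => //; exact: measurable_coordT.
Qed.

Lemma measurable_rV_opp g D : measurable_fun D g -> measurable_fun D (fun x => - g x).
Proof.
move=> mg; under eq_fun do rewrite -scaleN1r.
by apply: measurable_rV_scale => //; exact: measurable_cst.
Qed.

Lemma measurable_rV_sub f g D : measurable_fun D f -> measurable_fun D g ->
  measurable_fun D (fun x => f x - g x).
Proof. by move=> mf mg; apply: measurable_rV_addr => //; exact: measurable_rV_opp. Qed.

Lemma measurable_dotp f g D : measurable_fun D f -> measurable_fun D g ->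
  measurable_fun D (fun x => dotp (f x) (g x)).
Proof.
move=> mf mg; rewrite /dotp; apply: measurable_sum => i.
by apply: measurable_funM; exact: measurable_coordT.
Qed.

Lemma measurable_enorm f D : measurable_fun D f -> measurable_fun D (fun x => enorm (f x)).
Proof.
move=> mf; apply: (measurableT_comp (f := @Num.sqrt R)).
  by apply: continuous_measurable_fun; exact: sqrt_continuous.
exact: measurable_dotp.
Qed.

End MeasurableOps.

(** * Hausdorff measure *)

Section EDiam.
Context {R : realType} {n : nat}.
Implicit Types (C : set 'rV[R]_n) (r : R).

Let dists C := [set r | exists x y, C x /\ C y /\ r = enorm (x - y)].

Lemma ediam_ge0 C : 0 <= ediam C.
Proof.
rewrite /ediam; have [[[r [x [y [Cx [Cy rE]]]]] ub]|h] := pselect (has_sup (dists C)).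
  by apply: le_trans (ub_le_sup ub _); last (by exists x, y); exact: enorm_ge0.
by rewrite sup_out.
Qed.

Lemma ediam_le C r : 0 <= r -> (forall x y, C x -> C y -> enorm (x - y) <= r) ->
  ediam C <= r.
Proof.
move=> r0 Cr; have [[[z Cz] ub]|h] := pselect (has_sup (dists C)).
  by apply: ge_sup; [exists z|move=> _ [x [y [Cx [Cy ->]]]]; exact: Cr].
by rewrite /ediam sup_out.
Qed.

(** The bound [r] guards against the default value: the supremum of an unbounded set is 0. *)
Lemma enorm_le_ediam C r x y : (forall x y, C x -> C y -> enorm (x - y) <= r) ->
  C x -> C y -> enorm (x - y) <= ediam C.
Proof.
move=> Cr Cx Cy; apply: ub_le_sup; last by exists x, y.
by exists r => _ [x' [y' [Cx' [Cy' ->]]]]; exact: Cr.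
Qed.

Lemma ediam0 : ediam (set0 : set 'rV[R]_n) = 0.
Proof. by apply/eqP; rewrite eq_le ediam_ge0 andbT; apply: ediam_le. Qed.

End EDiam.

Lemma kappa_gt0 (R : realType) k : 0 < kappa R k.
Proof.
(* The recursion goes back two steps, so two consecutive values are carried along. *)
suff : 0 < kappa R k /\ 0 < kappa R k.+1 by case.
elim: k => [|k [k0 k1]]; first by split.
split=> //; change (0 < (2 * pi / k.+2%:R) * kappa R k).
by rewrite mulr_gt0// divr_gt0// mulr_gt0// pi_gt0.
Qed.

Section Hausdorff.
Context {R : realType} {n : nat} (s : nat).
Local Notation V := 'rV[R]_n.
Implicit Types (A B : set V) (delta : R).
Local Open Scope ereal_scope.

(** The exponent is positive on purpose: with exponent 0 the empty set would have gauge 1. *)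
Let gauge (C : set V) : \bar R := (kappa R s.+1 * (ediam C / 2) ^+ s.+1)%:E.

Let gauge_ge0 C : 0 <= gauge C.
Proof. by rewrite lee_fin mulr_ge0 ?(ltW (kappa_gt0 _ _))// exprn_ge0// divr_ge0// ediam_ge0. Qed.

Let gauge0 : gauge set0 = 0.
Proof. by rewrite /gauge ediam0 mul0r expr0n mulr0. Qed.

Let small delta (C : set V) := forall x y, C x -> C y -> (enorm (x - y) <= delta)%R.

(* The discrete sigma-algebra makes every set admissible in the covers of [mu_ext],
   so that the Hausdorff premeasure becomes an instance of [mu_ext]. *)
Let discT := g_sigma_algebraType [set: set V].

Let pre delta (C : set discT) : \bar R := if `[< small delta C >] then gauge C else +oo.

Let pre_ge0 delta C : 0 <= pre delta C.
Proof. by rewrite /pre; case: ifPn => // _; exact: leey. Qed.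

Let pre0 delta : pre delta set0 = 0.
Proof. by rewrite /pre ifT ?gauge0//; apply/asboolP. Qed.

Let measurable_disc (A : set discT) : measurable A.
Proof. exact: sub_sigma_algebra. Qed.

(** [pre delta] is infinite on sets of diameter above [delta], so a cover using such a set does not
    affect the infimum. *)
Lemma hausdorff_delta_mu_ext delta :
  hausdorff_delta s.+1 delta = (mu_ext (pre delta : set discT -> \bar R) : set V -> \bar R).
Proof.
apply/funext => A; apply/eqP; rewrite eq_le; apply/andP; split.
  apply: le_ereal_inf_tmp => _ [C [_ AC] <-].
  have [H|/existsNP[i Ci]] := pselect (forall i, small delta (C i)).
    rewrite (@eq_eseriesr _ _ (gauge \o C)) => [|i _]; last by rewrite /pre ifT//; apply/asboolP.
    by apply: ereal_inf_lbound; exists C.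
  rewrite (eseries_pinfty (k := i)) ?leey// => [k _|].
    by rewrite -ltNye (lt_le_trans _ (pre_ge0 _ _)).
  by rewrite /pre ifF//; apply/negbTE/asboolPn.
apply: le_ereal_inf_tmp => _ [C [AC Cs] <-].
rewrite (@eq_eseriesr _ _ (pre delta \o C)) => [|i _]; last first.
  by rewrite /= /pre ifT//; apply/asboolP; exact: Cs.
by apply: ereal_inf_lbound; exists C.
Qed.

Lemma hausdorff_delta_ge0 delta A : 0 <= hausdorff_delta s.+1 delta A.
Proof. by rewrite hausdorff_delta_mu_ext; exact: mu_ext_ge0. Qed.

Lemma hausdorff_delta_le delta A : (0 < delta)%R ->
  hausdorff_delta s.+1 delta A <= hausdorff s.+1 A.
Proof. by move=> d0; apply: ereal_sup_ubound; exists delta. Qed.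

Lemma hausdorff_ge0 A : 0 <= hausdorff s.+1 A.
Proof.
by apply: le_trans (hausdorff_delta_ge0 1 A) (hausdorff_delta_le _ _).
Qed.

Lemma hausdorff0 : hausdorff s.+1 (set0 : set V) = 0.
Proof.
apply/eqP; rewrite eq_le hausdorff_ge0 andbT; apply: ge_ereal_sup => _ [e _ <-].
by rewrite hausdorff_delta_mu_ext mu_ext0.
Qed.

Lemma hausdorff_sub : {homo (@hausdorff R n s.+1) : A B / A `<=` B >-> A <= B}.
Proof.
move=> A B AB; apply: ge_ereal_sup => _ [e e0 <-].
apply: le_trans (hausdorff_delta_le _ e0).
by rewrite hausdorff_delta_mu_ext; exact: le_mu_ext.
Qed.

Lemma hausdorff_sigma_subadditive : sigma_subadditive (@hausdorff R n s.+1).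
Proof.
move=> A; apply: ge_ereal_sup => _ [e e0 <-].
apply: (@le_trans _ _ (\sum_(i <oo) hausdorff_delta s.+1 e (A i))).
  by rewrite hausdorff_delta_mu_ext; exact: mu_ext_sigma_subadditive.
apply: lee_nneseries => [i _ _|i _]; first exact: hausdorff_delta_ge0.
exact: hausdorff_delta_le.
Qed.

HB.instance Definition _ := isOuterMeasure.Build R V (@hausdorff R n s.+1)
  hausdorff0 hausdorff_ge0 hausdorff_sub hausdorff_sigma_subadditive.

(* Two maps are compared rather than one map and its inverse, so that no
   inverse function is ever needed. *)
Lemma hausdorff_lipschitz (T : Type) (A : set T) (f g : T -> V) (L : R) : (0 < L)%R ->
  (forall x y, A x -> A y -> enorm (f x - f y) <= L * enorm (g x - g y))%R ->
  hausdorff s.+1 (f @` A) <= (L ^+ s.+1)%:E * hausdorff s.+1 (g @` A).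
Proof.
move=> L0 fg; apply: ge_ereal_sup => _ [e e0 <-].
have Ls : (0 < L ^+ s.+1)%R by rewrite exprn_gt0.
apply: (@le_trans _ _ ((L ^+ s.+1)%:E * hausdorff_delta s.+1 (e / L) (g @` A))); last first.
  by apply: lee_wpmul2l; [rewrite lee_fin ltW|apply: hausdorff_delta_le; rewrite divr_gt0].
rewrite -lee_pdivrMl//; apply: le_ereal_inf_tmp => _ [C [AC Cs] <-].
rewrite lee_pdivrMl// -nneseriesZl => [|i _]; last first.
  exact: gauge_ge0.
pose D i := f @` (A `&` g @^-1` C i).
have DC i x y : D i x -> D i y -> (enorm (x - y) <= L * ediam (C i))%R.
  move=> [a [Aa Ca] <-] [b [Ab Cb] <-].
  apply: le_trans (fg _ _ Aa Ab) _; rewrite ler_pM2l//.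
  exact: (enorm_le_ediam (Cs i)).
apply: (@le_trans _ _ (\sum_(i <oo) gauge (D i))).
  apply: ereal_inf_lbound; exists D => //; split.
    move=> _ [a Aa <-]; have [i _ Ci] := AC _ (imageP g Aa).
    by exists i => //; exists a.
  move=> i x y Dx Dy; apply: le_trans (DC _ _ _ Dx Dy) _.
  rewrite mulrC -ler_pdivlMr//; apply: ediam_le; last exact: Cs.
  by rewrite divr_ge0// ltW.
apply: lee_nneseries => [i _ _|i _]; first exact: gauge_ge0.
rewrite -EFinM lee_fin mulrCA ler_pM2l ?kappa_gt0//.
rewrite -exprMn lerXn2r ?nnegrE ?mulr_ge0 ?divr_ge0 ?ediam_ge0 ?(ltW L0)//.
rewrite mulrA ler_pM2r ?invr_gt0//; apply: ediam_le; last exact: DC.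
by rewrite mulr_ge0 ?ediam_ge0 ?ltW.
Qed.

Lemma hausdorff_isometry (T : Type) (A : set T) (f g : T -> V) :
  (forall x y, A x -> A y -> enorm (f x - f y) = enorm (g x - g y)) ->
  hausdorff s.+1 (f @` A) = hausdorff s.+1 (g @` A).
Proof.
move=> fg; apply/eqP; rewrite eq_le; apply/andP; split.
  rewrite -[leRHS]mul1e -(expr1n _ s.+1); apply: hausdorff_lipschitz => // x y Ax Ay.
  by rewrite mul1r fg.
rewrite -[leRHS]mul1e -(expr1n _ s.+1); apply: hausdorff_lipschitz => // x y Ax Ay.
by rewrite mul1r fg.
Qed.

Lemma hausdorff_scale (A : set V) (a : R) : (0 < a)%R ->
  hausdorff s.+1 ( *:%R a @` A) = (a ^+ s.+1)%:E * hausdorff s.+1 A.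
Proof.
move=> a0; have as0 : (0 < a ^+ s.+1)%R by rewrite exprn_gt0.
apply/eqP; rewrite eq_le; apply/andP; split.
  rewrite -{2}(image_id A); apply: hausdorff_lipschitz => // x y _ _.
  by rewrite -scalerBr enormZ gtr0_norm.
rewrite -lee_pdivlMl// -exprVn -{1}(image_id A).
apply: hausdorff_lipschitz => [|x y _ _]; first by rewrite invr_gt0.
by rewrite -scalerBr enormZ gtr0_norm// mulrA mulVf ?mul1r ?lt0r_neq0.
Qed.

(** A set of diameter below q - p cannot meet both slabs, so a fine cover of the union splits into
    covers of the two parts without any loss. *)
Lemma hausdorff_slabs (A B : set V) i (p q : R) : (p < q)%R ->
  (forall x, A x -> x 0%R i <= p)%R -> (forall x, B x -> q < x 0%R i)%R ->
  hausdorff s.+1 A + hausdorff s.+1 B <= hausdorff s.+1 (A `|` B).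
Proof.
move=> pq Ap Bq.
pose H e (X : set V) := hausdorff_delta s.+1 e X.
have mono e1 e2 (X : set V) : (e1 <= e2)%R -> H e2 X <= H e1 X.
  move=> e12; apply: le_ereal_inf => _ [C [XC Cs] <-]; exists C => //; split => // k x y Cx Cy.
  by apply: le_trans (Cs _ _ _ Cx Cy) _.
have [->|Tfin] := eqVneq (hausdorff s.+1 (A `|` B)) +oo; first by rewrite leey.
have Toofin X : X `<=` A `|` B -> hausdorff s.+1 X \is a fin_num.
  move=> XAB; rewrite ge0_fin_numE ?hausdorff_ge0//.
  by rewrite (le_lt_trans (hausdorff_sub XAB))// ltey.
(* The premeasures grow as the mesh shrinks, so a common small mesh suffices. The two suprema are
   then taken one after the other, for which the meshes must be independent, as in [K2]. *)
suff {Tfin}K e : (0 < e)%R -> (e < q - p)%R -> H e A + H e B <= hausdorff s.+1 (A `|` B).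
  have K2 e1 e2 : (0 < e1)%R -> (0 < e2)%R -> H e1 A + H e2 B <= hausdorff s.+1 (A `|` B).
    move=> e10 e20; pose e := Num.min e1 (Num.min e2 ((q - p) / 2)%R).
    apply: (@le_trans _ _ (H e A + H e B)).
      by apply: leeD; apply: mono; rewrite /e !ge_min lexx ?orbT.
    by apply: K; rewrite /e ?lt_min ?gt_min ?e10 ?e20/=; lra.
  have finB : hausdorff s.+1 B \is a fin_num by apply: Toofin; exact: subsetUr.
  rewrite -leeBrDr//; apply: ge_ereal_sup => _ [e1 e10 <-].
  have finA : H e1 A \is a fin_num.
    rewrite ge0_fin_numE ?hausdorff_delta_ge0//.
    apply: le_lt_trans (hausdorff_delta_le _ e10) _.
    by rewrite -ge0_fin_numE ?hausdorff_ge0//; apply: Toofin; exact: subsetUl.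
  rewrite leeBrDr// -leeBrDl//; apply: ge_ereal_sup => _ [e2 e20 <-].
  by rewrite leeBrDl//; exact: K2.
move=> e0 eqp; apply: le_trans (hausdorff_delta_le _ e0).
apply: le_ereal_inf_tmp => _ [C [ABC Cs] <-].
pose CA k := C k `&` [set x : V | (x 0 i <= p)%R].
pose CB k := C k `&` [set x : V | (q < x 0 i)%R].
apply: (@le_trans _ _ (\sum_(k <oo) gauge (CA k) + \sum_(k <oo) gauge (CB k))).
  apply: leeD; apply: ereal_inf_lbound.
    exists CA => //; split => [x Ax|k x y [Cx _] [Cy _]]; last exact: Cs Cx Cy.
    by have [|k _ Ck] := ABC x; [left|exists k => //; split => //=; exact: Ap].
  exists CB => //; split => [x Bx|k x y [Cx _] [Cy _]]; last exact: Cs Cx Cy.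
  by have [|k _ Ck] := ABC x; [right|exists k => //; split => //=; exact: Bq].
rewrite -nneseriesD//; apply: lee_nneseries => [k _ _|k _]; first exact: adde_ge0.
have sub X : X `<=` C k -> gauge X <= gauge (C k).
  move=> XC; rewrite lee_fin ler_pM2l ?kappa_gt0// lerXn2r ?nnegrE ?divr_ge0 ?ediam_ge0//.
  rewrite ler_pM2r ?invr_gt0//; apply: ediam_le; first exact: ediam_ge0.
  by move=> x y /XC Cx /XC Cy; exact: (enorm_le_ediam (Cs k)).
have [[x [Cx xp]]|nA] := pselect (CA k !=set0).
  rewrite [CB k](_ : _ = set0) ?gauge0 ?adde0; first by apply: sub => z [].
  apply/seteqP; split => // y [Cy yq].
  have := Cs _ _ _ Cy Cx; have := le_trans (ler_norm _) (coord_enorm (y - x) i).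
  by rewrite !mxE; move: xp yq eqp => /=; lra.
rewrite [CA k](_ : _ = set0) ?gauge0 ?add0e; first by apply: sub => z [].
by apply/seteqP; split => // y Cy; apply: nA; exists y.
Qed.

End Hausdorff.

Section HausdorffMeasure.
Context {R : realType} {n : nat} (s : nat).
Local Notation V := 'rV[R]_n.
Local Notation H := (@hausdorff R n s.+1).
Local Open Scope ereal_scope.

(* Caratheodory's criterion: H is additive over slabs at positive distance, and the
   slabs [c_(k+2) < x_i <= c_(k+1)] of equal parity are pairwise separated, so that the
   part of X between the hyperplanes x_i = a and x_i = c_k becomes negligible. *)
Lemma caratheodory_halfspace i (a : R) :
  H.-caratheodory [set x : V | (a < x 0%R i)%R].
Proof.
apply: le_caratheodory_measurable => X /=.
have [->|Xfin] := eqVneq (H X) +oo; first by rewrite leey.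
have {}Xfin : H X < +oo by rewrite ltey.
pose c k : R := (a + k.+1%:R^-1)%R.
have cS k l : (k < l)%N -> (c l < c k)%R.
  by move=> kl; rewrite ltrD2l ltf_pV2 ?posrE// ltr_nat.
pose Y k := X `&` [set x : V | (c k < x 0%R i)%R].
pose Z k := X `&` [set x : V | (c k.+2 < x 0%R i <= c k.+1)%R].
have S b N : \sum_(j < N) H (Z (j.*2 + b)%N) <= H (Y (N.*2 + b)%N).
  elim: N => [|N IH]; first by rewrite big_ord0 hausdorff_ge0.
  rewrite big_ord_recr/=; apply: le_trans (leeD IH (lexx _)) _; rewrite addeC.
  apply: le_trans (@hausdorff_slabs _ _ _ _ _ i (c (N.*2 + b).+1) (c (N.*2 + b)%N) _ _ _) _.
  - exact: cS.
  - by move=> x [_ /andP[]].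
  - by move=> x [].
  - apply: hausdorff_sub => x [[Xx /andP[x1 _]]|[Xx x1]]; split => //=.
    by apply: lt_trans x1; rewrite doubleS; exact: cS.
pose t b N := \sum_(N <= j <oo) H (Z (j.*2 + b)%N).
have tail b : t b N @[N --> \oo] --> 0.
  apply: nneseries_tail_cvg => [|k _]; last exact: hausdorff_ge0.
  apply: le_lt_trans Xfin; apply: lime_le.
    by apply: is_cvg_nneseries => k _ _; exact: hausdorff_ge0.
  apply: nearW => N; rewrite big_mkord; apply: le_trans (S b N) _.
  by apply: hausdorff_sub => x [].
have cover N : H (X `&` [set x : V | (a < x 0%R i)%R]) <= H (Y N.*2.+1) + (t 0%N N + t 1%N N).
  pose F b := \bigcup_(j in ~` `I_N) Z (j.*2 + b)%N.
  apply: (@le_trans _ _ (H (Y N.*2.+1 `|` (F 0%N `|` F 1%N)))).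
    apply: hausdorff_sub => x [Xx /= ax].
    have [xc|xc] := ltP (c N.*2.+1) (x 0%R i); first by left.
    right; have ex : exists m, (c m < x 0%R i)%R.
      exists (Num.truncn (x 0%R i - a)^-1); rewrite /c -ltrBrDl invf_plt ?posrE ?subr_gt0//.
      exact: truncnS_gt.
    case: (ex_minnP ex) => m cm mmin.
    have m1 : (N.*2.+1 < m)%N.
      rewrite ltnNge; apply/negP; rewrite leq_eqVlt => /orP[/eqP E|/cS E].
        by move: cm; rewrite E ltNge xc.
      by move: cm; rewrite ltNge (le_trans xc (ltW E)).
    case: m m1 cm mmin => [//|[//|k]] m1 cm mmin.
    have Zk : Z k x.
      split => //=; rewrite cm/= leNgt; apply/negP => /mmin.
      by rewrite ltnn.
    have kE : k = (k./2.*2 + odd k)%N by rewrite addnC odd_double_half.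
    have kN : (N <= k./2)%N by rewrite -(doubleK N); apply: half_leq; rewrite -ltnS -ltnS.
    case: (odd k) kE => kE; [right|left]; exists k./2; rewrite /= -?kE//.
    - by apply/negP; rewrite -leqNgt.
    - by apply/negP; rewrite -leqNgt.
  apply: le_trans (outer_measureU2 _ _ _) _; apply: leeD => //.
  apply: le_trans (outer_measureU2 _ _ _) _; apply: leeD.
    exact: (outer_measure_sigma_subadditive_tail _ _ (fun j => Z (j.*2 + 0)%N)).
  exact: (outer_measure_sigma_subadditive_tail _ _ (fun j => Z (j.*2 + 1)%N)).
have L : (H X + (t 0%N N + t 1%N N)) @[N --> \oo] --> H X.
  rewrite -[X in _ --> X]adde0; apply: cvgeD; [by rewrite fin_num_adde_defl|exact: cvg_cst|].
  by rewrite -[X in _ --> X]adde0; apply: cvgeD.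
rewrite addeC; apply: (cvge_ge _ L).
apply: nearW => N; apply: (@le_trans _ _
  (H (X `&` ~` [set x : V | (a < x 0%R i)%R]) + (H (Y N.*2.+1) + (t 0%N N + t 1%N N)))).
  by apply: leeD.
rewrite addeA; apply: leeD => //.
apply: le_trans (@hausdorff_slabs _ _ _ _ _ i a (c N.*2.+1) _ _ _) _.
- by rewrite ltrDl invr_gt0.
- by move=> x [_ /= /negP]; rewrite -leNgt.
- by move=> x [].
- by apply: hausdorff_sub => x [[]|[]].
Qed.

(** Caratheodory sets form a sigma-algebra, and the half-spaces of the coordinates generate the
    Borel sets. *)
Lemma measurable_caratheodory (A : set V) : measurable A -> H.-caratheodory A.
Proof.
move: A; apply: smallest_sub.
  split => [|A cA|F cF].
  - exact: caratheodory_measurable_set0.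
  - by rewrite setTD; exact: caratheodory_measurable_setC.
  - exact: caratheodory_measurable_bigcup.
move=> A; rewrite -bigcup_seq => -[i /= _ [C mC <-]].
suff : measurable_fun [set: caratheodory_type H] (fun x : V => x 0%R i).
  by move=> /(_ measurableT _ mC); rewrite setTI.
apply: (measurability _ (RGenOInfty.measurableE R)).
move=> _ [_ [a ->] <-]; rewrite setTI.
rewrite (_ : _ @^-1` _ = [set x : V | (a < x 0%R i)%R]); first exact: caratheodory_halfspace.
by apply/seteqP; split => x /=; rewrite in_itv/= andbT.
Qed.

Lemma hausdorff_sigma_additive : semi_sigma_additive H.
Proof.
move=> F mF tF mU; apply: (@caratheodory_measure_sigma_additive _ _ H) => //.
- by move=> k; exact: measurable_caratheodory.
- exact: measurable_caratheodory.
Qed.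

HB.instance Definition _ := isMeasure.Build _ V R (@hausdorff R n s.+1)
  (hausdorff0 s) (hausdorff_ge0 s) hausdorff_sigma_additive.

End HausdorffMeasure.

(** * Local finiteness of the Hausdorff measure on a coordinate hyperplane *)

Section Grid.
Context {R : realType} {d : nat}.
Local Notation V := 'rV[R]_d.+2.
Local Notation H := (@hausdorff R d.+2 d.+1).

Lemma hausdorff_delta_seq (e : R) (A : set V) (ls : seq (set V)) :
  (forall x, A x -> exists2 C, C \in ls & C x) ->
  (forall C, C \in ls -> forall x y, C x -> C y -> enorm (x - y) <= e) ->
  (hausdorff_delta d.+1 e A <= (\sum_(C <- ls) kappa R d.+1 * (ediam C / 2) ^+ d.+1)%:E)%E.
Proof.
move=> Als lse.
pose g (C : set V) := (kappa R d.+1 * (ediam C / 2) ^+ d.+1)%:E.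
have g0 C : (0 <= g C)%E.
  by rewrite lee_fin mulr_ge0 ?(ltW (kappa_gt0 _ _))// exprn_ge0// divr_ge0// ediam_ge0.
(* The list is continued by empty sets, whose gauge is 0. *)
apply: (@le_trans _ _ (\sum_(k <oo) g (nth set0 ls k))%E).
  apply: ereal_inf_lbound; exists (nth set0 ls) => //; split => [x /Als[C Cls Cx]|k].
    by exists (index C ls) => //; rewrite nth_index.
  have [kls|kls] := ltnP k (size ls); last by rewrite nth_default.
  by apply: lse; exact: mem_nth.
rewrite (nneseries_split _ (size ls)) => [|k _]; last exact: g0.
rewrite eseries0 => [|k + _]; last first.
  by rewrite add0n => kls; rewrite nth_default// /g ediam0 mul0r expr0n mulr0.
by rewrite adde0 add0n sumEFin -(big_nth set0 xpredT (fun C => kappa R d.+1 * (ediam C / 2) ^+ d.+1)).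
Qed.

(** A cube of dimension d+1 is cut into N^(d+1) cells; their total gauge does not depend on N. Only
    finiteness matters, so the bound is crude. *)
Lemma hausdorff_coord_hyperplane_bounded (r : R) : 0 < r ->
  (H [set x : V | (x 0 ord0 = 0 /\ forall i, `|x 0 i| < r)%R] < +oo)%E.
Proof.
move=> r0; set A := [set x | _].
(* A cell of side 2r/N has diameter at most (d+1) 2r/N by the sum of its sides; N^(d+1) such gauges
   add up to [M]. *)
pose M : R := kappa R d.+1 * (d.+1%:R * r) ^+ d.+1.
apply: (@le_lt_trans _ _ M%:E); last exact: ltry.
apply: ge_ereal_sup => _ [e /= e0 <-].
(* Just fine enough for the cells to have diameter at most [e]. *)
pose N := (Num.truncn (d.+1%:R * (2 * r) / e)).+1.
have N0 : 0 < N%:R :> R by rewrite ltr0n.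
have Ne : d.+1%:R * (2 * r / N%:R) <= e.
  have := truncnS_gt (d.+1%:R * (2 * r) / e); rewrite ltr_pdivrMr// => NE.
  by rewrite mulrA ler_pdivrMr// [leRHS]mulrC; exact: ltW.
pose cell (f : {ffun 'I_d.+1 -> 'I_N}) : set V := [set x : V | x 0 ord0 = 0 /\
  forall j, (f j)%:R <= (x 0 (lift ord0 j) + r) * N%:R / (2 * r) <= (f j).+1%:R].
have celld f x y : cell f x -> cell f y -> enorm (x - y) <= d.+1%:R * (2 * r / N%:R).
  move=> [x0 xf] [y0 yf]; apply: le_trans (enorm_sum _) _.
  rewrite big_ord_recl !mxE x0 y0 subr0 normr0 add0r.
  apply: (@le_trans _ _ (\sum_(j < d.+1) (2 * r / N%:R))); last first.
    by rewrite sumr_const card_ord -[leLHS]mulr_natl.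
  apply: ler_sum => j _; rewrite !mxE.
  have /andP[x1 x2] := xf j; have /andP[y1 y2] := yf j.
  have K : `|(x 0 (lift ord0 j) + r) * N%:R / (2 * r) - (y 0 (lift ord0 j) + r) * N%:R / (2 * r)| <= 1.
    have fj : (f j).+1%:R = (f j)%:R + 1 :> R by rewrite -natr1.
    move: x1 x2 y1 y2; rewrite fj; set p := _ / (2 * r); set q := _ / (2 * r) => x1 x2 y1 y2.
    by rewrite ler_norml; apply/andP; split; lra.
  have -> : x 0 (lift ord0 j) - y 0 (lift ord0 j) = ((x 0 (lift ord0 j) + r) * N%:R / (2 * r) -
      (y 0 (lift ord0 j) + r) * N%:R / (2 * r)) * (2 * r / N%:R).
    by field; rewrite ?lt0r_neq0// mulr_gt0.
  rewrite normrM [X in _ * X]ger0_norm; last by rewrite divr_ge0 ?mulr_ge0// ltW.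
  by rewrite ler_piMl// divr_ge0 ?mulr_ge0// ltW.
apply: le_trans (@hausdorff_delta_seq e A [seq cell f | f : {ffun 'I_d.+1 -> 'I_N}] _ _) _.
- move=> x [x0 xr].
  have B j : 0 <= (x 0 (lift ord0 j) + r) * N%:R / (2 * r) < N%:R.
    have := xr (lift ord0 j); rewrite ltr_norml => /andP[x1 x2]; apply/andP; split.
      by rewrite divr_ge0 ?mulr_ge0//; lra.
    by rewrite ltr_pdivrMr ?mulr_gt0// mulrC ltr_pM2l//; lra.
  have Bn j : (Num.truncn ((x 0 (lift ord0 j) + r) * N%:R / (2 * r))%R < N)%N.
    have /andP[b1 b2] := B j; rewrite -(ltr_nat R) (le_lt_trans _ b2)//.
    by have /andP[] := truncn_itv b1.
  exists (cell [ffun j => Ordinal (Bn j)]); first by apply/mapP; eexists; [rewrite mem_enum|reflexivity].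
  split => // j; rewrite ffunE /=; have /andP[b1 b2] := B j.
  have := truncn_itv b1; set m := Num.truncn _.
  by case/andP => [c1 c2]; rewrite c1 ltW.
- by move=> C /mapP[f _ ->] x y Cx Cy; apply: le_trans (celld _ _ _ Cx Cy) _.
rewrite lee_fin big_map.
apply: (@le_trans _ _ (\sum_(f <- enum {ffun 'I_d.+1 -> 'I_N}) kappa R d.+1 * (d.+1%:R * (r / N%:R)) ^+ d.+1)).
  apply: ler_sum => f _; rewrite ler_pM2l ?kappa_gt0//.
  rewrite lerXn2r ?nnegrE ?divr_ge0 ?ediam_ge0 ?mulr_ge0 ?(ltW r0)//.
  rewrite ler_pdivrMr//; apply: (@le_trans _ _ (d.+1%:R * (2 * r / N%:R))).
    apply: ediam_le; last exact: celld.
    by rewrite mulr_ge0// divr_ge0 ?mulr_ge0// ltW.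
  by rewrite le_eqVlt; apply/orP; left; apply/eqP; ring.
rewrite big_const_seq count_predT -cardE card_ffun !card_ord iter_addr_0 -[leLHS]mulr_natr natrX.
by rewrite -mulrA -exprMn -mulrA mulfVK ?lt0r_neq0.
Qed.

End Grid.

(** * Hyperplane measures and volume *)

Section MeasureTools.
Context d1 d2 (T1 : measurableType d1) (T2 : measurableType d2) (R : realType).
Local Open Scope ereal_scope.

Lemma ge0_integral_image (m1 : {measure set T1 -> \bar R}) (m2 : {measure set T2 -> \bar R})
    (phi : T1 -> T2) (f : T2 -> \bar R) : measurable_fun setT phi ->
  (forall A, measurable A -> m2 A = m1 (phi @^-1` A)) ->
  measurable_fun setT f -> (forall x, 0 <= f x) ->
  \int[m2]_x f x = \int[m1]_x f (phi x).
Proof.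
move=> mphi m12 mf f0.
have := @ge0_integral_pushforward _ _ _ _ _ _ mphi m1 setT f measurableT mf (fun y _ => f0 y).
rewrite preimage_setT => <-.
pose Phi : {mfun T1 >-> T2} := HB.pack phi (isMeasurableFun.Build _ _ _ _ _ mphi).
apply: (@eq_measure_integral _ _ _ _ (pushforward m1 Phi)) => A mA _.
by rewrite m12.
Qed.

Lemma fubini_sections (m1 : {sigma_finite_measure set T1 -> \bar R})
    (m2 : {sigma_finite_measure set T2 -> \bar R}) (E : set (T1 * T2)) : measurable E ->
  \int[m1]_x m2 (xsection E x) = \int[m2]_y m1 (ysection E y).
Proof.
move=> mE; have := indic_fubini_tonelli m1 m2 mE.
by rewrite indic_fubini_tonelli_FE// indic_fubini_tonelli_GE.
Qed.

End MeasureTools.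

Section Lebesgue1.
Context {R : realType}.
Local Notation leb := (@lebesgue_measure R).
Implicit Types (A : set (measurableTypeR R)).

Lemma lebesgue_measure_shift (a : R) A : measurable A -> leb [set t | A (t + a)] = leb A.
Proof.
move=> mA.
have mf : measurable_fun [set: measurableTypeR R] (fun t : R => t + a : measurableTypeR R).
  by apply: measurable_funD.
pose Phi : {mfun measurableTypeR R >-> measurableTypeR R} :=
  HB.pack (fun t : R => t + a) (isMeasurableFun.Build _ _ _ _ _ mf).
apply/esym; apply: (@lebesgue_measure_unique _ (pushforward leb Phi)) => //= _ [[b c]] _ <-.
rewrite /pushforward (_ : _ @^-1` _ = `]b - a, c - a]%classic); last first.
  by apply/seteqP; split => t /=; rewrite !in_itv/= ltrBlDr lerBrDr.
by rewrite !lebesgue_measure_itv/= !lte_fin ltrD2r; case: ifP => // _; congr EFin; lra.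
Qed.

Lemma lebesgue_measure_scale (k : R) A : 0 < k -> measurable A ->
  leb [set t | A (k * t)] = (k^-1%:E * leb A)%E.
Proof.
move=> k0 mA.
have mf : measurable_fun [set: measurableTypeR R] (fun t : R => k * t : measurableTypeR R).
  by apply: measurable_funM.
pose Phi : {mfun measurableTypeR R >-> measurableTypeR R} :=
  HB.pack (fun t : R => k * t) (isMeasurableFun.Build _ _ _ _ _ mf).
pose kk : {nonneg R} := NngNum (ltW k0).
have K := @lebesgue_measure_unique _ (mscale kk (pushforward leb Phi)) _ A mA.
rewrite (K mf) {K}.
  by rewrite /mscale/= muleA -EFinM mulVf ?gt_eqF// mul1e.
move=> _ [[b c]] _ <-.
rewrite [RHS](_ : _ = (k%:E * leb (`](b / k)%R, (c / k)%R]%classic))%E); last first.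
  congr (_ * leb _)%E.
  by apply/seteqP; split => t /=; rewrite !in_itv/= ltr_pdivrMr// ler_pdivlMr// !(mulrC t).
rewrite !lebesgue_measure_itv/= !lte_fin ltr_pM2r ?invr_gt0//; case: ifP => _.
  by rewrite -!EFinB -EFinM; congr EFin; field; rewrite gt_eqF.
by rewrite mule0.
Qed.

End Lebesgue1.

Section Reflection.
Context {R : realType} {n : nat}.
Implicit Types (u v w x y : 'rV[R]_n).

(* The reflection exchanging u and v; when u = v the quotient is x / 0 = 0 and this is
   the identity. *)
Definition reflect_between u v x : 'rV[R]_n :=
  x - (2 * dotp x (u - v) / dotp (u - v) (u - v)) *: (u - v).

Lemma reflect_betweenB u v x y :
  reflect_between u v x - reflect_between u v y = reflect_between u v (x - y).
Proof.
rewrite /reflect_between [dotp (x - y) _]dotpBl mulrBr mulrBl scalerBl.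
by apply/rowP => i; rewrite !mxE; ring.
Qed.

Lemma dotp_reflect_between u v x y :
  dotp (reflect_between u v x) (reflect_between u v y) = dotp x y.
Proof.
rewrite /reflect_between; move: (u - v) => w; have [->|w0] := eqVneq w 0.
  by rewrite !scaler0 !subr0.
have ww : dotp w w != 0 by rewrite dotp_eq0.
by rewrite !dotpE (dotpC w y); field.
Qed.

Lemma reflect_betweenK u v : involutive (reflect_between u v).
Proof.
move=> x; rewrite /reflect_between; move: (u - v) => w; have [->|w0] := eqVneq w 0.
  by rewrite !scaler0 !subr0.
have ww : dotp w w != 0 by rewrite dotp_eq0.
set a := 2 * dotp x w / dotp w w; rewrite dotpBl dotpZl.
have -> : 2 * (dotp x w - a * dotp w w) / dotp w w = - a by rewrite /a; field.
by rewrite scaleNr opprK subrK.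
Qed.

Lemma enorm_reflect_between u v x : enorm (reflect_between u v x) = enorm x.
Proof. by rewrite /enorm dotp_reflect_between. Qed.

Lemma reflect_between_l u v : enorm u = 1 -> enorm v = 1 -> reflect_between u v u = v.
Proof.
move=> /dotp_enorm1 u1 /dotp_enorm1 v1; rewrite /reflect_between; set w := u - v.
have [w0|w0] := eqVneq w 0; first by rewrite w0 scaler0 subr0; apply/eqP; rewrite -subr_eq0 -/w w0.
(* For unit vectors both sides equal 2 - 2 u.v. *)
have E : 2 * dotp u w = dotp w w.
  by rewrite /w !dotpE u1 v1 (dotpC v u); ring.
by rewrite E divff ?dotp_eq0// scale1r /w opprB addrC subrK.
Qed.

End Reflection.

Section Planes.
Context {R : realType} {d : nat}.
Local Notation V := 'rV[R]_d.+2.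
Local Notation H := (@hausdorff R d.+2 d.+1).
Local Notation leb := (@lebesgue_measure R).
Local Open Scope ereal_scope.

(** Bundling the norm condition lets sigma-finiteness of [plane_measure u] be found as an
    instance. *)
Record unit_vector := UnitVector { uvec :> V; uvecP : enorm uvec = 1%R }.
Implicit Types (u v m : unit_vector).

Lemma dotp_uu u : dotp (u : V) u = 1%R.
Proof. exact/dotp_enorm1/uvecP. Qed.

Definition plane (u : V) : set V := [set y | dotp y u = 0%R].

Lemma measurable_plane (u : V) : measurable (plane u).
Proof.
apply: closed_measurable_rV.
rewrite (_ : plane u = (fun y => `|dotp y u|%R) @^-1` [set r | (r <= 0)%R]); last first.
  by apply/seteqP; split => y; rewrite /plane/= normr_le0 => /eqP.
apply: preimage_closed => [x _|]; last exact: closed_le.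
apply: (@continuous_comp _ _ _ (fun y => dotp y u) Num.norm); last exact: norm_continuous.
apply: (@continuous_dotp _ _ _ id (cst u)); first by move=> ?; exact: cvg_id.
exact: cst_continuous.
Qed.

Definition plane_measure (u : V) : set V -> \bar R := mrestr H (measurable_plane u).
HB.instance Definition _ (u : V) := Measure.on (plane_measure u).

(** The reflection is an isometry exchanging [u] and [v], hence also their orthogonal hyperplanes.
    Questions on a hyperplane can thus be moved to a coordinate hyperplane. *)
Lemma plane_measure_reflect u v (A : set V) :
  plane_measure v A = plane_measure u (reflect_between u v @^-1` A).
Proof.
rewrite /plane_measure /mrestr.
have -> : A `&` plane v = reflect_between u v @` (reflect_between u v @^-1` A `&` plane u).
  apply/seteqP; split => [x [Ax xv]|_ [x [Ax xu] <-]].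
    exists (reflect_between u v x); rewrite ?reflect_betweenK//.
    split; rewrite /= ?reflect_betweenK// /plane /=.
    by rewrite -(dotp_reflect_between u v _ u) reflect_betweenK reflect_between_l ?uvecP.
  split => //; move: xu; rewrite /plane /= -(dotp_reflect_between u v x u).
  by rewrite reflect_between_l ?uvecP.
rewrite -[in RHS](image_id (_ `&` plane u)).
apply: hausdorff_isometry => x y _ _.
by rewrite reflect_betweenB enorm_reflect_between.
Qed.

Lemma plane_measure_bounded u (r : R) : plane_measure u [set x : V | (enorm x < r)%R] < +oo.
Proof.
pose e0 : unit_vector := UnitVector (enorm_delta (ord0 : 'I_d.+2)).
rewrite (plane_measure_reflect e0 u) /plane_measure /mrestr.
have [r0|r0] := leP r 0%R.
  rewrite (_ : _ `&` _ = set0) ?hausdorff0//.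
  by apply/seteqP; split => // x [/= + _]; rewrite ltNge (le_trans r0)// enorm_ge0.
apply: le_lt_trans (hausdorff_coord_hyperplane_bounded r0).
apply: hausdorff_sub => x [/= xr]; rewrite /plane /= dotp_deltar => x0; split => // i.
by apply: le_lt_trans (coord_enorm x i) _; rewrite enorm_reflect_between in xr.
Qed.

Lemma measurable_ball_rV (r : R) : measurable [set x : V | (enorm x < r)%R].
Proof.
have H : measurable_fun setT (@enorm R d.+2) := measurable_enorm (@measurable_id _ _ setT).
have := H measurableT _ (measurable_itv `]-oo, r[).
by rewrite setTI; congr measurable; apply/seteqP; split => x /=; rewrite in_itv.
Qed.

Lemma plane_measure_sigma_finite u : sigma_finite setT (plane_measure u).
Proof.
exists (fun k => [set x : V | (enorm x < k%:R)%R]) => [|k].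
  apply/seteqP; split => // x _; exists (Num.truncn (enorm x)).+1 => //=.
  exact: truncnS_gt.
by split; [exact: measurable_ball_rV|exact: plane_measure_bounded].
Qed.

HB.instance Definition _ u := Measure_isSigmaFinite.Build _ _ _ (plane_measure u)
  (plane_measure_sigma_finite u).

Lemma plane_measure_shift u (w : V) (A : set V) : plane u w ->
  plane_measure u [set x | A (x + w)%R] = plane_measure u A.
Proof.
move=> uw; rewrite /plane_measure /mrestr.
have -> : A `&` plane u = (fun x => x + w)%R @` ([set x | A (x + w)%R] `&` plane u).
  apply/seteqP; split => [x [Ax xu]|_ [x [Ax xu] <-]].
    exists (x - w)%R; rewrite ?subrK//; split; rewrite /= ?subrK//.
    by rewrite /plane /= dotpBl xu uw subrr.
  by split => //; rewrite /plane/= dotpDl xu uw addr0.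
rewrite -[in LHS](image_id (_ `&` plane u)).
by apply: hausdorff_isometry => x y _ _; rewrite opprD addrACA subrr addr0.
Qed.

End Planes.

(** * Uniqueness of translation invariant measures *)

Section Haar.
Context {R : realType} {n : nat}.
Local Notation V := 'rV[R]_n.
Local Open Scope ereal_scope.

Lemma measurable_preimage d1 d2 (T1 : measurableType d1) (T2 : measurableType d2)
  (f : T1 -> T2) (A : set T2) : measurable_fun setT f -> measurable A -> measurable (f @^-1` A).
Proof. by move=> mf mA; rewrite -[X in measurable X]setTI; exact: mf. Qed.

(* Tonelli on the set of pairs with x + y in A and y in B, computed in two ways. *)
Lemma translation_invariant_unique (mu nu : {sigma_finite_measure set V -> \bar R}) (A B : set V) :
  (forall (A : set V) (w : V), measurable A -> mu [set x : V | A (x + w)%R] = mu A) ->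
  (forall (A : set V) (w : V), measurable A -> nu [set x : V | A (x + w)%R] = nu A) ->
  measurable A -> measurable B -> mu A * nu B = nu A * mu [set x : V | B (- x)%R].
Proof.
move=> muT nuT mA mB.
have madd : measurable_fun setT (fun p : V * V => p.1 + p.2)%R by exact: measurable_rV_addr.
have msub : measurable_fun setT (fun p : V * V => p.2 - p.1)%R by exact: measurable_rV_sub.
have mopp : measurable_fun setT (fun x : V => - x)%R by exact: measurable_rV_opp.
pose E1 : set (V * V) := [set p | A (p.1 + p.2)%R] `&` [set p | B p.2].
pose E2 : set (V * V) := [set p | A p.2] `&` [set p | B (p.2 - p.1)%R].
have mE1 : measurable E1.
  apply: measurableI; first exact: (measurable_preimage madd).
  exact: (measurable_preimage measurable_snd).
have mE2 : measurable E2.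
  apply: measurableI; first exact: (measurable_preimage measurable_snd).
  exact: (measurable_preimage msub).
have -> : mu A * nu B = \int[nu]_y mu (ysection E1 y).
  rewrite -integral_cst// integral_mkcond; apply: eq_integral => y _; rewrite patchE.
  case: ifPn => [/set_mem By|/negP yB]; rewrite /ysection/=.
    rewrite -(muT A y mA); congr (mu _); apply/seteqP; split => x /=.
      by rewrite inE; split.
    by rewrite inE => -[].
  rewrite (_ : mkset _ = set0) ?measure0//; apply/seteqP; split => // x /=.
  by rewrite inE => -[_ By]; apply: yB; rewrite inE.
rewrite -fubini_sections//.
have -> : nu A * mu [set x : V | B (- x)%R] = \int[nu]_y mu (ysection E2 y).
  rewrite muleC -integral_cst// integral_mkcond; apply: eq_integral => y _; rewrite patchE.
  case: ifPn => [/set_mem Ay|/negP yA]; rewrite /ysection/=.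
    rewrite -(muT _ (- y)%R); last exact: (measurable_preimage mopp).
    congr (mu _); apply/seteqP; split => x /=.
      by rewrite opprB inE; split.
    by rewrite opprB inE => -[].
  rewrite (_ : mkset _ = set0) ?measure0//; apply/seteqP; split => // x /=.
  by rewrite inE => -[Ay _]; apply: yA; rewrite inE.
rewrite -fubini_sections//; apply: eq_integral => x _.
rewrite -(nuT (xsection E2 x) x); last exact: measurable_xsection.
congr (nu _); apply/seteqP; split => y /=; rewrite /xsection/= !inE /E1 /E2 /= addrK addrC.
  by [].
by [].
Qed.

End Haar.

(** * Volume by fibring along a direction, and its independence of the direction *)

Section Volume.
Context {R : realType} {d : nat}.
Local Notation V := 'rV[R]_d.+2.
Local Notation H := (@hausdorff R d.+2 d.+1).
Local Notation leb := (@lebesgue_measure R).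
Local Open Scope ereal_scope.
Implicit Types (u v m : @unit_vector R d).

Lemma plane_measureE (u : V) (A : set V) : plane_measure u A = H (A `&` plane u).
Proof. by []. Qed.

Lemma ae_plane u : {ae plane_measure u, forall y, plane u y}.
Proof.
exists (~` plane u); split => //; first by apply: measurableC; exact: measurable_plane.
by rewrite plane_measureE setICl measure0.
Qed.

Lemma eq_plane_integral u (f g : V -> \bar R) :
  measurable_fun setT f -> measurable_fun setT g -> (forall y, plane u y -> f y = g y) ->
  \int[plane_measure u]_y f y = \int[plane_measure u]_y g y.
Proof.
move=> mf mg fg; apply: ae_eq_integral => //.
by apply: filterS (ae_plane u) => y uy _; exact: fg.
Qed.

Definition line_point (u : V) (p : V * measurableTypeR R) : V := (p.1 + (p.2 : R) *: u)%R.

Lemma measurable_line_point u : measurable_fun setT (line_point u).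
Proof.
apply: measurable_rV_addr; first exact: measurable_fst.
by apply: measurable_rV_scale; [exact: measurable_snd|exact: measurable_cst].
Qed.

(* Lebesgue measure of V, up to a factor which is never needed, obtained by
   fibring V along the direction u. *)
Definition volume_along (u : unit_vector) (A : set V) : \bar R :=
  (plane_measure u \x leb) (line_point u @^-1` A).

Let volume0 u : volume_along u set0 = 0.
Proof. by rewrite /volume_along preimage_set0 measure0. Qed.

Let volume_ge0 u A : 0 <= volume_along u A.
Proof. exact: measure_ge0. Qed.

Let volume_sigma_additive u : semi_sigma_additive (volume_along u).
Proof.
move=> F mF tF mUF; rewrite /volume_along preimage_bigcup.
apply: measure_semi_sigma_additive.
- by move=> n; exact: (measurable_preimage (measurable_line_point u)).
- apply/trivIsetP => /= i j _ _ ij; rewrite -preimage_setI.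
  by move/trivIsetP : tF => /(_ _ _ _ _ ij) ->//; rewrite preimage_set0.
- by rewrite -preimage_bigcup; exact: (measurable_preimage (measurable_line_point u)).
Qed.

HB.instance Definition _ u := isMeasure.Build _ _ _ (volume_along u)
  (volume0 u) (volume_ge0 u) (@volume_sigma_additive u).

Lemma volume_alongE u (A : set V) :
  volume_along u A = \int[plane_measure u]_y leb [set t : R | A (y + t *: uvec u)%R].
Proof.
rewrite /volume_along /= /product_measure1; apply: eq_integral => y _ /=.
by congr (leb _); apply/seteqP; split => t; rewrite /xsection/= inE.
Qed.

Lemma measurable_fibre_length u (A : set V) : measurable A ->
  measurable_fun setT (fun y : V => leb [set t : R | A (y + t *: uvec u)%R]).
Proof.
move=> mA; have mE := measurable_preimage (measurable_line_point u) mA.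
rewrite (_ : (fun _ => _) = leb \o xsection (line_point u @^-1` A)).
  exact: measurable_fun_xsection.
apply/funext => y /=.
by congr (leb _); apply/seteqP; split => t; rewrite /xsection/= inE.
Qed.

Lemma measurable_fibre u (A : set V) (y : V) : measurable A ->
  measurable ([set t : measurableTypeR R | A (y + t *: uvec u)%R]).
Proof.
move=> mA; have mE := measurable_preimage (measurable_line_point u) mA.
have := @measurable_xsection _ _ _ _ _ y mE.
by congr measurable; apply/seteqP; split => t; rewrite /xsection/= inE.
Qed.

(** The component of [w] in the hyperplane is absorbed by the invariance of the plane measure, its
    component along [u] by the invariance of Lebesgue measure on each fibre. *)
Lemma volume_along_shift u (A : set V) (w : V) : measurable A ->
  volume_along u [set x : V | A (x + w)%R] = volume_along u A.
Proof.
move=> mA; rewrite !volume_alongE.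
pose w' : V := (w - dotp w u *: uvec u)%R.
have uw' : plane u w' by rewrite /plane/= /w' dotpBl dotpZl dotp_uu mulr1 subrr.
transitivity (\int[plane_measure u]_y leb [set t : R | A ((y + w') + t *: uvec u)%R]).
  apply: eq_integral => y _.
  rewrite -(@lebesgue_measure_shift _ (dotp w u) [set t : R | A ((y + w') + t *: uvec u)%R]).
    congr (leb _); apply/seteqP; split => t /=; congr A;
    by rewrite /w' scalerDl; apply/rowP => i; rewrite !mxE; ring.
  exact: measurable_fibre.
apply/esym; apply: (@ge0_integral_image _ _ _ _ _ _ _ (fun y : V => y + w')%R
  (fun y => leb [set t : R | A (y + t *: uvec u)%R])) => //.
- by apply: measurable_rV_addr; [exact: measurable_id|exact: measurable_cst].
- by move=> B mB; exact: (esym (@plane_measure_shift _ _ u w' B uw')).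
- exact: measurable_fibre_length.
Qed.

Let fibre_ball (r : R) (y : V) : \bar R := leb [set t | (dotp y y + t ^+ 2 < r ^+ 2)%R].

Let measurable_fibre_ball r : measurable_fun setT (fibre_ball r).
Proof.
pose E : set (V * measurableTypeR R) := [set p | (dotp p.1 p.1 + (p.2 : R) ^+ 2 < r ^+ 2)%R].
have mE : measurable E.
  have mf : measurable_fun setT (fun p : V * measurableTypeR R => (dotp p.1 p.1 + (p.2 : R) ^+ 2)%R).
    apply: measurable_funD; first by apply: measurable_dotp; exact: measurable_fst.
    by apply: measurable_funX; exact: measurable_snd.
  have := measurable_preimage mf (measurable_itv `]-oo, (r ^+ 2)%R[).
  by congr measurable; apply/seteqP; split => x /=; rewrite in_itv.
rewrite (_ : fibre_ball r = leb \o xsection E); first exact: measurable_fun_xsection.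
apply/funext => y /=.
by congr (leb _); apply/seteqP; split => t; rewrite /xsection/= inE.
Qed.

Lemma dotp_plane_line u (y : V) (t : R) : plane u y ->
  dotp (y + t *: (u : V))%R (y + t *: (u : V))%R = (dotp y y + t ^+ 2)%R.
Proof.
rewrite /plane/= => yu; rewrite !dotpE (dotpC _ y) yu dotp_uu; ring.
Qed.

Let volume_ballE u (r : R) : (0 < r)%R ->
  volume_along u [set x : V | (enorm x < r)%R] = \int[plane_measure u]_y fibre_ball r y.
Proof.
move=> r0; rewrite volume_alongE; apply: eq_plane_integral.
- by apply: measurable_fibre_length; exact: measurable_ball_rV.
- exact: measurable_fibre_ball.
- move=> y uy; congr (leb _); apply/seteqP; split => t /=.
    by rewrite -(dotp_plane_line t uy) -sqr_enorm (ltr_pXn2r (_ : 0 < 2)%N)// ?nnegrE ?enorm_ge0 ?(ltW r0).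
  by rewrite -(dotp_plane_line t uy) -sqr_enorm (ltr_pXn2r (_ : 0 < 2)%N)// ?nnegrE ?enorm_ge0 ?(ltW r0).
Qed.

(** By Pythagoras the fibre lengths of a centred ball depend on |y| only, which the reflection
    between the two hyperplanes preserves. *)
Lemma volume_ball u v (r : R) : (0 < r)%R ->
  volume_along u [set x : V | (enorm x < r)%R] = volume_along v [set x : V | (enorm x < r)%R].
Proof.
move=> r0; apply: (etrans (volume_ballE u r0)); apply: (etrans _ (esym (volume_ballE v r0))).
apply: (etrans (@ge0_integral_image _ _ _ _ _ (plane_measure v) (plane_measure u) (reflect_between v u) _ _ _ _ _)) => //.
- apply: measurable_rV_sub; first exact: measurable_id.
  apply: measurable_rV_scale; last exact: measurable_cst.
  apply: measurable_funM => //; apply: measurable_funM => //.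
  by apply: measurable_dotp => //; exact: measurable_id.
- by move=> A _; exact: plane_measure_reflect.
- by apply: eq_integral => y _; rewrite /fibre_ball dotp_reflect_between.
Qed.

Lemma volume_ball_fin u (r : R) : (0 < r)%R ->
  volume_along u [set x : V | (enorm x < r)%R] < +oo.
Proof.
move=> r0; rewrite volume_ballE//.
pose B : set V := [set x : V | (enorm x < r)%R].
apply: (@le_lt_trans _ _ (\int[plane_measure u]_(y in B) cst (2 * r)%:E y)).
  rewrite [leRHS]integral_mkcond; apply: ge0_le_integral => //.
  - by apply/(measurable_restrictT _ (measurable_ball_rV r)); exact: measurable_cst.
  - move=> y _; rewrite patchE; case: ifPn => [_|/negP yB].
      apply: (@le_trans _ _ (leb (`[(- r)%R, r]%classic))).
        apply: le_measure; rewrite ?inE//.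
          have mf : measurable_fun setT (fun t : measurableTypeR R => (dotp y y + (t : R) ^+ 2)%R).
            by apply: measurable_funD => //; apply: measurable_funX.
          have := measurable_preimage mf (measurable_itv `]-oo, (r ^+ 2)%R[).
          by congr measurable; apply/seteqP; split => x /=; rewrite in_itv.
        move=> t /= tr; rewrite in_itv/= -ler_norml -(ler_pXn2r (_ : 0 < 2)%N)// ?nnegrE ?(ltW r0)//.
        by rewrite real_normK ?num_real// ltW// (le_lt_trans _ tr)// lerDr dotp_ge0.
      rewrite lebesgue_measure_itv/= lte_fin; case: ifP => _; rewrite lee_fin; lra.
    rewrite /fibre_ball (_ : [set t | _] = set0) ?measure0//.
    apply/seteqP; split => // t /= tr; apply: yB; rewrite inE /B/=.
    rewrite -(ltr_pXn2r (_ : 0 < 2)%N)// ?nnegrE ?enorm_ge0 ?(ltW r0)// sqr_enorm.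
    by rewrite (le_lt_trans _ tr)// lerDl sqr_ge0.
rewrite integral_cst; last exact: measurable_ball_rV.
by rewrite lte_mul_pinfty ?lee_fin ?mulr_ge0 ?(ltW r0)//; exact: plane_measure_bounded.
Qed.

Lemma bigcup_ball_rV : \bigcup_k [set x : V | (enorm x < k.+1%:R)%R] = setT.
Proof.
apply/seteqP; split => // x _; exists (Num.truncn (enorm x)) => //=.
exact: truncnS_gt.
Qed.

Lemma volume_sigma_finite u : sigma_finite setT (volume_along u).
Proof.
exists (fun k => [set x : V | (enorm x < k.+1%:R)%R]) => [|k]; first by rewrite bigcup_ball_rV.
by split; [exact: measurable_ball_rV|exact: volume_ball_fin].
Qed.

HB.instance Definition _ u := Measure_isSigmaFinite.Build _ _ _ (volume_along u)
  (volume_sigma_finite u).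

(** Uniqueness with a centred ball as second set: balls are symmetric and have the same volume along
    all directions, so the ball factor cancels. *)
Lemma volume_along_indep u v (A : set V) : measurable A ->
  volume_along u A = volume_along v A.
Proof.
move=> mA.
have K (r : R) : (0 < r)%R -> volume_along u A * volume_along u [set x : V | (enorm x < r)%R] =
    volume_along v A * volume_along u [set x : V | (enorm x < r)%R].
  move=> r0; rewrite {1}(volume_ball u v r0).
  have E := @translation_invariant_unique R _ (volume_along u) (volume_along v) A
    [set x : V | (enorm x < r)%R] (fun B w mB => volume_along_shift u w mB)
    (fun B w mB => volume_along_shift v w mB) mA (measurable_ball_rV r).
  apply: etrans E _; congr (_ * volume_along _ _).
  by apply/seteqP; split => x /=; rewrite enormN.
(* Positivity of the volume of balls is never established: if all of them are null, both measures
   vanish and the claim is 0 = 0. *)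
have [[k bk]|h] := pselect (exists k : nat, volume_along u [set x : V | (enorm x < k.+1%:R)%R] != 0).
  have bfin : volume_along u [set x : V | (enorm x < k.+1%:R)%R] \is a fin_num.
    by rewrite ge0_fin_numE ?measure_ge0//; exact: volume_ball_fin.
  have b0 : 0 < volume_along u [set x : V | (enorm x < k.+1%:R)%R] by rewrite lt0e bk measure_ge0.
  have E := K k.+1%:R (ltr0Sn _ _).
  have cancel x y (b : \bar R) : b \is a fin_num -> 0 < b -> x * b = y * b -> x = y.
    by move=> bf bp e; apply/eqP; rewrite eq_le -(lee_pmul2r bf bp) -[X in _ && X](lee_pmul2r bf bp) e lexx.
  exact: cancel bfin b0 E.
have Z w : volume_along w setT = 0.
  apply/eqP; rewrite eq_le measure_ge0 andbT -bigcup_ball_rV.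
  apply: le_trans (measure_sigma_subadditive _ _ _ (@subset_refl _ _)) _.
  - by move=> k; exact: measurable_ball_rV.
  - by apply: bigcupT_measurable => k; exact: measurable_ball_rV.
  - rewrite eseries0// => k _ _.
    change (volume_along w [set x : V | (enorm x < k.+1%:R)%R] = 0); rewrite (volume_ball w u)//.
    by apply/eqP; apply: contrapT => /negP bk; apply: h; exists k.
have Z' w : volume_along w A = 0.
  apply/eqP; rewrite eq_le measure_ge0 andbT -(Z w).
  by apply: le_measure; rewrite ?inE.
by rewrite !Z'.
Qed.

Lemma volume_integral u (f : V -> \bar R) : measurable_fun setT f -> (forall x, 0 <= f x) ->
  \int[volume_along u]_x f x = \int[plane_measure u]_y \int[leb]_t f (y + t *: uvec u)%R.
Proof.
move=> mf f0.
rewrite (@ge0_integral_image _ _ _ _ _ (plane_measure u \x leb) _ (line_point u))//.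
- rewrite fubini_tonelli1//; apply: measurableT_comp => //.
  exact: measurable_line_point.
- exact: measurable_line_point.
Qed.

End Volume.

(** * The area factor of an oblique projection *)

Section Stretch.
Context {R : realType} {d : nat}.
Local Notation V := 'rV[R]_d.+2.
Local Notation H := (@hausdorff R d.+2 d.+1).
Local Notation leb := (@lebesgue_measure R).
Local Open Scope ereal_scope.
Implicit Types (u v m : @unit_vector R d) (k : R) (B : set V).

(** For a unit vector [m], the linear map with eigenvalue [k] on [m] and 1 on its orthogonal
    complement. *)
Definition stretch (m : V) k (x : V) : V := (x + ((k - 1) * dotp x m) *: m)%R.

Lemma measurable_stretch (m : V) k : measurable_fun setT (stretch m k).
Proof.
apply: measurable_rV_addr; first exact: measurable_id.
apply: measurable_rV_scale; last exact: measurable_cst.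
apply: measurable_funM; first exact: measurable_cst.
by apply: measurable_dotp; [exact: measurable_id|exact: measurable_cst].
Qed.

Lemma stretchK m k : (k != 0)%R -> cancel (stretch m k) (stretch m k^-1).
Proof.
move=> k0 x; rewrite /stretch dotpDl dotpZl dotp_uu mulr1 -addrA -scalerDl.
have -> : ((k - 1) * dotp x m + (k^-1 - 1) * (dotp x m + (k - 1) * dotp x m) = 0)%R by field.
by rewrite scale0r addr0.
Qed.

Lemma volume_stretch m k (A : set V) : (0 < k)%R -> measurable A ->
  volume_along m [set x : V | A (stretch m k x)] = (k^-1)%:E * volume_along m A.
Proof.
move=> k0 mA; rewrite !volume_alongE -ge0_integralZl//; first last.
- by rewrite lee_fin invr_ge0 ltW.
- exact: measurable_fibre_length.
apply: eq_plane_integral.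
- by apply: measurable_fibre_length; exact: (measurable_preimage (measurable_stretch m k)).
- by apply: measurable_funeM; exact: measurable_fibre_length.
move=> y; rewrite /plane/= => ym.
rewrite -(@lebesgue_measure_scale _ _ [set t : R | A (y + t *: uvec m)%R])//; last exact: measurable_fibre.
congr (leb _); apply/seteqP; split => t /=; congr A;
rewrite /stretch dotpDl dotpZl ym dotp_uu add0r mulr1 -addrA -scalerDl;
by congr (_ + _ *: _)%R; ring.
Qed.

(** All fibres over [B] have length 1. This turns hyperplane area into volume, which may then be
    computed along another direction. *)
Lemma volume_cylinder u B : measurable B ->
  volume_along u [set x : V | B (x - dotp x u *: (u : V))%R /\ (0 <= dotp x u <= 1)%R] =
  plane_measure u B.
Proof.
move=> mB; rewrite volume_alongE.
pose A : set V := [set x : V | B (x - dotp x u *: (u : V))%R /\ (0 <= dotp x u <= 1)%R].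
have md : measurable_fun setT (fun x : V => dotp x u).
  by apply: measurable_dotp; [exact: measurable_id|exact: measurable_cst].
have mA : measurable A.
  apply: measurableI.
    apply: (@measurable_preimage _ _ _ _ (fun x : V => x - dotp x u *: (u : V))%R B _ mB).
    apply: measurable_rV_sub; first exact: measurable_id.
    by apply: measurable_rV_scale => //; exact: measurable_cst.
  have := measurable_preimage md (measurable_itv `[0%R, 1%R]).
  by congr measurable; apply/seteqP; split => x /=; rewrite in_itv.
transitivity (\int[plane_measure u]_y (\1_B y)%:E); last by rewrite integral_indic// setIT.
apply: eq_plane_integral => //; first exact: measurable_fibre_length.
  by apply/measurable_EFinP; exact: measurable_indic.
move=> y; rewrite /plane/= => yu.
have E t : dotp (y + t *: (u : V))%R u = t by rewrite dotpDl dotpZl yu dotp_uu add0r mulr1.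
rewrite indicE; have [By|nBy] := pselect (B y).
  rewrite mem_set// (_ : [set t : R | _] = `[0%R, 1%R]%classic).
    by rewrite lebesgue_measure_itv/= lte_fin ltr01 oppr0 adde0.
  by apply/seteqP; split => t /=; rewrite in_itv/= E addrK => // -[].
rewrite memNset// (_ : [set t : R | _] = set0) ?measure0//.
by apply/seteqP; split => // t /=; rewrite E addrK => -[].
Qed.

(** Since [m] is orthogonal to [u], stretching along [m] commutes with taking the unit cylinder
    along [u]; the volume of the stretched cylinder is read off along [m]. *)
Lemma plane_measure_stretch u m k B : dotp (m : V) u = 0%R -> (0 < k)%R -> measurable B ->
  plane_measure u [set x : V | B (stretch m k x)] = (k^-1)%:E * plane_measure u B.
Proof.
move=> mu k0 mB.
rewrite -volume_cylinder; last exact: (measurable_preimage (measurable_stretch m k)).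
rewrite -(volume_cylinder u mB).
pose A : set V := [set x : V | B (x - dotp x u *: (u : V))%R /\ (0 <= dotp x u <= 1)%R].
have md : measurable_fun setT (fun x : V => dotp x u).
  by apply: measurable_dotp; [exact: measurable_id|exact: measurable_cst].
have mA : measurable A.
  apply: measurableI.
    apply: (@measurable_preimage _ _ _ _ (fun x : V => x - dotp x u *: (u : V))%R B _ mB).
    apply: measurable_rV_sub; first exact: measurable_id.
    by apply: measurable_rV_scale => //; exact: measurable_cst.
  have := measurable_preimage md (measurable_itv `[0%R, 1%R]).
  by congr measurable; apply/seteqP; split => x /=; rewrite in_itv.
transitivity (volume_along u [set x : V | A (stretch m k x)]); last first.
  rewrite (volume_along_indep u m); last exact: (measurable_preimage (measurable_stretch m k)).
  by rewrite volume_stretch//; congr (_ * _); exact: volume_along_indep.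
congr (volume_along _ _); apply/seteqP; split => x /= [h1 h2].
  rewrite /A/= /stretch dotpDl dotpZl mu mulr0 addr0; split => //; move: h1.
  rewrite /stretch dotpBl dotpZl (dotpC u) mu mulr0 subr0; congr B.
  by rewrite addrAC.
move: h1 h2; rewrite /A/= /stretch dotpDl dotpZl mu mulr0 addr0 => h1 h2; split => //.
rewrite dotpBl dotpZl (dotpC u) mu mulr0 subr0; move: h1; congr B.
by rewrite addrAC.
Qed.

(** The projection along [u] onto the hyperplane orthogonal to [q], provided that u.q is not 0. *)
Definition oblique (u q : V) (y : V) : V := (y - (dotp y q / dotp u q) *: u)%R.

Lemma obliqueB (u q x y : V) : (oblique u q x - oblique u q y = oblique u q (x - y))%R.
Proof. by rewrite /oblique dotpBl mulrBl; apply/rowP => i; rewrite !mxE; ring. Qed.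

(** Restricted to the hyperplane orthogonal to [u], the oblique projection differs by an isometry
    from a stretch along the component [p] of [q] in that hyperplane. Its factor |q| / (u.q) is the
    reciprocal cosine of the angle between the hyperplanes. *)
Lemma hausdorff_oblique u (q : V) B : (0 < dotp (u : V) q)%R -> measurable B -> B `<=` plane u ->
  H (oblique u q @` B) = (enorm q / dotp (u : V) q)%:E * H B.
Proof.
move=> uq mB Bu; pose p : V := (q - dotp q u *: (u : V))%R.
have qE : q = (p + dotp q u *: (u : V))%R by rewrite subrK.
have pu : dotp p u = 0%R by rewrite /p dotpBl dotpZl dotp_uu mulr1 subrr.
have qq : dotp q q = (dotp p p + dotp (u : V) q ^+ 2)%R.
  have -> : dotp p p = (dotp q q - dotp (u : V) q ^+ 2)%R.
    by rewrite /p !dotpE dotp_uu (dotpC q u); ring.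
  by rewrite subrK.
(* If [q] is parallel to [u] there is no stretching direction, but the projection is then the
   identity on [B]. *)
have [p0|p0] := eqVneq p 0%R.
  have -> : enorm q = dotp (u : V) q.
    by rewrite /enorm qq p0 dotp0l add0r sqrtr_sqr gtr0_norm.
  rewrite divff ?gt_eqF// mul1e -[in RHS](image_id B).
  apply: hausdorff_isometry => x y Bx By.
  rewrite obliqueB /oblique qE p0 add0r dotpZr.
  have := Bu _ Bx; have := Bu _ By; rewrite /plane/= => yu xu.
  by rewrite dotpBl xu yu subr0 mulr0 mul0r scale0r subr0.
have pn0 : (0 < enorm p)%R by rewrite enorm_gt0.
have mP : enorm ((enorm p)^-1 *: p)%R = 1%R.
  by rewrite enormZ gtr0_norm ?invr_gt0// mulVf// gt_eqF.
pose m : unit_vector := UnitVector mP.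
have mu : dotp (m : V) u = 0%R by rewrite /m/= dotpZl pu mulr0.
pose k := (enorm q / dotp (u : V) q)%R.
have q0 : (0 < enorm q)%R.
  by rewrite enorm_gt0; apply: contraTneq uq => ->; rewrite dotp0r ltxx.
have k0 : (0 < k)%R by rewrite divr_gt0.
have k1 : (0 < k^-1)%R by rewrite invr_gt0.
have k2 : (k ^+ 2 = 1 + dotp p p / dotp (u : V) q ^+ 2)%R.
  by rewrite /k expr_div_n sqr_enorm qq mulrDl divff ?expf_neq0 ?gt_eqF// addrC.
(* For w orthogonal to [u] both images have squared length w.w + (w.p)^2 / (u.q)^2. *)
transitivity (H (stretch m k @` B)).
  apply: hausdorff_isometry => x y Bx By.
  rewrite obliqueB.
  have -> : (stretch m k x - stretch m k y = stretch m k (x - y))%R.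
    by rewrite /stretch dotpBl; apply/rowP => i; rewrite !mxE; ring.
  have wu : dotp (x - y)%R u = 0%R by rewrite dotpBl (Bu _ Bx) (Bu _ By) subrr.
  move: (x - y)%R wu => w wu.
  have wq : dotp w q = dotp w p by rewrite qE dotpDr dotpZr wu mulr0 addr0.
  have wm : dotp w m = (dotp w p / enorm p)%R by rewrite /m/= dotpZr mulrC.
  have mm : dotp (m : V) m = 1%R by rewrite dotp_uu.
  clearbody m; congr Num.sqrt; rewrite /oblique /stretch !dotpE wq (dotpC u w) wu (dotpC m w) wm mm dotp_uu.
  have pp : (dotp p p = enorm p ^+ 2)%R by rewrite sqr_enorm.
  rewrite -/(dotp p p) !mulr0.
  transitivity (dotp w w + (k ^+ 2 - 1) * (dotp w p / enorm p) ^+ 2)%R; last by ring.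
  rewrite k2 pp; field; rewrite !gt_eqF//.
have -> : stretch m k @` B = [set x : V | B (stretch m k^-1 x)].
  have SK := stretchK m (lt0r_neq0 k0).
  have SK' := stretchK m (lt0r_neq0 k1); rewrite invrK in SK'.
  apply/seteqP; split => [_ [x Bx <-]|x Bx]; first exact: (eq_ind_r B Bx (SK x)).
  by exists (stretch m k^-1 x) => //; exact: SK'.
have := plane_measure_stretch mu k1 mB; rewrite !plane_measureE invrK.
rewrite (setIidl Bu) => <-; congr (H _).
apply/esym/setIidl => x /= /Bu; rewrite /plane/= /stretch dotpDl dotpZl mu mulr0 addr0.
by [].
Qed.

End Stretch.

(** * From layer-cake integrals of outer measures to Lebesgue integrals *)

Section LayerCake.
Context {R : realType} {n : nat}.
Local Notation V := 'rV[R]_n.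
Local Notation leb := (@lebesgue_measure R).
Local Open Scope ereal_scope.

Lemma lebesgue_measure_subgraph (y : \bar R) : 0 <= y ->
  leb [set t : R | (0 <= t)%R /\ t%:E < y] = y.
Proof.
move: y => [r| |]// r0.
  rewrite (_ : [set t | _] = `[0%R, r[%classic); last first.
    by apply/seteqP; split => t /=; rewrite in_itv/= lte_fin => /andP.
  rewrite lebesgue_measure_itv/= lte_fin; case: ltP => [_|r1]; first by rewrite oppr0 adde0.
  by congr EFin; apply/eqP; rewrite eq_le r1 -lee_fin r0.
rewrite (_ : [set t | _] = `[0%R, +oo[%classic); last first.
  by apply/seteqP; split => t /=; rewrite in_itv/= andbT ltry => // -[].
by rewrite lebesgue_measure_itv/= ltry.
Qed.

Lemma layer_cake d0 (T : measurableType d0) (nu : {sigma_finite_measure set T -> \bar R}) (g : T -> \bar R) :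
  measurable_fun setT g -> (forall x, 0 <= g x) ->
  \int[leb]_(t in [set t : R | (0 <= t)%R]) nu [set x | t%:E < g x] = \int[nu]_x g x.
Proof.
move=> mg g0.
pose E : set (T * measurableTypeR R) := [set p | (0 <= (p.2 : R))%R] `&` [set p | (p.2 : R)%:E < g p.1].
have mE : measurable E.
  apply: measurableI.
    have := @measurable_preimage _ _ _ _ (fun p : T * measurableTypeR R => p.2) _ measurable_snd (measurable_itv `[0%R, +oo[).
    by congr measurable; apply/seteqP; split => x /=; rewrite in_itv/= andbT.
  rewrite -[X in measurable X]setTI; apply: emeasurable_fun_lt => //.
    by apply/measurable_EFinP; exact: measurable_snd.
  exact: measurableT_comp.
transitivity (\int[nu]_x leb (xsection E x)); last first.
  apply: eq_integral => x _.
  have -> : xsection E x = [set t : R | (0 <= t)%R /\ t%:E < g x].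
    by apply/seteqP; split => t; rewrite /xsection/= inE.
  exact: lebesgue_measure_subgraph.
rewrite fubini_sections// integral_mkcond; apply: eq_integral => t _; rewrite patchE.
case: ifPn => [|t0].
  rewrite inE/= => t0; congr (nu _); apply/seteqP; split => x; rewrite /ysection/= inE.
    by move=> ?; split.
  by case.
rewrite (_ : ysection _ _ = set0) ?measure0//.
apply/seteqP; split => // x; rewrite /ysection/= inE => -[/= t1 _].
by case/negP : t0; rewrite inE.
Qed.

(** The bridge from the integrals of the statement to Lebesgue integrals. The integrand counts on
    [A] only, so it may be traded for any globally measurable function that agrees with it there. *)
Lemma ointegralE (mu : set V -> \bar R) (A : set V) (nu : {sigma_finite_measure set V -> \bar R})
    (f g : V -> \bar R) :
  (forall B, nu B = mu (A `&` B)) -> measurable_fun setT g -> (forall x, A x -> f x = g x) ->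
  ointegral mu A f = \int[nu]_x g x.
Proof.
move=> nuE mg fg; rewrite integralE /ointegral -!layer_cake//; first last.
- exact: measurable_funepos.
- exact: measurable_funeneg.
congr (_ - _); apply: eq_integral => t; rewrite inE/= => t0; rewrite nuE; congr (mu _).
  apply/seteqP; split => x [Ax /=]; rewrite (fg _ Ax) => tx; split => //=.
    by rewrite funeposE lt_max tx.
  by move: tx; rewrite funeposE lt_max => /orP[//|]; rewrite lte_fin ltNge t0.
apply/seteqP; split => x [Ax /=]; rewrite (fg _ Ax) => tx; split => //=.
  by rewrite funenegE lt_max tx.
by move: tx; rewrite funenegE lt_max => /orP[//|]; rewrite lte_fin ltNge t0.
Qed.

End LayerCake.

(** * Convex bodies with unique normals *)

Section Approx.
Context {R : realType} {n : nat}.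
Local Notation V := 'rV[R]_n.

Lemma closed_approx (A : set V) :
  (forall x, (forall e, 0 < e -> exists2 y, A y & enorm (y - x) < e) -> A x) -> closed A.
Proof.
move=> h x cx; apply: h => e e0.
have /cx[y [Ay ye]] : nbhs x [set y | enorm (y - x) < e] by apply/nbhs_enorm; exists e.
by exists y.
Qed.

Lemma closed_approxP (A : set V) x : closed A ->
  (forall e, 0 < e -> exists2 y, A y & enorm (y - x) < e) -> A x.
Proof.
move=> cA h; apply: cA => B /nbhs_enorm[e e0 eB]; have [y Ay ye] := h _ e0.
by exists y; split => //; exact: eB.
Qed.

Lemma interior_enorm (A : set V) x :
  interior A x <-> exists2 r : R, 0 < r & forall y, enorm (y - x) < r -> A y.
Proof. by split => [/nbhs_enorm[r r0 h]|[r r0 h]]; [exists r|apply/nbhs_enorm; exists r]. Qed.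

Lemma dense_rat_rV (x : V) (e : R) : 0 < e ->
  exists q : 'rV[rat]_n, enorm (x - map_mx ratr q) < e.
Proof.
move=> e0; pose e' := e / n.+1%:R.
have e'0 : 0 < e' by rewrite divr_gt0.
have H i : exists q : rat, `|x 0 i - ratr q| < e'.
  have xx : x 0 i - e' < x 0 i + e' by lra.
  have [q] := rat_in_itvoo xx; rewrite in_itv/= => /andP[q1 q2].
  by exists q; rewrite ltr_norml; apply/andP; split; lra.
exists (\row_i projT1 (cid (H i))).
apply: le_lt_trans (enorm_sum _) _.
apply: (@le_lt_trans _ _ (\sum_(i < n) e')).
  by apply: ler_sum => i _; rewrite !mxE; case: (cid _) => q /= /ltW.
rewrite sumr_const card_ord -(mulr_natr e' n) /e' mulrAC ltr_pdivrMr//.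
by rewrite ltr_pM2l// ltr_nat.
Qed.

End Approx.

(** Smoothness is recorded only as uniqueness of the outer unit normal. The given body obtains it
    from the C^1 hypothesis, the unit ball by direct computation, and both then share all results
    below. *)
Record smooth_body (R : realType) (d : nat) := SmoothBody {
  body :> set 'rV[R]_d.+2 ;
  normal : 'rV[R]_d.+2 -> 'rV[R]_d.+2 ;
  center : 'rV[R]_d.+2 ;
  body_convex : Defs.convex_set body ;
  body_compact : compact body ;
  body_center : interior body center ;
  normalP : forall x, bdry body x -> outer_unit_normal body x (normal x) ;
  normal_unique : forall x v, bdry body x -> outer_unit_normal body x v -> v = normal x }.

Section Body.
Context {R : realType} {d : nat} (B : smooth_body R d).
Local Notation K := (body B).
Local Notation V := 'rV[R]_d.+2.
Local Notation c := (center B).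
Local Notation nu := (normal B).
Implicit Types (u : @unit_vector R d) (x y z : V).

Lemma body_closed : closed K.
Proof. by apply: compact_closed; [exact: norm_hausdorff|exact: body_compact]. Qed.

Lemma bdryE x : bdry K x <-> K x /\ ~ interior K x.
Proof. by rewrite /bdry -((closure_id K).1 body_closed). Qed.

Lemma bdry_sub x : bdry K x -> K x.
Proof. by move/bdryE => []. Qed.

Lemma closed_bdry : closed (bdry K).
Proof. by rewrite /bdry setDE; apply: closedI; [exact: closed_closure|apply: open_closedC; exact: open_interior]. Qed.

Lemma body_bounded : exists2 r : R, 0 < r & forall x, K x -> enorm x <= r.
Proof. exact: compact_enorm_bounded (@body_compact _ _ B). Qed.

Lemma body_ball : exists2 r : R, 0 < r & forall y, enorm (y - c) < r -> K y.
Proof. exact/interior_enorm/body_center. Qed.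

(** The convex hull of [x] and a ball around the centre contains a ball of radius (1 - t) r around
    the point at parameter [t]. *)
Lemma body_cone x (r t : R) z : (forall y, enorm (y - c) < r -> K y) -> K x -> 0 <= t < 1 ->
  enorm (z - (c + t *: (x - c))) < (1 - t) * r -> K z.
Proof.
move=> Kr Kx /andP[t0 t1] zr; have t1' : 0 < 1 - t by rewrite subr_gt0.
have -> : z = (1 - t) *: (c + (1 - t)^-1 *: (z - (c + t *: (x - c)))) + t *: x.
  by apply/rowP => i; rewrite !mxE; field; rewrite gt_eqF.
have cK := @body_convex _ _ B; rewrite /Defs.convex_set in cK.
apply: cK => //; last by rewrite t0 ltW.
apply: Kr; rewrite addrAC subrr add0r enormZ gtr0_norm ?invr_gt0//.
by rewrite ltr_pdivrMl.
Qed.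

Lemma normal_norm x : bdry K x -> enorm (nu x) = 1.
Proof. by case/normalP. Qed.

Lemma normal_le x y : bdry K x -> K y -> dotp (nu x) (y - x) <= 0.
Proof. by move=> /normalP[_]; exact. Qed.

Lemma normal_interior x z (r : R) : bdry K x -> 0 < r -> (forall y, enorm (y - z) < r -> K y) ->
  0 < dotp (nu x) (x - z).
Proof.
move=> bx r0 zr; have n1 := normal_norm bx.
have : K (z + (r / 2) *: nu x).
  by apply: zr; rewrite addrAC subrr add0r enormZ n1 mulr1 gtr0_norm; lra.
move=> /(normal_le bx); rewrite !dotpE (dotp_enorm1 n1); lra.
Qed.

(** Continuity of the normal along the boundary: a limit of outer unit normals at points tending to
    x0 is an outer unit normal at x0, hence the one given by uniqueness. *)
Lemma closed_normal_preimage (C : set V) : closed C -> closed [set x | bdry K x /\ C (nu x)].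
Proof.
move=> cC; apply: closed_approx => x0 h.
have bx0 : bdry K x0.
  by apply: closed_approxP closed_bdry _ => e /h[y [by_ _] ye]; exists y.
split => //.
(* The normals at admissible points near x0 form a filter base inside the compact set of unit
   vectors of [C], so they have a cluster point [v]. *)
pose S e := nu @` [set x | bdry K x /\ C (nu x) /\ enorm (x - x0) < e].
pose F := filter_from [set e : R | 0 < e] S.
have FF : ProperFilter F.
  apply: (filter_from_proper (filter_from_filter _ _)).
  - by exists 1 => /=.
  - move=> e1 e2 /= e10 e20; exists (Num.min e1 e2); first by rewrite /= lt_min e10.
    by move=> _ [x [bx [Cx xe]] <-]; move: xe; rewrite lt_min => /andP[? ?]; split; exists x.
  - by move=> e /= /h[y [by_ Cy] ye]; exists (nu y), y.
pose A := [set v | C v /\ enorm v = 1].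
have cA : compact A.
  apply: (@closed_bounded_compact _ _ _ 1) => [|v [_ ->]//].
  apply: closed_approx => v hv; split.
    by apply: closed_approxP cC _ => e /hv[y [Cy _] ye]; exists y.
  apply/eqP; rewrite eq_le; apply/andP; split; apply/ler_addgt0Pr => e /hv[y [_ y1] ye].
    have := enormD (v - y) y; rewrite subrK y1 enormC; lra.
  have := enormD (y - v) v; rewrite subrK y1; lra.
have [v [[Cv v1] clv]] : A `&` cluster F !=set0.
  apply: cA; exists 1 => //= _ [x [bx [Cx _]] <-]; split => //; exact: normal_norm.
rewrite -(_ : v = nu x0)//; apply: normal_unique => //; split => // y Ky.
have [r r0 Kr] := body_bounded.
apply/ler_addgt0Pr => e e0; rewrite add0r.
(* One half of [e] pays for replacing x0 by a nearby boundary point; the other pays for replacing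
   [v] by the normal there, as |y - x0| <= 2r. *)
pose e1 := Num.min (e / 2) (e / (4 * r)).
have e10 : 0 < e1 by rewrite lt_min !divr_gt0// mulr_gt0.
have /(_ _ _)[||_ [[x [bx [Cx xe]] <-] ve]] := clv (S e1) [set v' | enorm (v' - v) < e1].
- by exists e1.
- by apply/nbhs_enorm; exists e1.
rewrite /= in ve.
have h1 := normal_le bx Ky.
have h2 : dotp (nu x) (x - x0) <= e1.
  apply: le_trans (ler_norm _) (le_trans (cauchy_schwarz _ _) _).
  by rewrite (normal_norm bx) mul1r ltW.
have h3 : dotp (v - nu x) (y - x0) <= e1 * (2 * r).
  apply: le_trans (ler_norm _) (le_trans (cauchy_schwarz _ _) _).
  apply: ler_pM; rewrite ?enorm_ge0//; first by rewrite enormC ltW.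
  by have := enormB y x0; have := Kr _ Ky; have := Kr _ (bdry_sub bx0); lra.
have -> : dotp v (y - x0) = dotp (v - nu x) (y - x0) + dotp (nu x) (y - x) + dotp (nu x) (x - x0).
  by rewrite !dotpE; ring.
have e1a : e1 <= e / 2 by rewrite ge_min lexx.
have e1b : e1 * (2 * r) <= e / 2.
  have : e1 <= e / (4 * r) by rewrite ge_min lexx orbT.
  rewrite ler_pdivlMr ?mulr_gt0//; lra.
lra.
Qed.

(** The record says nothing about [normal] off the boundary; the extension by 0 makes a map that is
    measurable on the whole space. *)
Definition gauss (x : V) : V := if x \in bdry K then nu x else 0.

Lemma gaussE x : bdry K x -> gauss x = nu x.
Proof. by move=> bx; rewrite /gauss mem_set. Qed.

Lemma measurable_bdry : measurable (bdry K).
Proof. by apply: closed_measurable_rV; exact: closed_bdry. Qed.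

Lemma measurable_gauss : measurable_fun setT gauss.
Proof.
apply: measurable_rV => i; apply: (measurability _ (RGenCInfty.measurableE R)).
move=> _ [_ [a [-> <-]]]; rewrite setTI.
rewrite (_ : _ @^-1` _ = [set x | bdry K x /\ [set v : V | a <= v 0 i] (nu x)] `|`
    (if a <= 0 then ~` bdry K else set0)).
  apply: measurableU; last by case: ifP => _ //; apply: measurableC; exact: measurable_bdry.
  apply: closed_measurable_rV; apply: (@closed_normal_preimage [set v : V | a <= v 0 i]).
  rewrite (_ : [set v : V | _] = (fun v : V => v 0 i) @^-1` [set t | a <= t])//.
  by apply: preimage_closed => [x _|]; [exact: continuous_coord|exact: closed_ge].
apply/seteqP; split => x /=; rewrite in_itv/= andbT /gauss.
  case: ifPn => [/set_mem bx ?|/negP bx]; first by left.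
  by rewrite mxE => ->; right => b; apply: bx; rewrite inE.
case=> [[bx ax]|]; first by rewrite mem_set.
by case: ifP => // a0 bx; rewrite memNset// mxE.
Qed.

Definition project (u x : V) : V := x - dotp x u *: u.

Lemma continuous_project (u : V) : continuous (project u).
Proof.
apply: continuous_rV => i x; rewrite /project.
under eq_fun do rewrite !mxE.
apply: (@continuousB _ _ _ (fun x : V => x 0 i) (fun x => dotp x u * u 0 i)).
  exact: continuous_coord.
apply: continuousM; last exact: cst_continuous.
by apply: (@continuous_dotp _ _ _ id (cst u)) => // y; [exact: cvg_id|exact: cst_continuous].
Qed.

Lemma project_plane u x : plane u (project u x).
Proof. by rewrite /plane/= /project dotpBl dotpZl dotp_uu mulr1 subrr. Qed.

Lemma projectK (u : V) x : project u x + dotp x u *: u = x.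
Proof. by rewrite subrK. Qed.

Lemma project_line u y (t : R) : plane u y -> project u (y + t *: (u : V)) = y.
Proof.
by rewrite /plane/= => yu; rewrite /project dotpDl dotpZl dotp_uu yu add0r mulr1 addrK.
Qed.

Definition shadow u : set V := project u @` K.

Lemma shadowP u y : shadow u y <-> plane u y /\ exists t : R, K (y + t *: (u : V)).
Proof.
split => [[x Kx <-]|[uy [t Kt]]].
  by split; [exact: project_plane|exists (dotp x u); rewrite projectK].
by exists (y + t *: (u : V)) => //; exact: project_line.
Qed.

(** These sets are the superlevel sets of [height], so their compactness is what makes [height] and
    [top] measurable. *)
Lemma compact_shadow_above u (a : R) : compact (project u @` (K `&` [set x | a <= dotp x u])).
Proof.
apply: continuous_compact; first exact/continuous_subspaceT/continuous_project.
have [r r0 Kr] := body_bounded.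
apply: (@closed_bounded_compact _ _ _ r) => [|x [/Kr]//].
apply: closedI; first exact: body_closed.
rewrite (_ : [set x | _] = (fun x : V => dotp x u) @^-1` [set t | a <= t])//.
apply: preimage_closed => [x _|]; last exact: closed_ge.
apply: (@continuous_dotp _ _ _ id (cst (u : V))) => // y; [exact: cvg_id|exact: cst_continuous].
Qed.

Lemma compact_shadow u : compact (shadow u).
Proof.
by apply: continuous_compact; [exact/continuous_subspaceT/continuous_project|exact: body_compact].
Qed.

Lemma measurable_shadow u : measurable (shadow u).
Proof. by apply: compact_measurable_rV; exact: compact_shadow. Qed.

Definition height u y : R := sup [set t : R | K (y + t *: (u : V))].

Lemma fibre_bounded u y (t : R) : plane u y -> K (y + t *: (u : V)) ->
  forall r, (forall x, K x -> enorm x <= r) -> `|t| <= r.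
Proof.
move=> uy Kt r Kr; apply: le_trans (Kr _ Kt).
have {1}-> : t = dotp (y + t *: (u : V)) u.
  by rewrite dotpDl dotpZl dotp_uu (_ : dotp y u = 0) ?add0r ?mulr1.
by apply: le_trans (cauchy_schwarz _ _) _; rewrite uvecP mulr1.
Qed.

Lemma height_has_sup u y : shadow u y -> has_sup [set t : R | K (y + t *: (u : V))].
Proof.
move=> /shadowP[uy [t Kt]]; split; first by exists t.
have [r r0 Kr] := body_bounded; exists r => s Ks.
exact: le_trans (ler_norm _) (fibre_bounded uy Ks Kr).
Qed.

Lemma height_ub u y (t : R) : plane u y -> K (y + t *: (u : V)) -> t <= height u y.
Proof.
move=> uy Kt; have /height_has_sup[_ ub] : shadow u y by apply/shadowP; split; [|exists t].
by apply: ub_le_sup => //; exists t.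
Qed.

Definition top u y : V := y + height u y *: (u : V).

Lemma top_body u y : shadow u y -> K (top u y).
Proof.
move=> sy; apply: (closed_approxP body_closed) => e e0.
have [t Kt te] := sup_adherent e0 (height_has_sup sy).
exists (y + t *: (u : V)) => //; rewrite /top opprD addrACA subrr add0r -scalerBl enormZ uvecP mulr1.
have /shadowP[uy _] := sy; have := height_ub uy Kt.
by rewrite -/(height u y) in te => h; rewrite ler0_norm; lra.
Qed.

Lemma top_bdry u y : shadow u y -> bdry K (top u y).
Proof.
move=> sy; have /shadowP[uy _] := sy.
apply/bdryE; split; first exact: top_body.
move=> /interior_enorm[r r0 Kr].
have : K (y + (height u y + r / 2) *: (u : V)).
  apply: Kr; rewrite (_ : _ - _ = (r / 2) *: (u : V)).
    by rewrite enormZ uvecP mulr1 gtr0_norm; lra.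
  by rewrite /top; apply/rowP => i; rewrite !mxE; ring.
by move=> /(height_ub uy); lra.
Qed.

(** The supporting hyperplane at [x] excludes every point of the line beyond [x] in direction [u],
    so [x] is the last point of the body on it. *)
Lemma top_project u x : bdry K x -> 0 < dotp (nu x) u -> top u (project u x) = x.
Proof.
move=> bx nxu; rewrite -[RHS](projectK u x); congr (_ + _ *: _).
have uy := project_plane u x.
apply/eqP; rewrite eq_le; apply/andP; split; last first.
  by apply: height_ub => //; rewrite projectK; exact: bdry_sub.
apply: ge_sup; first by exists (dotp x u) => /=; rewrite projectK; exact: bdry_sub.
move=> t /= /(normal_le bx).
have -> : project u x + t *: (u : V) - x = (t - dotp x u) *: (u : V).
  by rewrite /project; apply/rowP => i; rewrite !mxE; ring.
by rewrite dotpZr pmulr_lle0// subr_le0.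
Qed.

Lemma project_top u y : plane u y -> project u (top u y) = y.
Proof. by move=> uy; exact: project_line. Qed.

Lemma measurable_top u : measurable_fun (shadow u) (top u).
Proof.
have mh : measurable_fun (shadow u) (height u).
  apply: (measurability _ (RGenCInfty.measurableE R)).
  move=> _ [_ [a [-> <-]]].
  rewrite (_ : _ `&` _ = project u @` (K `&` [set x | a <= dotp x u])).
    by apply: compact_measurable_rV; exact: compact_shadow_above.
  apply/seteqP; split => [y [sy /=]|_ [x [Kx ax] <-]].
    rewrite in_itv/= andbT => ay; have /shadowP[uy _] := sy.
    exists (top u y); last exact: project_top.
    split; first exact: top_body.
    by rewrite /= dotpDl dotpZl dotp_uu (_ : dotp y u = 0) ?add0r ?mulr1.
  split; first by exists x.
  rewrite /= in_itv/= andbT (le_trans ax)//; apply: height_ub; first exact: project_plane.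
  by rewrite projectK.
apply: measurable_rV_addr; first exact: measurable_id.
by apply: measurable_rV_scale => //; exact: measurable_cst.
Qed.

End Body.

(** * Cauchy's formula *)

Section RestrictedMeasure.
Context d0 (T : measurableType d0) (R : realType).
Local Open Scope ereal_scope.

Lemma integral_mrestr (mu : {measure set T -> \bar R}) (A : set T) (mA : measurable A)
    (f : T -> \bar R) : measurable_fun setT f ->
  \int[mrestr mu mA]_x f x = \int[mu]_(x in A) f x.
Proof.
move=> mf; transitivity (\int[mrestr mu mA]_(x in A) f x).
  rewrite [RHS]integral_mkcond; apply: ae_eq_integral => //.
    by apply/(measurable_restrictT f mA); exact: measurable_funTS.
  exists (~` A); split; first exact: measurableC.
    by rewrite -[LHS]/(mu (~` A `&` A)) setICl measure0.
  move=> x; by apply: contra_not => Ax _; rewrite patchE mem_set.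
by apply: eq_measure_integral => B mB BA; rewrite -[LHS]/(mu (B `&` A)) setIidl.
Qed.

End RestrictedMeasure.

Section Density.
Context d1 d2 {T1 : measurableType d1} {T2 : measurableType d2} {R : realType}.
Local Notation leb := (@lebesgue_measure R).
Local Open Scope ereal_scope.

(* Layer cake on the left, then Tonelli. *)
Lemma ge0_integral_density (m : {sigma_finite_measure set T1 -> \bar R})
    (nu : {sigma_finite_measure set T2 -> \bar R}) (phi : T1 -> T2) (w : T1 -> R)
    (f : T2 -> \bar R) : measurable_fun setT phi -> measurable_fun setT w -> (forall x, (0 <= w x)%R) ->
  (forall E, measurable E -> nu E = \int[m]_(x in phi @^-1` E) (w x)%:E) ->
  measurable_fun setT f -> (forall x, 0 <= f x) ->
  \int[nu]_x f x = \int[m]_x ((w x)%:E * f (phi x)).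
Proof.
move=> mphi mw w0 nuE mf0 f0.
have mf : measurable_fun setT (f \o phi) by exact: measurableT_comp.
pose E : set (T1 * measurableTypeR R) := [set p | (0 <= (p.2 : R))%R] `&` [set p | (p.2 : R)%:E < f (phi p.1)].
have mE : measurable E.
  apply: measurableI.
    have := @measurable_preimage _ _ _ _ (fun p : T1 * measurableTypeR R => p.2) _ measurable_snd (measurable_itv `[0%R, +oo[).
    by congr measurable; apply/seteqP; split => x /=; rewrite in_itv/= andbT.
  rewrite -[X in measurable X]setTI; apply: emeasurable_fun_lt => //.
    by apply/measurable_EFinP; exact: measurable_snd.
  exact: (measurableT_comp mf).
pose F (p : T1 * measurableTypeR R) : \bar R := (w p.1 * \1_E p)%:E.
have F0 p : 0 <= F p by rewrite lee_fin mulr_ge0.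
have mF : measurable_fun setT F.
  apply/measurable_EFinP/measurable_funM; last exact: measurable_indic.
  by apply: measurableT_comp => //; exact: measurable_fst.
transitivity (\int[leb]_t \int[m]_x F (x, t)).
  rewrite -layer_cake// integral_mkcond; apply: eq_integral => t _; rewrite patchE.
  case: ifPn => [|/negP t0].
    rewrite inE/= => t0; rewrite nuE; last first.
      by rewrite -[X in measurable X]setTI; exact: emeasurable_fun_o_infty.
    rewrite integral_mkcond; apply: eq_integral => x _; rewrite patchE /F /=.
    case: ifPn => [|/negP xt]; first by rewrite inE/= => xt; rewrite indicE mem_set ?mulr1.
    by rewrite indicE memNset ?mulr0// => -[_ /= ?]; apply: xt; rewrite inE.
  rewrite integral0_eq// => x _; rewrite /F indicE memNset ?mulr0// => -[/= ? _].
  by apply: t0; rewrite inE.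
rewrite -fubini_tonelli//; apply: eq_integral => x _.
transitivity (\int[leb]_t ((w x)%:E * (\1_(xsection E x) t)%:E)).
  apply: eq_integral => t _; rewrite /F/= -EFinM !indicE; congr (_ * _%:R)%:E; congr nat_of_bool.
  by apply/idP/idP; rewrite !inE /xsection/= inE.
rewrite ge0_integralZl//; first last.
- by rewrite lee_fin.
- by apply/measurable_EFinP; apply: measurable_indic; exact: measurable_xsection.
rewrite integral_indic//; last exact: measurable_xsection.
rewrite setIT; congr (_ * _).
have -> : xsection E x = [set t : R | (0 <= t)%R /\ t%:E < f (phi x)].
  by apply/seteqP; split => t; rewrite /xsection/= inE.
exact: lebesgue_measure_subgraph.
Qed.

End Density.

Lemma le_of_ratio_powers (R : realType) (N : nat) (x y : \bar R) : (0 <= y)%E ->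
  (forall eta : R, 0 < eta < 1 -> (x <= (((1 + eta) / (1 - eta)) ^+ N)%:E * y)%E) -> (x <= y)%E.
Proof.
move=> y0 h; case: y y0 h => [y| |]// y0 h; last by rewrite leey.
pose t k : R := (1 + 2 * k.+1%:R^-1) ^+ N * y.
have T0 : (1 + 2 * k.+1%:R^-1 : R) @[k --> \oo] --> (1 + 2 * 0 : R).
  by apply: cvgD; [exact: cvg_cst|apply: cvgMr; exact: cvg_harmonic].
have ty : t k @[k --> \oo] --> y.
  rewrite [X in _ --> X](_ : y = (1 + 2 * 0) ^+ N * y); last by rewrite mulr0 addr0 expr1n mul1r.
  by apply: cvgMl; exact: (cvg_comp _ _ T0 (@exprn_continuous R N _)).
have tE : (t k)%:E @[k --> \oo] --> y%:E by apply: cvg_EFin; [exact: nearW|exact: ty].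
apply: (cvge_ge _ tE).
apply: nearW => k.
(* For eta = 1/(k+2) the ratio (1+eta)/(1-eta) is exactly 1 + 2/(k+1), which tends to 1. *)
have := h (k.+2%:R^-1); rewrite invr_gt0 ltr0n/= invf_lt1// ltr1n => /(_ isT).
rewrite -EFinM /t; congr (_ <= (_ ^+ _ * _)%:E)%E.
have -> : k.+2%:R = k.+1%:R + 1 :> R by rewrite -natr1.
have : 0 < k.+1%:R :> R by [].
move: (k.+1%:R : R) => p p0; have ? : p != 0 by rewrite gt_eqF.
have ? : p + 1 != 0 by rewrite gt_eqF//; lra.
field; do ?[apply/andP; split=> //]; rewrite ?addrK//.
Qed.

Lemma continuous_homothety (R : realType) n (c : 'rV[R]_n) (t : R) :
  continuous (fun y : 'rV[R]_n => c + t *: (y - c)).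
Proof.
apply: continuous_rV => i y; under eq_fun do rewrite !mxE.
apply: (@continuousD _ R _ (fun=> c 0 i) (fun y : 'rV[R]_n => t * (y 0 i - c 0 i))); first exact: cst_continuous.
apply: (@continuousM _ _ (fun=> t) (fun y : 'rV[R]_n => y 0 i - c 0 i)); first exact: cst_continuous.
by apply: (@continuousB _ R _ (fun y : 'rV[R]_n => y 0 i) (fun=> c 0 i)); [exact: continuous_coord|exact: cst_continuous].
Qed.

Section Surface.
Context {R : realType} {d : nat} (B : smooth_body R d).
Local Notation K := (body B).
Local Notation V := 'rV[R]_d.+2.
Local Notation H := (@hausdorff R d.+2 d.+1).
Local Notation nu := (normal B).
Local Open Scope ereal_scope.
Implicit Types (u : @unit_vector R d) (x y z : V).

Definition surface : set V -> \bar R := mrestr H (measurable_bdry B).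
HB.instance Definition _ := Measure.on surface.

Lemma surfaceE A : surface A = H (A `&` bdry K).
Proof. by []. Qed.

Definition weight u x : R := Num.max 0%R (dotp (gauss B x) u).

Lemma weight_ge0 u x : (0 <= weight u x)%R.
Proof. by rewrite le_max lexx. Qed.

Lemma measurable_weight u : measurable_fun setT (weight u).
Proof.
apply: measurable_maxr; first exact: measurable_cst.
by apply: measurable_dotp; [exact: measurable_gauss|exact: measurable_cst].
Qed.

Definition lit u : set V := [set x | (0 < weight u x)%R].

Lemma litP u x : lit u x <-> bdry K x /\ (0 < dotp (nu x) u)%R.
Proof.
rewrite /lit /= /weight lt_max ltxx/= /gauss; case: ifPn => [/set_mem bx|/negP bx].
  by split => [|[]].
by rewrite dotp0l ltxx; split => // -[b _]; case: bx; rewrite inE.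
Qed.

Lemma measurable_lit u : measurable (lit u).
Proof.
have := measurable_preimage (measurable_weight u) (measurable_itv `]0%R, +oo[).
by congr measurable; apply/seteqP; split => x /=; rewrite in_itv/= andbT.
Qed.

Definition topset u (E : set V) : set V := shadow B u `&` top B u @^-1` E.

Lemma measurable_topset u E : measurable E -> measurable (topset u E).
Proof. by move=> mE; exact: (measurable_top (measurable_shadow B u)). Qed.

Lemma topset_plane u E : topset u E `<=` plane u.
Proof. by move=> y [/shadowP[]]. Qed.

Lemma project_lit u E : E `<=` lit u -> project u @` E = topset u E.
Proof.
move=> El; apply/seteqP; split => [_ [x Ex <-]|y [sy Ey]].
  have /litP[bx nx] := El _ Ex; split; first by exists x => //; exact: bdry_sub bx.
  by rewrite /= top_project.
exists (top B u y) => //; apply: project_top.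
by have /shadowP[] := sy.
Qed.

(** * Comparison on a piece of almost constant normal *)

Section Piece.
Variables (u : @unit_vector R d) (q : V) (eta : R).
Hypotheses (eta0 : (0 < eta)%R) (eta1 : (eta < 1)%R) (uq : (0 < dotp (u : V) q)%R).

(** The tolerance is relative to u.q: then n.u agrees with u.q up to a factor between 1 - eta and 1
    + eta, however close to tangential [u] is. The vector [q] is not normalised because it will run
    through rational vectors. *)
Definition piece : set V := [set x | bdry K x /\ (enorm (nu x - q) <= eta * dotp (u : V) q)%R].

Lemma measurable_piece : measurable piece.
Proof.
apply: closed_measurable_rV.
apply: (@closed_normal_preimage _ _ B [set v : V | (enorm (v - q) <= eta * dotp (u : V) q)%R]).
exact: closed_enorm_le.
Qed.

Let enormq : (dotp (u : V) q <= enorm q)%R.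
Proof.
by apply: le_trans (ler_norm _) _; apply: le_trans (cauchy_schwarz _ _) _; rewrite uvecP mul1r.
Qed.

Let piece_normal x : piece x ->
  ((1 - eta) * dotp (u : V) q <= dotp (nu x) u <= (1 + eta) * dotp (u : V) q)%R.
Proof.
move=> [bx xq]; have : (`|dotp (nu x - q) u| <= eta * dotp (u : V) q)%R.
  by apply: le_trans (cauchy_schwarz _ _) _; rewrite uvecP mulr1.
by rewrite dotpBl (dotpC q) ler_norml => /andP[h1 h2]; apply/andP; split; lra.
Qed.

Lemma piece_lit : piece `<=` lit u.
Proof.
move=> x px; apply/litP; split; first by case: px.
have /andP[h _] := piece_normal px; apply: lt_le_trans h.
by rewrite mulr_gt0// subr_gt0.
Qed.

(* Convexity gives n(y).(x - y) <= 0 <= n(x).(x - y), so that x - y is almost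
   orthogonal to the common approximate normal q. *)
Let piece_dist x y : piece x -> piece y ->
  (`|dotp (x - y) q| <= eta * dotp (u : V) q * enorm (x - y))%R.
Proof.
move=> [bx xq] [by_ yq].
have h1 := normal_le bx (bdry_sub by_); have h2 := normal_le by_ (bdry_sub bx).
have cs v : (enorm (v - q) <= eta * dotp (u : V) q)%R ->
    (`|dotp v (x - y) - dotp (x - y) q| <= eta * dotp (u : V) q * enorm (x - y))%R.
  move=> vq; rewrite -(dotpC q (x - y)) -dotpBl; apply: le_trans (cauchy_schwarz _ _) _.
  by rewrite ler_wpM2r// enorm_ge0.
have := cs _ xq; have := cs _ yq; rewrite !ler_norml.
have -> : dotp (nu x) (x - y) = (- dotp (nu x) (y - x))%R by rewrite -dotpNr opprB.
move: h1 h2; set a := dotp (nu x) _; set a' := dotp (nu y) _; set q' := dotp _ q.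
set b := (_ * enorm _)%R => h1 h2 /andP[h3 h4] /andP[h5 h6].
by apply/andP; split; lra.
Qed.

(** Differences of points of a piece are almost orthogonal to [q], so the projection along [u]
    changes them by at most eta times their length: it is bi-Lipschitz with constants 1 - eta and 1
    + eta. *)
Let oblique_piece x y : piece x -> piece y ->
  ((1 - eta) * enorm (x - y) <= enorm (oblique u q x - oblique u q y) <= (1 + eta) * enorm (x - y))%R.
Proof.
move=> px py; rewrite obliqueB; have := piece_dist px py; move: (x - y)%R => w wq.
have h : (enorm ((dotp w q / dotp (u : V) q) *: (u : V)) <= eta * enorm w)%R.
  by rewrite enormZ uvecP mulr1 normrM normfV (gtr0_norm uq) ler_pdivrMr// mulrAC.
apply/andP; split.
  have := enormD (oblique u q w) ((dotp w q / dotp (u : V) q) *: (u : V)).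
  by rewrite /oblique subrK; lra.
have := enormB w ((dotp w q / dotp (u : V) q) *: (u : V)).
by rewrite -/(oblique u q w); lra.
Qed.

Variable E : set V.
Hypotheses (mE : measurable E) (EP : E `<=` piece).

(** The oblique projection does not change if the point is first projected along [u], and that first
    projection takes [E] onto its [topset], to which the area factor applies. *)
Let H_oblique : H (oblique u q @` E) = (enorm q / dotp (u : V) q)%:E * plane_measure u (topset u E).
Proof.
have El : E `<=` lit u by apply: subset_trans EP piece_lit.
rewrite plane_measureE (setIidl (@topset_plane u E)) -hausdorff_oblique//; first last.
- exact: topset_plane.
- exact: measurable_topset.
have OE x : oblique u q (project u x) = oblique u q x.
  rewrite /oblique /project dotpBl dotpZl; apply/rowP => i; rewrite !mxE; field.
  by rewrite gt_eqF.
congr (H _); rewrite -(project_lit El); apply/seteqP; split => [_ [x Ex <-]|_ [_ [x Ex <-] <-]].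
  by exists (project u x); [exists x|exact: OE].
by exists x => //; rewrite OE.
Qed.

Let weight_bound : ((1 - eta) * dotp (u : V) q)%:E * H E <= \int[surface]_(x in E) (weight u x)%:E /\
  \int[surface]_(x in E) (weight u x)%:E <= ((1 + eta) * dotp (u : V) q)%:E * H E.
Proof.
have sE : surface E = H E by rewrite surfaceE setIidl// => x /EP[].
have wE x : E x -> weight u x = dotp (nu x) u.
  move=> /EP px; rewrite /weight gaussE; last by case: px.
  by apply/max_idPr/ltW; have /litP[] := piece_lit px.
have mw : measurable_fun E (fun x => (weight u x)%:E).
  by apply/measurable_EFinP; apply: measurable_funTS; exact: measurable_weight.
rewrite -sE -!integral_cst//; split; apply: ge0_le_integral => //.
- by move=> x _; rewrite lee_fin mulr_ge0 ?(ltW uq)// subr_ge0 ltW.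
- by move=> x Ex; rewrite lee_fin wE//; have /andP[] := piece_normal (EP Ex).
- by move=> x _; rewrite lee_fin weight_ge0.
- by move=> x Ex; rewrite lee_fin wE//; have /andP[] := piece_normal (EP Ex).
Qed.

Let hausdorff_bound : H E <= ((1 - eta)^-1 ^+ d.+1)%:E * H (oblique u q @` E) /\
  H (oblique u q @` E) <= ((1 + eta) ^+ d.+1)%:E * H E.
Proof.
have e1 : (0 < 1 - eta)%R by rewrite subr_gt0.
split.
  rewrite -{1}(image_id E); apply: hausdorff_lipschitz => [|x y Ex Ey]; first by rewrite invr_gt0.
  rewrite mulrC ler_pdivlMr// mulrC.
  by have /andP[] := oblique_piece (EP Ex) (EP Ey).
rewrite -{2}(image_id E); apply: hausdorff_lipschitz => [|x y Ex Ey]; first by rewrite addr_gt0.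
by have /andP[] := oblique_piece (EP Ex) (EP Ey).
Qed.

(** The weight is about u.q, the area of [E] about |q| / (u.q) times that of its projection, and |q|
    about 1, so the integral is about the projected area. The bi-Lipschitz constants cost d+1
    factors, weight and |q| together one more: hence the exponent d+2. *)
Lemma piece_compare : \int[surface]_(x in E) (weight u x)%:E <=
    (((1 + eta) / (1 - eta)) ^+ d.+2)%:E * plane_measure u (topset u E) /\
  plane_measure u (topset u E) <=
    (((1 + eta) / (1 - eta)) ^+ d.+2)%:E * \int[surface]_(x in E) (weight u x)%:E.
Proof.
have [E0|/set0P[x0 Ex0]] := eqVneq E set0.
  by rewrite E0 integral_set0 /topset preimage_set0 setI0 measure0 mule0.
have e1 : (0 < 1 - eta)%R by rewrite subr_gt0.
have e2 : (0 < 1 + eta)%R by rewrite addr_gt0.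
have q0 : (0 < enorm q)%R by apply: lt_le_trans enormq.
have [bx0 xq0] := EP Ex0; have n1 := normal_norm bx0.
pose w := ((1 + eta) / (1 - eta))%R.
have w1 : (1 + eta <= w)%R by rewrite ler_pdivlMr// ler_piMr ?(ltW e2)// gerBl ltW.
have w2 : ((1 - eta)^-1 <= w)%R by rewrite ler_peMl ?invr_ge0 ?(ltW e1)// lerDl ltW.
have w0 : (0 <= w)%R by rewrite divr_ge0// ltW.
have etaq : (eta * dotp (u : V) q <= eta * enorm q)%R by rewrite ler_pM2l.
(* [q] is within eta |q| of a unit normal, so its length is close to 1. *)
have q1 : ((1 - eta) * enorm q <= 1)%R.
  have := enormD (q - nu x0) (nu x0); rewrite subrK n1 enormC; lra.
have q2 : (1 <= (1 + eta) * enorm q)%R.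
  have := enormD (nu x0 - q) q; rewrite subrK n1; lra.
have [A4 A3] := weight_bound; have [A1 A2] := hausdorff_bound; rewrite H_oblique in A1 A2.
move: A1 A2 A3 A4; set a := \int[_]_(_ in _) _; set b := plane_measure _ _; set h := H E.
set l := dotp _ _; set Q := enorm q in q0 q1 q2 *.
have b0 : 0 <= b by exact: measure_ge0.
have h0 : 0 <= h by exact: measure_ge0.
have a0 : 0 <= a by apply: integral_ge0 => x _; rewrite lee_fin weight_ge0.
move=> A1 A2 A3 A4; have l0 : (0 < l)%R := uq.
split.
  apply: le_trans A3 _.
  apply: (@le_trans _ _ (((1 + eta) * l)%:E * (((1 - eta)^-1 ^+ d.+1)%:E * ((Q / l)%:E * b)))).
    by apply: lee_wpmul2l => //; rewrite lee_fin mulr_ge0// ltW.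
  rewrite !muleA -!EFinM; apply: lee_wpmul2r => //; rewrite lee_fin.
  have -> : ((1 + eta) * l * (1 - eta)^-1 ^+ d.+1 * (Q / l) = ((1 + eta) * Q) * (1 - eta)^-1 ^+ d.+1)%R.
    by field; rewrite !gt_eqF.
  rewrite -/w (exprS w); apply: ler_pM; rewrite ?mulr_ge0 ?exprn_ge0 ?invr_ge0 ?(ltW e1) ?(ltW e2) ?(ltW q0)//.
    by rewrite /w ler_pM2l// -(ler_pM2l e1) mulfV ?gt_eqF.
  by rewrite lerXn2r ?nnegrE ?invr_ge0 ?(ltW e1).
have {A4} : h <= (((1 - eta) * l)^-1)%:E * a by rewrite lee_pdivlMl// mulr_gt0.
have {A2} : b <= ((l / Q) * (1 + eta) ^+ d.+1)%:E * h.
  by rewrite EFinM -muleA -(invf_div Q l) lee_pdivlMl// divr_gt0.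
move=> A2 A4; apply: le_trans A2 _.
apply: (@le_trans _ _ ((l / Q * (1 + eta) ^+ d.+1)%:E * ((((1 - eta) * l)^-1)%:E * a))).
  by apply: lee_wpmul2l => //; rewrite lee_fin mulr_ge0 ?divr_ge0 ?exprn_ge0// ltW.
rewrite muleA -EFinM; apply: lee_wpmul2r => //; rewrite lee_fin.
have -> : (l / Q * (1 + eta) ^+ d.+1 * ((1 - eta) * l)^-1 = ((1 - eta)^-1 * Q^-1) * (1 + eta) ^+ d.+1)%R.
  by field; rewrite !gt_eqF.
rewrite -/w (exprS w); apply: ler_pM; rewrite ?mulr_ge0 ?exprn_ge0 ?invr_ge0 ?(ltW e1) ?(ltW e2) ?(ltW q0)//.
  by rewrite /w mulrC ler_pM2r ?invr_gt0// -(ler_pM2r q0) mulVf ?gt_eqF.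
by rewrite lerXn2r ?nnegrE ?(ltW e2).
Qed.

End Piece.


(** The line over a point strictly inside the shadow passes through an interior point z of the body.
    The last point of the line is z plus a nonnegative multiple of [u], and its normal has positive
    product with that difference. *)
Lemma shadow_scaled_lit u y (t : R) : (0 <= t < 1)%R -> shadow B u y ->
  let y' := (project u (center B) + t *: (y - project u (center B)))%R in
  shadow B u y' /\ lit u (top B u y').
Proof.
move=> t01 [x Kx <-] y'; set c := center B.
have [r r0 Kr] := body_ball B.
pose z := (c + t *: (x - c))%R.
have t1 : (0 < (1 - t) * r)%R by case/andP: t01 => _ t1; rewrite mulr_gt0// subr_gt0.
have zK v : (enorm (v - z) < (1 - t) * r)%R -> K v by move=> vz; exact: (body_cone Kr Kx t01).
have yz : y' = project u z.
  rewrite /y' /z /project !dotpE; apply/rowP => i; rewrite !mxE; ring.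
have sy : shadow B u y'.
  by rewrite yz; exists z => //; apply: zK; rewrite subrr enorm0.
split => //; apply/litP; split; first exact: top_bdry.
have := normal_interior (top_bdry sy) t1 zK.
have -> : (top B u y' - z = (height B u y' - dotp z u) *: (u : V))%R.
  by rewrite /top -[z in LHS](projectK u z) -yz scalerBl opprD addrACA subrr add0r.
have : (dotp z u <= height B u y')%R.
  apply: height_ub; first by have /shadowP[] := sy.
  by rewrite yz projectK; apply: zK; rewrite subrr enorm0.
rewrite -subr_ge0 dotpZr => h hm; rewrite -(pmulr_rgt0 _ (_ : 0 < height B u y' - dotp z u)%R)//.
by rewrite lt_def h andbT; apply: contraTneq hm => ->; rewrite mul0r ltxx.
Qed.

(** The tangential lines avoid every copy of the shadow shrunk by t < 1, which already has measure
    t^(d+1) times that of the shadow; let t tend to 1. Finiteness of the shadow permits the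
    subtraction. *)
Lemma topset_not_lit u : plane_measure u (topset u (~` lit u)) = 0.
Proof.
set D := topset _ _; set M := plane_measure u (shadow B u).
have mS := measurable_shadow B u.
have mD : measurable D by apply: measurable_topset; apply: measurableC; exact: measurable_lit.
have Mfin : M < +oo.
  have [r r0 Sr] := compact_enorm_bounded (@compact_shadow _ _ B u).
  apply: le_lt_trans (plane_measure_bounded u (r + 1)); apply: le_measure; rewrite ?inE//.
    exact: measurable_ball_rV.
  by move=> y /Sr ?; rewrite /=; lra.
have M0 : 0 <= M by exact: measure_ge0.
have D0 : 0 <= plane_measure u D by exact: measure_ge0.
have DM : plane_measure u D <= M by apply: le_measure; rewrite ?inE//; move=> y [].
have Dfin := le_lt_trans DM Mfin.
have MD : M <= M - plane_measure u D.
  apply: (@le_of_ratio_powers _ d.+1) => [|eta /andP[eta0 eta1]].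
    by rewrite sube_ge0 ?DM// ge0_fin_numE// Dfin.
  have e1 : (0 < 1 - eta)%R by lra.
  have e2 : (0 < 1 + eta)%R by lra.
  (* This ratio turns t^(d+1) M <= M - measure of [D] into the shape required by
     [le_of_ratio_powers]. *)
  pose t := ((1 - eta) / (1 + eta))%R.
  have t0 : (0 < t)%R by rewrite divr_gt0.
  have t01 : (0 <= t < 1)%R by rewrite ltW// ltr_pdivrMr//; lra.
  rewrite -invf_div exprVn -/t lee_pdivlMl ?exprn_gt0//.
  pose f y := (project u (center B) + t *: (y - project u (center B)))%R.
  have fS : plane_measure u (f @` shadow B u) = (t ^+ d.+1)%:E * M.
    rewrite /M !plane_measureE !setIidl; first last.
    - by move=> _ [y sy <-]; have [/shadowP[]] := shadow_scaled_lit t01 sy.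
    - by move=> y /shadowP[].
    rewrite -hausdorff_scale//; apply: hausdorff_isometry => x y _ _.
    by rewrite /f; congr enorm; apply/rowP => i; rewrite !mxE; ring.
  rewrite -fS leeBrDr ?ge0_fin_numE//.
  have mf : measurable (f @` shadow B u).
    apply: compact_measurable_rV; apply: continuous_compact; last exact: compact_shadow.
    by apply: continuous_subspaceT; exact: continuous_homothety.
  rewrite -measureU//.
    apply: le_measure; rewrite ?inE//; first exact: measurableU.
    by move=> y [[z sz <-]|[]//]; have [] := shadow_scaled_lit t01 sz.
  apply/seteqP; split => // _ [[y sy <-] [_ Dy]]; apply: Dy.
  by have [] := shadow_scaled_lit t01 sy.
move: MD; rewrite leeBrDr ?ge0_fin_numE// -[leRHS]adde0 leeD2lE ?ge0_fin_numE// => ?.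
by apply/eqP; rewrite eq_le D0 andbT.
Qed.


End Surface.

(** Making the cover disjoint lets countable additivity sum the local comparisons. *)
Lemma le_of_cover d0 (T : measurableType d0) (R : realType) (a b : set T -> \bar R) (k : R)
    (P : nat -> set T) (A : set T) : measurable A -> (forall i, measurable (P i)) ->
  A `<=` \bigcup_i P i -> (forall E, 0 <= b E)%E -> (forall E, 0 <= a E)%E -> 0 <= k ->
  (forall F : nat -> set T, (forall i, measurable (F i)) -> trivIset setT F ->
    a (\bigcup_i F i) = \sum_(i <oo) a (F i))%E ->
  (forall F : nat -> set T, (forall i, measurable (F i)) -> trivIset setT F ->
    b (\bigcup_i F i) = \sum_(i <oo) b (F i))%E ->
  (forall i E, measurable E -> E `<=` A `&` P i -> a E <= k%:E * b E)%E ->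
  (a A <= k%:E * b A)%E.
Proof.
move=> mA mP AP b0 a0 k0 aU bU ab.
pose F := seqDU (fun i => A `&` P i).
have mAP i : measurable (A `&` P i) by exact: measurableI.
have mF i : measurable (F i).
  by apply: measurableD => //; apply: bigsetU_measurable => j _; exact: mAP.
have AF : A = \bigcup_i F i.
  by rewrite -seqDU_bigcup_eq -setI_bigcupr; apply/seteqP; split => // x Ax; split => //; exact: AP.
rewrite {1 2}AF aU ?bU//; [|exact: trivIset_seqDU..].
rewrite -nneseriesZl//; apply: lee_nneseries => // i _; apply: ab => //.
exact: subset_seqDU.
Qed.

(** * Cauchy's formula for measurable parts of the boundary *)

Section WeightedMeasure.
Context {R : realType} {d : nat} (B : smooth_body R d).
Local Notation K := (body B).
Local Notation V := 'rV[R]_d.+2.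
Local Notation H := (@hausdorff R d.+2 d.+1).
Local Notation nu := (normal B).
Local Open Scope ereal_scope.
Local Notation surface := (surface B).
Local Notation weight := (weight B).
Local Notation lit := (lit B).
Local Notation topset := (topset B).
Local Notation piece := (piece B).
Implicit Types (u : @unit_vector R d) (x y z : V).

Let piece_cover u (eta : R) k : set V :=
  if unpickle k is Some q then
    if (0 < dotp (u : V) (map_mx ratr (q : 'rV[rat]_d.+2)))%R then piece u (map_mx ratr q) eta else set0
  else set0.

Let lit_cover u (eta : R) : (0 < eta)%R -> lit u `<=` \bigcup_k piece_cover u eta k.
Proof.
(* The solution of eta (n.u - e) = e: if [q] is within [e] of the normal, then u.q >= n.u - e, so
   [e] is within the tolerance eta (u.q). *)
move=> eta0 x /litP[bx xu]; pose e := (eta * dotp (nu x) u / (1 + eta))%R.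
have e1 : (0 < 1 + eta)%R by lra.
have e0 : (0 < e)%R by rewrite divr_gt0 ?mulr_gt0.
have eE : (eta * dotp (nu x) u = e * (1 + eta))%R by rewrite /e; field; rewrite gt_eqF.
have [q xq] := dense_rat_rV (nu x) e0; exists (pickle q) => //.
rewrite /piece_cover pickleK; set p := map_mx ratr q in xq *.
have : (dotp (nu x - p) u <= e)%R.
  apply: le_trans (ler_norm _) (le_trans (cauchy_schwarz _ _) _).
  by rewrite uvecP mulr1 ltW.
rewrite dotpBl (dotpC p) => h.
have h2 : (e <= eta * dotp (u : V) p)%R.
  have : (eta * (dotp (nu x) u - dotp (u : V) p) <= eta * e)%R by rewrite ler_pM2l.
  by lra.
rewrite -(pmulr_rgt0 _ eta0) (lt_le_trans e0 h2); split => //.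
by apply: le_trans h2; exact: ltW.
Qed.

Let measurable_piece_cover u (eta : R) k : measurable (piece_cover u eta k).
Proof.
rewrite /piece_cover; case: unpickle => [q|] //; case: ifP => // _.
exact: measurable_piece.
Qed.

Lemma topset_additive u (F : nat -> set V) : (forall i, measurable (F i)) -> trivIset setT F ->
  plane_measure u (topset u (\bigcup_i F i)) = \sum_(i <oo) plane_measure u (topset u (F i)).
Proof.
move=> mF tF; rewrite /topset preimage_bigcup setI_bigcupr.
have mT i : measurable (shadow B u `&` top B u @^-1` F i) by exact: measurable_topset.
rewrite measure_bigcup//; first by apply: eq_eseriesl => i; rewrite in_setT.
apply/trivIsetP => i j _ _ ij; move/trivIsetP : tF => /(_ i j Logic.I Logic.I ij) Fij.
by rewrite setIACA setIid -preimage_setI Fij preimage_set0 setI0.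
Qed.

Lemma weight_additive u (F : nat -> set V) : (forall i, measurable (F i)) -> trivIset setT F ->
  \int[surface]_(x in \bigcup_i F i) (weight u x)%:E =
  \sum_(i <oo) \int[surface]_(x in F i) (weight u x)%:E.
Proof.
move=> mF tF; rewrite ge0_integral_bigcup//.
  by apply/measurable_EFinP; apply: measurable_funTS; exact: measurable_weight.
by move=> x _; rewrite lee_fin weight_ge0.
Qed.

(** Off the lit part the weight is 0 and the projected set is negligible. The lit part is covered by
    countably many pieces with rational [q], the comparison on pieces is summed, and eta tends to
    0. *)
Lemma integral_weight u (E : set V) : measurable E ->
  \int[surface]_(x in E) (weight u x)%:E = plane_measure u (topset u E).
Proof.
move=> mE; have ml := measurable_lit B u.
have mw D : measurable_fun D (fun x => (weight u x)%:E).
  by apply/measurable_EFinP; apply: measurable_funTS; exact: measurable_weight.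
have w0 x : 0 <= (weight u x)%:E by rewrite lee_fin weight_ge0.
have aE : \int[surface]_(x in E) (weight u x)%:E = \int[surface]_(x in E `&` lit u) (weight u x)%:E.
  rewrite integral_mkcond [RHS]integral_mkcond; apply: eq_integral => x _; rewrite !patchE in_setI.
  case: ifPn => //= _; case: ifPn => // /negP; rewrite inE /lit/= => /negP.
  by rewrite lt_neqAle weight_ge0 andbT negbK => /eqP <-.
have bE : plane_measure u (topset u E) = plane_measure u (topset u (E `&` lit u)).
  rewrite {1}(_ : topset u E = topset u (E `&` lit u) `|` topset u (E `&` ~` lit u)).
    rewrite measureU//; [|by apply: measurable_topset; apply: measurableI => //; exact: measurableC..|].
      rewrite [X in _ + X](_ : _ = 0) ?adde0//.
      apply/eqP; rewrite eq_le measure_ge0 andbT -(topset_not_lit B u).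
      apply: le_measure; rewrite ?inE.
      - by apply: measurable_topset; apply: measurableI => //; exact: measurableC.
      - by apply: measurable_topset; exact: measurableC.
      - by move=> y [? [? ?]]; split.
    by apply/seteqP; split => // y [[_ [_ ?]] [_ [_]]].
  by rewrite /topset -setIUr -preimage_setU -setIUr setUv setIT.
rewrite aE bE; set A := E `&` lit u; have mA : measurable A by exact: measurableI.
(* The two inequalities have the same proof, given once for abstract additive set functions [a] and
   [b]. *)
have key (a b : set V -> \bar R) : (forall X, 0 <= b X) -> (forall X, 0 <= a X) ->
  (forall F : nat -> set V, (forall i, measurable (F i)) -> trivIset setT F ->
    a (\bigcup_i F i) = \sum_(i <oo) a (F i)) ->
  (forall F : nat -> set V, (forall i, measurable (F i)) -> trivIset setT F ->
    b (\bigcup_i F i) = \sum_(i <oo) b (F i)) ->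
  (forall q eta X, (0 < eta)%R -> (eta < 1)%R -> (0 < dotp (u : V) q)%R -> measurable X ->
     X `<=` piece u q eta -> a X <= (((1 + eta) / (1 - eta)) ^+ d.+2)%:E * b X) ->
  a A <= b A.
  move=> b0 a0 aU bU ab; apply: (@le_of_ratio_powers _ d.+2) => // eta /andP[eta0 eta1].
  have e1 : (0 < 1 - eta)%R by lra.
  have e2 : (0 < 1 + eta)%R by lra.
  apply: (@le_of_cover _ _ _ a b _ (piece_cover u eta)) => //.
  - by apply: subset_trans (lit_cover eta0) => x [].
  - by rewrite exprn_ge0// divr_ge0 ?ltW.
  - move=> i X mX XP; have [->|/set0P[x Xx]] := eqVneq X set0.
      have q1 : (0 < dotp (u : V) u)%R by rewrite dotp_uu.
      by apply: (ab u eta) => //; exact: sub0set.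
    have [_] := XP x Xx; move: XP; rewrite /piece_cover; case: unpickle => [q|//].
    case: ifPn => [q0 XP _|//]; apply: (ab (map_mx ratr q) eta) => //.
    by apply: subset_trans XP _ => y [].
apply/eqP; rewrite eq_le; apply/andP; split.
  apply: (key (fun E => \int[surface]_(x in E) (weight u x)%:E)
    (fun E => plane_measure u (topset u E))) => //.
  - by move=> X; exact: integral_ge0.
  - exact: weight_additive.
  - exact: topset_additive.
  - by move=> q eta X e0 e1 uq mX Xp; have [] := piece_compare e0 e1 uq mX Xp.
apply: (key (fun E => plane_measure u (topset u E))
  (fun E => \int[surface]_(x in E) (weight u x)%:E)) => //.
- by move=> X; exact: integral_ge0.
- exact: topset_additive.
- exact: weight_additive.
- by move=> q eta X e0 e1 uq mX Xp; have [] := piece_compare e0 e1 uq mX Xp.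
Qed.

End WeightedMeasure.

Section Axes.
Context {R : realType} {d : nat}.
Local Notation V := 'rV[R]_d.+2.

Definition axis (i : 'I_d.+2) : @unit_vector R d :=
  @UnitVector R d (delta_mx 0 i) (@enorm_delta R _ i).

Lemma enorm_opp_unit (u : @unit_vector R d) : enorm (- (u : V)) = 1.
Proof. by rewrite enormN uvecP. Qed.

Definition opp_unit (u : @unit_vector R d) : @unit_vector R d := UnitVector (enorm_opp_unit u).

Lemma plane_opp (u : @unit_vector R d) : plane (opp_unit u : V) = plane u.
Proof.
apply/seteqP; split => y; rewrite /plane/= dotpNr => /eqP; rewrite ?oppr_eq0 => /eqP //.
by move=> ->; rewrite oppr0.
Qed.

Lemma plane_measure_opp (u : @unit_vector R d) (A : set V) :
  plane_measure (opp_unit u : V) A = plane_measure u A.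
Proof. by rewrite !plane_measureE plane_opp. Qed.

End Axes.

(** * Finiteness of the surface, and Cauchy's formula for functions *)

Section Flux.
Context {R : realType} {d : nat} (B : smooth_body R d).
Local Notation K := (body B).
Local Notation V := 'rV[R]_d.+2.
Local Notation H := (@hausdorff R d.+2 d.+1).
Local Notation nu := (normal B).
Local Notation leb := (@lebesgue_measure R).
Local Open Scope ereal_scope.
Implicit Types (u : @unit_vector R d) (x y z : V).

Lemma plane_measure_shadow_fin u : plane_measure u (shadow B u) < +oo.
Proof.
have [r r0 Sr] := compact_enorm_bounded (@compact_shadow _ _ B u).
apply: le_lt_trans (plane_measure_bounded u (r + 1)); apply: le_measure; rewrite ?inE//.
- exact: measurable_shadow.
- exact: measurable_ball_rV.
- by move=> y /Sr ?; rewrite /=; lra.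
Qed.

Lemma weight_opp u x : (weight B u x + weight B (opp_unit u) x = `|dotp (gauss B x) u|)%R.
Proof.
rewrite /weight /= dotpNr; move: (dotp _ _) => t.
by rewrite /Order.max oppr_gt0; case: ltrgt0P => _; rewrite ?addr0 ?add0r.
Qed.

Lemma weight_sub u x : (weight B u x - weight B (opp_unit u) x = dotp (gauss B x) u)%R.
Proof.
rewrite /weight /= dotpNr; move: (dotp _ _) => t.
by rewrite /Order.max oppr_gt0; case: ltrgt0P => [||->]; rewrite ?subr0 ?sub0r ?opprK.
Qed.

Lemma sum_weight_ge1 x : bdry K x ->
  (1 <= \sum_(i < d.+2) (weight B (axis i) x + weight B (opp_unit (axis i)) x))%R.
Proof.
move=> bx; under eq_bigr do rewrite weight_opp gaussE// dotp_deltar.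
by have := enorm_sum (nu x); rewrite normal_norm.
Qed.

(** The sum norm of a unit normal is at least 1, so the area is at most the sum of the shadow areas
    over the directions e_i and -e_i. *)
Lemma surface_fin : surface B setT < +oo.
Proof.
have mw u : measurable_fun setT (fun x => (weight B u x)%:E).
  by apply/measurable_EFinP; exact: measurable_weight.
apply: (@le_lt_trans _ _ (\int[surface B]_(x in bdry K)
    \sum_(i < d.+2) ((weight B (axis i) x)%:E + (weight B (opp_unit (axis i)) x)%:E))).
  rewrite -[leLHS]/(H (setT `&` bdry K)) -[leLHS]mul1e.
  have -> : H (setT `&` bdry K) = surface B (bdry K) by rewrite surfaceE setTI setIid.
  rewrite -integral_cst; last exact: measurable_bdry.
  apply: ge0_le_integral => //.
  - exact: measurable_bdry.
  - by apply: emeasurable_sum => i; apply: emeasurable_funD; apply: measurable_funTS; exact: mw.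
  - move=> x bx; under eq_bigr do rewrite -EFinD.
    by rewrite sumEFin lee_fin; exact: sum_weight_ge1.
rewrite ge0_integral_sum//; first last.
- by move=> i x _; rewrite -EFinD lee_fin addr_ge0// weight_ge0.
- by move=> i; apply: emeasurable_funD; apply: measurable_funTS; exact: mw.
- exact: measurable_bdry.
apply: lte_sum_pinfty => i _.
have mb := measurable_bdry B.
rewrite ge0_integralD//; try by [move=> x _; rewrite lee_fin weight_ge0|apply: measurable_funTS; exact: mw].
have fin u : \int[surface B]_(x in bdry K) (weight B u x)%:E < +oo.
  rewrite integral_weight//; apply: le_lt_trans (plane_measure_shadow_fin u).
  apply: le_measure; rewrite ?inE//; first exact: measurable_topset.
    exact: measurable_shadow.
  by move=> y [].
by rewrite lte_add_pinfty.
Qed.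

Let fin_num_surface : fin_num_fun (surface B).
Proof.
move=> A mA; rewrite ge0_fin_numE ?measure_ge0//; apply: le_lt_trans surface_fin.
by apply: le_measure; rewrite ?inE.
Qed.

HB.instance Definition _ := Measure_isFinite.Build _ _ _ (surface B) fin_num_surface.

Definition total_top u y : V := if y \in shadow B u then top B u y else 0%R.

Lemma total_topE u y : shadow B u y -> total_top u y = top B u y.
Proof. by move=> sy; rewrite /total_top mem_set. Qed.

Lemma measurable_total_top u : measurable_fun setT (total_top u).
Proof.
apply: measurable_fun_if => //.
- by apply: (@measurable_fun_bool _ _ _ _ true); rewrite setTI (_ : _ @^-1` _ = shadow B u) ?measurable_shadow//;
    [exact: measurable_shadow|apply/seteqP; split => y /=; [move/set_mem|move/mem_set]].
- rewrite setTI; apply: measurable_funS (measurable_top (B := B) (u := u)); first exact: measurable_shadow.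
  by move=> y /set_mem.
Qed.

(** The image of the plane measure on the shadow under the map to the last point. Cauchy's formula
    says that it has density [weight] with respect to the surface. *)
Definition top_law u (E : set V) : \bar R := pushforward (mrestr (plane_measure u) (measurable_shadow B u)) (total_top u) E.

Lemma top_lawE u E : top_law u E = plane_measure u (topset B u E).
Proof.
rewrite /top_law /pushforward /mrestr; congr (plane_measure u _).
by apply/seteqP; split => y [h1 h2]; split => //; move: h1 h2; rewrite /preimage/=; [move=> /[swap] /total_topE ->|move=> /total_topE -> ].
Qed.

Let top_law0 u : top_law u set0 = 0.
Proof. by rewrite top_lawE /topset preimage_set0 setI0 measure0. Qed.

Let top_law_ge0 u E : 0 <= top_law u E.
Proof. by rewrite top_lawE measure_ge0. Qed.

Let top_law_additive u : semi_sigma_additive (top_law u).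
Proof.
move=> F mF tF mUF; rewrite top_lawE topset_additive//.
under eq_fun do rewrite (eq_bigr _ (fun i _ => top_lawE u (F i))).
by apply: is_cvg_nneseries => n _ _; exact: measure_ge0.
Qed.

HB.instance Definition _ u := isMeasure.Build _ _ _ (top_law u)
  (top_law0 u) (top_law_ge0 u) (@top_law_additive u).

Let fin_num_top_law u : fin_num_fun (top_law u).
Proof.
move=> A mA; rewrite ge0_fin_numE ?measure_ge0// top_lawE.
apply: le_lt_trans (plane_measure_shadow_fin u).
apply: le_measure; rewrite ?inE//; first exact: measurable_topset.
  exact: measurable_shadow.
by move=> y [].
Qed.

HB.instance Definition _ u := Measure_isFinite.Build _ _ _ (top_law u) (fin_num_top_law u).

Lemma ge0_flux u (f : V -> \bar R) : measurable_fun setT f -> (forall x, 0 <= f x) ->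
  \int[surface B]_x ((weight B u x)%:E * f x) = \int[plane_measure u]_(y in shadow B u) f (top B u y).
Proof.
move=> mf f0; have tl E : measurable E -> top_law u E = \int[surface B]_(x in id @^-1` E) (weight B u x)%:E.
  by move=> mE; rewrite integral_weight//; exact: top_lawE.
apply: (etrans (esym (@ge0_integral_density _ _ _ _ _ (surface B) (top_law u) id (weight B u) f
  (@measurable_id _ _ _) (measurable_weight B u) (weight_ge0 B u) tl mf f0))).
have mt := measurable_total_top u.
apply: (etrans (@ge0_integral_image _ _ _ _ _ (mrestr (plane_measure u) (measurable_shadow B u)) (top_law u)
  (total_top u) f mt (fun=> fun=> erefl) mf f0)).
rewrite integral_mrestr; last exact: measurableT_comp.
by apply: eq_integral => y /set_mem sy; rewrite total_topE.
Qed.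

Lemma flux u (f : V -> R) : measurable_fun setT f ->
  \int[surface B]_x (weight B u x * f x)%:E = \int[plane_measure u]_(y in shadow B u) (f (top B u y))%:E.
Proof.
move=> mf; pose F x := (f x)%:E.
have mF : measurable_fun setT F by apply/measurable_EFinP.
rewrite [LHS]integralE [RHS]integralE; congr (_ - _).
  transitivity (\int[surface B]_x ((weight B u x)%:E * F^\+ x)).
    apply: eq_integral => x _; rewrite !funeposE /F EFinM.
    by rewrite maxe_pMr ?mule0// lee_fin weight_ge0.
  rewrite ge0_flux//; last exact: measurable_funepos.
  by apply: eq_integral => y _; rewrite !funeposE.
transitivity (\int[surface B]_x ((weight B u x)%:E * F^\- x)).
  apply: eq_integral => x _; rewrite !funenegE /F EFinM.
  by rewrite maxe_pMr ?mule0 ?muleN// lee_fin weight_ge0.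
rewrite ge0_flux//; last exact: measurable_funeneg.
by apply: eq_integral => y _; rewrite !funenegE.
Qed.

End Flux.

(** * Divergence theorem *)

Lemma bounded_integrable d0 (T : measurableType d0) (R : realType) (m : {measure set T -> \bar R}) (A : set T)
    (f : T -> R) (M : R) : measurable A -> (m A < +oo)%E -> measurable_fun A f ->
  (forall t, A t -> `|f t| <= M)%R -> m.-integrable A (fun x => (f x)%:E).
Proof.
move=> mA Afin mf fM; apply: measurable_bounded_integrable => //.
by exists M; split => [|N MN t At]; [exact: num_real|exact: le_trans (fM _ At) (ltW MN)].
Qed.

Section Divergence.
Context {R : realType} {d : nat} (B : smooth_body R d).
Local Notation K := (body B).
Local Notation V := 'rV[R]_d.+2.
Local Notation leb := (@lebesgue_measure R).
Local Open Scope ereal_scope.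
Implicit Types (u : @unit_vector R d) (x y z : V).

Lemma measurable_line_integral u (f : V -> \bar R) : measurable_fun setT f ->
  measurable_fun setT (fun y : V => \int[leb]_t f (y + t *: (u : V))%R).
Proof.
have ge0 (g : V -> \bar R) : measurable_fun setT g -> (forall x, 0 <= g x) ->
    measurable_fun setT (fun y : V => \int[leb]_t g (y + t *: (u : V))%R).
  move=> mg g0.
  apply: (@measurable_fun_fubini_tonelli_F _ _ _ _ _ leb (fun p => g (line_point u p))) => //.
  by apply: measurableT_comp => //; exact: measurable_line_point.
move=> mf; under eq_fun do rewrite integralE.
apply: emeasurable_funB.
  apply: (eq_measurable_fun (fun y : V => \int[leb]_t f^\+ (y + t *: (u : V))%R)).
    by move=> y _; apply: eq_integral => t _; rewrite !funeposE.
  by apply: ge0 => //; exact: measurable_funepos.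
apply: (eq_measurable_fun (fun y : V => \int[leb]_t f^\- (y + t *: (u : V))%R)).
  by move=> y _; apply: eq_integral => t _; rewrite !funenegE.
by apply: ge0 => //; exact: measurable_funeneg.
Qed.

Lemma integrable_volume_integral u (f : V -> \bar R) : (volume_along u).-integrable setT f ->
  \int[volume_along u]_x f x = \int[plane_measure u]_y \int[leb]_t f (y + t *: (u : V))%R.
Proof.
move=> If; have mf := measurable_int _ If.
have Ip : \int[volume_along u]_x f^\+ x < +oo.
  by have /integrableP[_] := integrable_funepos measurableT If; under eq_integral do rewrite gee0_abs//.
have In : \int[volume_along u]_x f^\- x < +oo.
  by have /integrableP[_] := integrable_funeneg measurableT If; under eq_integral do rewrite gee0_abs//.
have mp := measurable_funepos mf; have mn := measurable_funeneg mf.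
rewrite !volume_integral// in Ip In; rewrite integralE !volume_integral//.
have I (g : V -> \bar R) : measurable_fun setT g -> (forall x, 0 <= g x) ->
    \int[plane_measure u]_y \int[leb]_t g (y + t *: (u : V))%R < +oo ->
    (plane_measure u).-integrable setT (fun y => \int[leb]_t g (y + t *: (u : V))%R).
  move=> mg g0 gfin; apply/integrableP; split; first exact: measurable_line_integral.
  by under eq_integral do rewrite gee0_abs ?integral_ge0//.
rewrite -integralB//; [|exact: I..].
apply: eq_integral => y _; rewrite [RHS]integralE; congr (_ - _).
  by apply: eq_integral => t _; rewrite !funeposE.
by apply: eq_integral => t _; rewrite !funenegE.
Qed.

Lemma shadow_opp u : shadow B (opp_unit u) = shadow B u.
Proof.
rewrite /shadow; congr (_ @` _); apply/funext => x; rewrite /project /= dotpNr.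
by rewrite scalerN scaleNr opprK.
Qed.

(** As the last point in the opposite direction, it inherits all properties of [top]. *)
Definition bottom u y : V := top B (opp_unit u) y.

Lemma bottomE u y : (bottom u y = y + - height B (opp_unit u) y *: (u : V))%R.
Proof. by rewrite /bottom /top /= scaleNr scalerN. Qed.

Lemma fibreP u y (t : R) : shadow B u y ->
  K (y + t *: (u : V))%R <-> (- height B (opp_unit u) y <= t <= height B u y)%R.
Proof.
move=> sy; have /shadowP[uy _] := sy; split => [Kt|/andP[at_ tb]].
  rewrite height_ub// andbT lerNl; apply: height_ub; first by rewrite plane_opp.
  by rewrite /= scaleNr scalerN opprK.
set a := (- _)%R in at_; set b := height B u y in tb.
have Ka : K (y + a *: (u : V))%R by rewrite -bottomE; apply: top_body; rewrite shadow_opp.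
have Kb : K (y + b *: (u : V))%R by exact: top_body.
have [ab|ab] := eqVneq a b.
  by have -> : t = b by apply/eqP; rewrite eq_le tb -ab at_.
have ab0 : (0 < b - a)%R by rewrite subr_gt0 lt_neqAle ab (le_trans at_ tb).
have -> : (y + t *: (u : V) = (1 - (t - a) / (b - a)) *: (y + a *: (u : V)) + ((t - a) / (b - a)) *: (y + b *: (u : V)))%R.
  by apply/rowP => i; rewrite !mxE; field; rewrite gt_eqF.
have cK := @body_convex _ _ B; rewrite /Defs.convex_set in cK; apply: cK => //.
apply/andP; split; first by rewrite divr_ge0 ?(ltW ab0)// subr_ge0.
by rewrite ler_pdivrMr// mul1r lerB.
Qed.

Lemma bounded_on_body (F : V -> R) : continuous F -> exists2 M : R, (0 < M)%R & forall x, K x -> (`|F x| <= M)%R.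
Proof.
move=> cF; have : compact (F @` K).
  by apply: continuous_compact; [exact: continuous_subspaceT|exact: body_compact].
move=> /compact_bounded[M [_ FM]]; exists (`|M| + 1)%R; first by rewrite ltr_wpDl.
move=> x Kx; apply: FM; last by exists x.
by apply: le_lt_trans (ler_norm _) _; rewrite ltrDl.
Qed.

Lemma volume_body_fin u : volume_along u K < +oo.
Proof.
have [r r0 Kr] := body_bounded B.
apply: le_lt_trans (@volume_ball_fin _ _ u (r + 1) _); last by rewrite addr_gt0.
apply: le_measure; rewrite ?inE//.
- by apply: closed_measurable_rV; exact: body_closed.
- exact: measurable_ball_rV.
- by move=> y /Kr ?; rewrite /=; lra.
Qed.

Section Direction.
Variables (u : @unit_vector R d) (F G : V -> R).
Hypotheses (cF : continuous F) (cG : continuous G).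
Hypothesis dF : forall x (t : R), is_derive t 1%R (fun s : R => F (x + s *: (u : V))%R) (G (x + t *: (u : V))%R).

Let mbody : measurable K.
Proof. by apply: closed_measurable_rV; exact: body_closed. Qed.

Let weight_integrable v : (surface B).-integrable setT (fun x => (weight B v x * F x)%:E).
Proof.
have [M M0 FM] := bounded_on_body cF.
apply: (@bounded_integrable _ _ _ _ _ _ M) => //; first exact: surface_fin.
  by apply: measurable_funM; [exact: measurable_weight|exact: continuous_measurable_rV].
move=> x _; rewrite normrM (ger0_norm (weight_ge0 _ _ _)).
have [bx|bx] := pselect (bdry K x).
  rewrite -[leRHS]mul1r ler_pM ?weight_ge0 ?FM//; last exact: bdry_sub.
  rewrite /weight ge_max ler01/= gaussE//; apply: le_trans (ler_norm _) _.
  by apply: le_trans (cauchy_schwarz _ _) _; rewrite uvecP normal_norm// mul1r.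
have -> : weight B v x = 0%R by rewrite /weight /gauss memNset// dotp0l maxxx.
by rewrite mul0r ltW.
Qed.

Let line_FTC y (a b : R) : (a <= b)%R ->
  \int[leb]_(t in `[a, b]) (G (y + t *: (u : V))%R)%:E = (F (y + b *: (u : V))%R - F (y + a *: (u : V))%R)%:E.
Proof.
rewrite le_eqVlt => /predU1P[->|ab].
  by rewrite set_itv1 integral_set1 subrr.
have cline (f : V -> R) : continuous f -> continuous (fun t : R => f (y + t *: (u : V))%R).
  move=> cf t; apply: (@continuous_comp _ _ _ (fun t : R => y + t *: (u : V))%R f); last exact: cf.
  apply: (@cvgD _ _ _ _ _ (fun=> y) (fun t : R => t *: (u : V))%R); first exact: cvg_cst.
  by apply: cvgZl; exact: cvg_id.
have d1 t : derivable (fun s : R => F (y + s *: (u : V))%R) t 1%R by have [] := dF y t.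
rewrite (@continuous_FTC2 _ (fun t => G (y + t *: (u : V))%R) (fun t => F (y + t *: (u : V))%R))//.
- by apply: continuous_subspaceT; exact: cline.
- split => [t _||]; first exact: d1.
  + by apply: cvg_at_right_filter; exact: cline.
  + by apply: cvg_at_left_filter; exact: cline.
- by move=> t _; rewrite derive1E; exact: derive_val.
Qed.

(** n.u is the weight of [u] minus that of -u, so Cauchy's formula leaves the difference of [F] at
    the two ends of each chord; the fundamental theorem of calculus turns it into the integral of
    [G] along the chord. *)
Lemma flux_divergence :
  \int[surface B]_x (dotp (gauss B x) u * F x)%:E = \int[volume_along u]_(x in K) (G x)%:E.
Proof.
have mF := continuous_measurable_rV cF; have mG := continuous_measurable_rV cG.
under eq_integral => x _ do rewrite -weight_sub mulrBl EFinB.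
rewrite integralB//; [|exact: weight_integrable..].
rewrite !flux// shadow_opp.
have mS := measurable_shadow B u.
rewrite (@eq_measure_integral _ _ _ _ (plane_measure u) (plane_measure (opp_unit u : V))); last first.
  by move=> A mA _; exact: (plane_measure_opp u A).
have [M M0 FM] := bounded_on_body cF.
have It : (plane_measure u).-integrable (shadow B u) (fun y => (F (top B u y))%:E).
  apply: (@bounded_integrable _ _ _ _ _ _ M) => //; first exact: plane_measure_shadow_fin.
    by apply: measurableT_comp => //; exact: measurable_top.
  by move=> y sy; apply: FM; exact: top_body.
have Ib : (plane_measure u).-integrable (shadow B u) (fun y => (F (bottom u y))%:E).
  apply: (@bounded_integrable _ _ _ _ _ _ M) => //; first exact: plane_measure_shadow_fin.
    by apply: measurableT_comp => //; rewrite -shadow_opp; exact: measurable_top.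
  by move=> y sy; apply: FM; apply: top_body; rewrite shadow_opp.
rewrite -[X in _ - X]/(\int[plane_measure u]_(y in shadow B u) (F (bottom u y))%:E) -integralB//.
pose g := (fun x => (G x)%:E) \_ K.
have mg : measurable_fun setT g.
  by apply/(measurable_restrictT _ mbody); apply: measurable_funTS; exact/measurable_EFinP.
have Ig : (volume_along u).-integrable setT g.
  apply/(integrable_mkcond _ mbody); have [M' _ GM'] := bounded_on_body cG.
  apply: (@bounded_integrable _ _ _ _ _ _ M') => //; first exact: volume_body_fin.
  exact: measurable_funTS.
rewrite [RHS]integral_mkcond -/g integrable_volume_integral//.
transitivity (\int[plane_measure u]_(y in shadow B u) \int[leb]_t g (y + t *: (u : V))%R).
  apply: eq_integral => y /set_mem sy; rewrite -EFinB bottomE /top -line_FTC.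
    rewrite integral_mkcond; apply: eq_integral => t _; rewrite /g !patchE.
    by congr (if _ then _ else _); apply/idP/idP => /set_mem h; apply/mem_set; move: h;
      rewrite /= in_itv/= fibreP.
  by have /(fibreP _ sy)/andP[] := top_body sy => h1 h2; exact: le_trans h1 h2.
have mL := measurable_line_integral u mg.
rewrite integral_mkcond; apply: eq_plane_integral => //.
  by apply/(measurable_restrictT _ mS); exact: measurable_funTS.
move=> y uy; rewrite patchE; case: ifPn => // /negP sy.
rewrite integral0_eq// => t _; rewrite /g patchE; case: ifPn => // /set_mem Kt.
by case: sy; rewrite inE; apply/shadowP; split => //; exists t.
Qed.

End Direction.

End Divergence.

(** * Polar coordinates *)

Section WeightedMeasure.
Context d1 d2 {T1 : measurableType d1} {T2 : measurableType d2} {R : realType}.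
Local Open Scope ereal_scope.
Variables (m : {measure set T1 -> \bar R}) (A : set T1) (mA : measurable A)
  (phi : T1 -> T2) (mphi : measurable_fun setT phi) (w : T1 -> R)
  (mw : measurable_fun setT w) (w0 : forall x, (0 <= w x)%R).

Definition weighted_measure (E : set T2) : \bar R := \int[m]_(x in A `&` phi @^-1` E) (w x)%:E.

Let weighted0 : weighted_measure set0 = 0.
Proof. by rewrite /weighted_measure preimage_set0 setI0 integral_set0. Qed.

Let weighted_ge0 E : 0 <= weighted_measure E.
Proof. by apply: integral_ge0 => x _; rewrite lee_fin. Qed.

Let weighted_additive : semi_sigma_additive weighted_measure.
Proof.
move=> F mF tF mUF; rewrite /weighted_measure preimage_bigcup setI_bigcupr.
have mT i : measurable (A `&` phi @^-1` F i).
  by apply: measurableI => //; exact: measurable_preimage.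
rewrite ge0_integral_bigcup//; first last.
- apply/trivIsetP => i j _ _ ij; move/trivIsetP : tF => /(_ i j Logic.I Logic.I ij) Fij.
  by rewrite setIACA setIid -preimage_setI Fij preimage_set0 setI0.
- by move=> x _; rewrite lee_fin.
- by apply/measurable_EFinP; exact: measurable_funTS.
by apply: is_cvg_nneseries => n _ _; apply: integral_ge0 => x _; rewrite lee_fin.
Qed.

Definition weighted : {measure set T2 -> \bar R} :=
  HB.pack weighted_measure (isMeasure.Build _ _ _ weighted_measure weighted0 weighted_ge0 weighted_additive).

End WeightedMeasure.

Section RestrictedSigmaFinite.
Context d0 (T : measurableType d0) (R : realType) (mu : {sigma_finite_measure set T -> \bar R})
  (A : set T) (mA : measurable A).
Local Open Scope ereal_scope.

Let restrict_sigma_finite : sigma_finite setT (mrestr mu mA).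
Proof.
have [F FT Ffin] := sigma_finiteT mu; exists F => // k; have [mF Fk] := Ffin k; split => //.
by apply: le_lt_trans Fk; apply: le_measure; rewrite ?inE//; first exact: measurableI.
Qed.

Definition restricted : {sigma_finite_measure set T -> \bar R} :=
  HB.pack (mrestr mu mA) (Measure_isSigmaFinite.Build _ _ _ (mrestr mu mA) restrict_sigma_finite).

End RestrictedSigmaFinite.

Lemma measurable_inv (R : realType) : measurable_fun setT (fun x : R => x^-1).
Proof.
have -> : [set: R] = [set x | x != 0] `|` [set 0].
  by apply/seteqP; split => x //= _; have [->|] := eqVneq x 0; [right|left].
have o : open [set x : R | x != 0].
  exact: open_neq.
apply/measurable_funU; [exact: open_measurable|exact: measurable_set1|split].
  by apply: open_continuous_measurable_fun => // x /set_mem; exact: inv_continuous.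
exact: measurable_fun_set1.
Qed.

(** * The substitution s = sqrt (t^2 + a^2) *)

Section Hypotenuse.
Context {R : realType} (a : R) (a0 : 0 <= a).
Local Notation leb := (@lebesgue_measure R).
Local Open Scope ereal_scope.

Definition hypot (t : R) : R := Num.sqrt (t ^+ 2 + a ^+ 2).

Definition leg (s : R) : R := Num.sqrt (s ^+ 2 - a ^+ 2).

Lemma hypot_ge0 t : (0 <= hypot t)%R.
Proof. exact: sqrtr_ge0. Qed.

Lemma sqr_hypot t : (hypot t ^+ 2 = t ^+ 2 + a ^+ 2)%R.
Proof. by rewrite sqr_sqrtr// addr_ge0// sqr_ge0. Qed.

Lemma hypot_gt t : (0 < t)%R -> (a < hypot t)%R.
Proof.
move=> t0; rewrite -(ger0_norm a0) -sqrtr_sqr ltr_sqrt; last by rewrite ltr_wpDr ?sqr_ge0// exprn_gt0.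
by rewrite ltrDr exprn_gt0.
Qed.

Lemma hypot_gt0 t : (0 < t)%R -> (0 < hypot t)%R.
Proof. by move=> t0; exact: le_lt_trans (hypot_gt t0). Qed.

Lemma leg_ge0 s : (0 <= leg s)%R.
Proof. exact: sqrtr_ge0. Qed.

Lemma hypotK t : (0 <= t)%R -> leg (hypot t) = t.
Proof. by move=> t0; rewrite /leg sqr_hypot addrK sqrtr_sqr ger0_norm. Qed.

Lemma legK s : (a <= s)%R -> hypot (leg s) = s.
Proof.
move=> as_; have s0 := le_trans a0 as_.
rewrite /hypot /leg sqr_sqrtr ?subr_ge0; first by rewrite subrK sqrtr_sqr ger0_norm.
by rewrite lerXn2r.
Qed.

Lemma lt_hypot s t : (0 <= s)%R -> (0 <= t)%R -> (hypot s < hypot t)%R = (s < t)%R.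
Proof.
move=> s0 t0; apply/idP/idP => [|st].
  rewrite !ltNge; apply: contra => ts.
  by rewrite ler_sqrt ?addr_ge0 ?sqr_ge0// lerD2r lerXn2r.
rewrite ltr_sqrt ?ltrD2r ?ltrXn2r//.
by rewrite ltr_wpDr ?sqr_ge0// exprn_gt0// (le_lt_trans s0).
Qed.

Lemma continuous_hypot : continuous hypot.
Proof.
move=> t; apply: (@continuous_comp _ _ _ (fun t : R => t ^+ 2 + a ^+ 2 : R)%R (@Num.sqrt R)); last exact: sqrt_continuous.
apply: (@cvgD _ _ _ _ _ (fun t : R => t ^+ 2)%R (fun=> a ^+ 2)%R); last exact: cvg_cst.
exact: exprn_continuous.
Qed.

Lemma measurable_hypot : measurable_fun setT hypot.
Proof. exact: continuous_measurable_fun continuous_hypot. Qed.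

(** For t > 0 the derivative of [hypot]. The absolute value keeps it nonnegative on the whole line,
    as a density must be. *)
Definition hypot_slope (t : R) : R := `|t| / hypot t.

Lemma hypot_slope_ge0 t : (0 <= hypot_slope t)%R.
Proof. by rewrite divr_ge0 ?hypot_ge0. Qed.

Lemma measurable_hypot_slope : measurable_fun setT hypot_slope.
Proof.
apply: measurable_funM; first exact: normr_measurable.
apply: measurableT_comp; [exact: measurable_inv|exact: measurable_hypot].
Qed.

Lemma is_derive_hypot (t : R) : (0 < t)%R -> is_derive t 1%R hypot (hypot_slope t).
Proof.
move=> t0; have p : (0 < t ^+ 2 + a ^+ 2)%R by rewrite ltr_wpDr ?sqr_ge0// exprn_gt0.
have h := is_derive1_sqrt p.
rewrite (_ : hypot_slope t = (2 * Num.sqrt (t ^+ 2 + a ^+ 2))^-1 * (2 * t))%R; last first.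
  by rewrite /hypot_slope gtr0_norm// /hypot; field; rewrite gt_eqF// sqrtr_gt0.
apply: (@is_derive1_comp _ Num.sqrt (fun t => t ^+ 2 + a ^+ 2)%R).
apply: is_derive_eq.
by rewrite addr0 -[t%:A]/(t * 1)%R mulr1 mulr_natl mulr2n.
Qed.

Lemma integral_hypot_slope (p q : R) : (0 < a)%R -> (0 <= p)%R -> (p <= q)%R ->
  \int[leb]_(t in `]p, q]) (hypot_slope t)%:E = (hypot q - hypot p)%:E.
Proof.
move=> a1 p0; rewrite le_eqVlt => /predU1P[->|pq].
  by rewrite set_itvoc0 integral_set0 subrr.
rewrite integral_itv_obnd_cbnd; last by apply: measurable_funTS; apply/measurable_EFinP; exact: measurable_hypot_slope.
rewrite (@continuous_FTC2 _ hypot_slope hypot)//.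
- apply: continuous_subspaceT => t; apply: cvgM; first exact: norm_continuous.
  apply: cvgV; last exact: continuous_hypot.
  by rewrite gt_eqF// sqrtr_gt0 ltr_wpDl ?sqr_ge0// exprn_gt0.
- split => [t||].
  + rewrite in_itv/= => /andP[pt _]; have := is_derive_hypot (le_lt_trans p0 pt).
    by move=> /@ex_derive.
  + by apply: cvg_at_right_filter; exact: continuous_hypot.
  + by apply: cvg_at_left_filter; exact: continuous_hypot.
- move=> t; rewrite in_itv/= => /andP[pt _]; have h := is_derive_hypot (le_lt_trans p0 pt).
  by rewrite derive1E; exact: derive_val.
Qed.


(** The substitution rule as an identity of measures: it is checked on half-open intervals by the
    fundamental theorem of calculus and extends by uniqueness of Lebesgue measure. *)
Lemma lebesgue_hypot (A : set R) : (0 < a)%R -> measurable A ->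
  leb (A `&` `]a, +oo[) = \int[leb]_(t in `]0%R, +oo[ `&` hypot @^-1` A) (hypot_slope t)%:E.
Proof.
move=> a1 mA.
(* [hypot] has values above [a] only; the mass below is put back so that uniqueness can be applied
   on the whole line. *)
pose m1 := mrestr leb (measurable_itv `]-oo, a]).
pose m2 := @weighted _ _ (measurableTypeR R) (measurableTypeR R) R leb _ (measurable_itv `]0%R, +oo[) _ measurable_hypot _ measurable_hypot_slope hypot_slope_ge0.
have addE E : measure_add m1 m2 E = leb (E `&` `]-oo, a]) +
    \int[leb]_(t in `]0%R, +oo[ `&` hypot @^-1` E) (hypot_slope t)%:E by exact: measure_addE.
have key E : measurable E -> leb E = measure_add m1 m2 E.
  apply: lebesgue_measure_unique => _ [[x y] /= _ <-].
  have [xy|yx] := ltP x y; last first.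
    by rewrite set_itv_ge ?measure0// bnd_simp -leNgt.
  rewrite lebesgue_measure_itv/= lte_fin xy -[RHS]/(measure_add m1 m2 _) addE.
  have [ya|ay] := leP y a.
    rewrite setIidl; last by move=> t /=; rewrite !in_itv/= => /andP[_ ty]; exact: le_trans ty ya.
    rewrite lebesgue_measure_itv/= lte_fin xy (_ : _ `&` _ = set0) ?integral_set0 ?adde0//.
    apply/seteqP; split => // t [] /=; rewrite !in_itv/= andbT => /hypot_gt at_ /andP[_ ty].
    by have := lt_le_trans at_ (le_trans ty ya); rewrite ltxx.
  pose p := Num.max x a.
  have ap : (a <= p)%R by rewrite le_max lexx orbT.
  have py : (p <= y)%R by rewrite ge_max (ltW xy) ltW.
  have -> : `]0%R, +oo[ `&` hypot @^-1` `]x, y] = `]leg p, leg y]%classic.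
    apply/seteqP; split => [t []|t] /=; rewrite !in_itv/= ?andbT.
      move=> t0 /andP[xt ty]; rewrite -lt_hypot ?leg_ge0 ?(ltW t0)// legK// gt_max xt hypot_gt//=.
      by rewrite leNgt -lt_hypot ?leg_ge0 ?(ltW t0)// legK ?(ltW ay)// -leNgt.
    move=> /andP[pt ty]; have t0 := le_lt_trans (leg_ge0 _) pt; split => //.
    move: pt; rewrite -lt_hypot ?leg_ge0 ?(ltW t0)// legK// gt_max => /andP[-> _]/=.
    by rewrite leNgt -(legK (ltW ay)) lt_hypot ?leg_ge0 ?(ltW t0)// -leNgt.
  rewrite integral_hypot_slope ?leg_ge0//; last first.
    by rewrite leNgt -lt_hypot ?leg_ge0// !legK// ?(ltW ay)// -leNgt.
  rewrite !legK// ?(ltW ay)//.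
  have -> : `]x, y] `&` `]-oo, a] = `]x, a]%classic.
    apply/seteqP; split => t /=; rewrite !in_itv/=; first by move=> [/andP[-> _] ->].
    by move=> /andP[-> ta]; rewrite ta (le_trans ta (ltW ay)).
  rewrite lebesgue_measure_itv/= lte_fin /p; case: ltP => xa.
    by rewrite -!EFinB -EFinD; congr EFin; ring.
  by rewrite add0e.
have := key _ (measurableI _ _ mA (measurable_itv `]a, +oo[)).
rewrite addE => ->.
rewrite (_ : _ `&` _ = set0) ?measure0 ?add0e.
  congr (\int[leb]_(t in _) _); apply/seteqP; split => [t [? []]|t [t0 At]] //.
  by split => //; split => //; move: t0; rewrite /= !in_itv/= !andbT; exact: hypot_gt.
by apply/seteqP; split => // t [[_] /=]; rewrite !in_itv/= andbT => ta /(lt_le_trans ta); rewrite ltxx.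
Qed.

Lemma ge0_integral_hypot (G : R -> \bar R) : measurable_fun setT G -> (forall t, 0 <= G t) ->
  \int[leb]_(s in `]a, +oo[) G s = \int[leb]_(t in `]0%R, +oo[) ((hypot_slope t)%:E * G (hypot t)).
Proof.
(* For a = 0 the slope jumps at 0 and the calculus argument fails, but then [hypot] is the identity
   on t > 0. *)
move=> mG G0; have [a1|a1] := eqVneq a 0%R.
  rewrite a1; apply: eq_integral => t; rewrite inE/= in_itv/= andbT => t0.
  have ht : hypot t = t by rewrite /hypot a1 expr0n addr0 sqrtr_sqr gtr0_norm.
  by rewrite /hypot_slope ht gtr0_norm// divff ?gt_eqF// mul1e.
have {}a1 : (0 < a)%R by rewrite lt_def a1.
pose nu := restricted leb (measurable_itv `]a, +oo[).
pose m := restricted leb (measurable_itv `]0%R, +oo[).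
have -> : \int[leb]_(s in `]a, +oo[) G s = \int[nu]_s G s.
  by rewrite [RHS](@integral_mrestr _ (measurableTypeR R) R leb _ (measurable_itv _)).
have -> : \int[leb]_(t in `]0%R, +oo[) ((hypot_slope t)%:E * G (hypot t)) =
    \int[m]_t ((hypot_slope t)%:E * G (hypot t)).
  rewrite [RHS](@integral_mrestr _ (measurableTypeR R) R leb _ (measurable_itv _))//.
  apply: emeasurable_funM; first by apply/measurable_EFinP; exact: measurable_hypot_slope.
  by apply: measurableT_comp => //; exact: measurable_hypot.
apply: (@ge0_integral_density _ _ _ _ _ m nu hypot hypot_slope) => //.
- exact: measurable_hypot.
- exact: measurable_hypot_slope.
- exact: hypot_slope_ge0.
- move=> E mE; rewrite -[LHS]/(leb (E `&` `]a, +oo[)) lebesgue_hypot//.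
  have mh : measurable (hypot @^-1` E) by apply: measurable_preimage mE; exact: measurable_hypot.
  rewrite [RHS]integral_mkcond [RHS](@integral_mrestr _ (measurableTypeR R) R leb _ (measurable_itv _)).
    by rewrite integral_mkcondr.
  apply/(measurable_restrictT _ mh); apply/measurable_EFinP/measurable_funTS.
  exact: measurable_hypot_slope.
Qed.

End Hypotenuse.

Section UnitBall.
Context {R : realType} {d : nat}.
Local Notation V := 'rV[R]_d.+2.

Definition unit_ball : set V := [set x | enorm x <= 1].

Lemma unit_ball_interior x : interior unit_ball x <-> enorm x < 1.
Proof.
split => [/interior_enorm[r r0 h]|x1]; last first.
  apply/interior_enorm; exists (1 - enorm x); first by rewrite subr_gt0.
  move=> y yx; rewrite /unit_ball/=; have := enormD (y - x) x; rewrite subrK; lra.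
rewrite ltNge; apply/negP => x1.
have x0 : 0 < enorm x by rewrite (lt_le_trans _ x1).
have : unit_ball (x + (r / 2 / enorm x) *: x).
  apply: h; rewrite addrAC subrr add0r enormZ gtr0_norm ?divr_gt0// divfK ?gt_eqF//; lra.
rewrite /unit_ball/= -{1}(scale1r x) -scalerDl enormZ ger0_norm.
  rewrite mulrDl mul1r divfK ?gt_eqF//; lra.
by rewrite addr_ge0// divr_ge0// ?ltW// divr_gt0.
Qed.

Lemma closed_unit_ball : closed unit_ball.
Proof.
rewrite (_ : unit_ball = [set x : V | enorm (x - 0) <= 1]); first exact: closed_enorm_le.
by apply/seteqP; split => x; rewrite /unit_ball/= subr0.
Qed.

Lemma bdry_unit_ball x : bdry unit_ball x <-> enorm x = 1.
Proof.
rewrite /bdry -((closure_id _).1 closed_unit_ball); split => [[x1]|x1].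
  by rewrite unit_ball_interior => /negP; rewrite -leNgt => x2; apply/eqP; rewrite eq_le x1.
by split; [rewrite /unit_ball/= x1|rewrite unit_ball_interior x1 ltxx].
Qed.

Let ball_convex : Defs.convex_set unit_ball.
Proof.
move=> x y t x1 y1 /andP[t0 t1]; rewrite /unit_ball/= in x1 y1 *.
apply: le_trans (enormD _ _) _; rewrite !enormZ !ger0_norm ?subr_ge0//.
have h1 : (1 - t) * enorm x <= (1 - t) * 1 by rewrite ler_wpM2l// subr_ge0.
have h2 : t * enorm y <= t * 1 by rewrite ler_wpM2l.
lra.
Qed.

Let ball_compact : compact unit_ball.
Proof. by apply: (@closed_bounded_compact _ _ _ 1) => //; exact: closed_unit_ball. Qed.

Let ball_center : interior unit_ball 0.
Proof. by apply/unit_ball_interior; rewrite enorm0. Qed.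

Let ball_normal x : bdry unit_ball x -> outer_unit_normal unit_ball x x.
Proof.
move=> /bdry_unit_ball x1; split => // y y1; rewrite dotpBr (dotp_enorm1 x1) subr_le0.
apply: le_trans (ler_norm _) (le_trans (cauchy_schwarz _ _) _).
by rewrite x1 mul1r.
Qed.

(** Testing the normal condition with [v] itself gives v.x >= 1, hence |v - x|^2 <= 0. *)
Let ball_normal_unique x v : bdry unit_ball x -> outer_unit_normal unit_ball x v -> v = x.
Proof.
move=> /bdry_unit_ball x1 [v1 /(_ v)]; rewrite /unit_ball/= v1 lexx => /(_ isT).
rewrite dotpBr (dotp_enorm1 v1) subr_le0 => h; apply/eqP; rewrite -subr_eq0 -enorm_eq0.
rewrite -sqrf_eq0 sqr_enorm eq_le dotp_ge0 andbT !dotpE (dotp_enorm1 v1) (dotp_enorm1 x1) (dotpC x v); lra.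
Qed.

Definition ball_body : smooth_body R d :=
  SmoothBody ball_convex ball_compact ball_center ball_normal ball_normal_unique.

End UnitBall.

Section Polar.
Context {R : realType} {d : nat}.
Local Notation V := 'rV[R]_d.+2.
Local Notation leb := (@lebesgue_measure R).
Local Notation ball := (@ball_body R d).
Local Open Scope ereal_scope.
Implicit Types (u : @unit_vector R d) (x y z : V).

Lemma eq_surface_integral (B : smooth_body R d) (f g : V -> \bar R) :
  measurable_fun setT f -> measurable_fun setT g -> (forall x, bdry B x -> f x = g x) ->
  \int[surface B]_x f x = \int[surface B]_x g x.
Proof.
move=> mf mg fg; apply: ae_eq_integral => //.
exists (~` bdry B); split; first by apply: measurableC; exact: measurable_bdry.
  by apply: (etrans (surfaceE B _)); rewrite setICl measure0.
by move=> x /= h /fg e; apply: h.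
Qed.

Lemma plane_measure_scale u (t : R) (g : V -> \bar R) : (0 < t)%R -> measurable_fun setT g ->
  (forall y, 0 <= g y) ->
  \int[plane_measure u]_y g y = \int[plane_measure u]_y ((t ^+ d.+1)%:E * g (t *: y)%R).
Proof.
move=> t0 mg g0.
have mt : measurable_fun setT ( *:%R t : V -> V).
  by apply: measurable_rV_scale; [exact: measurable_cst|exact: measurable_id].
apply: (@ge0_integral_density _ _ _ _ _ (plane_measure u) (plane_measure u) ( *:%R t)
  (fun=> t ^+ d.+1)%R) => //.
  by move=> _; rewrite exprn_ge0// ltW.
move=> E mE; rewrite integral_cst; last exact: measurable_preimage.
transitivity (@hausdorff R d.+2 d.+1 (E `&` plane u)); first by [].
transitivity ((t ^+ d.+1)%:E * @hausdorff R d.+2 d.+1 ( *:%R t @^-1` E `&` plane u)); last by [].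
rewrite -hausdorff_scale//; congr hausdorff.
apply/seteqP; split => [y [Ey uy]|_ [y [Ey uy] <-]].
  exists (t^-1 *: y)%R; last by rewrite scalerA mulfV ?gt_eqF// scale1r.
  split; first by rewrite /= scalerA mulfV ?gt_eqF// scale1r.
  by rewrite /plane/= dotpZl uy mulr0.
by split => //; rewrite /plane/= dotpZl uy mulr0.
Qed.

Lemma ball_shadow u y : shadow ball u y <-> plane u y /\ (enorm y <= 1)%R.
Proof.
have h t : plane u y -> (enorm y ^+ 2 <= enorm (y + t *: (u : V)) ^+ 2)%R.
  by move=> uy; rewrite !sqr_enorm (dotp_plane_line t uy) lerDl sqr_ge0.
rewrite shadowP; split => [[uy [t yt]]|[uy y1]].
  split => //; rewrite -(@expr_le1 R 2) ?enorm_ge0//.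
  by apply: le_trans (h t uy) _; rewrite expr_le1// enorm_ge0.
by split => //; exists 0%R; rewrite scale0r addr0.
Qed.

Lemma enorm_plane_line u y t : plane u y -> enorm (y + t *: (u : V)) = hypot (enorm y) t.
Proof.
move=> uy; by rewrite /hypot sqr_enorm [(t ^+ 2 + _)%R]addrC -(dotp_plane_line t uy).
Qed.

Lemma ball_top u y : shadow ball u y -> top ball u y = (y + Num.sqrt (1 - enorm y ^+ 2) *: (u : V))%R.
Proof.
move=> sy; have /ball_shadow[uy y1] := sy.
have p : (0 <= 1 - enorm y ^+ 2)%R by rewrite subr_ge0 expr_le1// enorm_ge0.
congr (_ + _ *: _)%R; apply/eqP; rewrite eq_le; apply/andP; split.
  have := top_body sy; rewrite /= /unit_ball/= /top (enorm_plane_line _ uy) /hypot.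
  rewrite -[X in (_ <= X)%R -> _](sqrtr1 R) ler_sqrt// => h.
  by apply: le_trans (ler_norm _) _; rewrite -sqrtr_sqr ler_sqrt// lerBrDr.
apply: height_ub => //; rewrite /= /unit_ball/= (enorm_plane_line _ uy) /hypot sqr_sqrtr//.
by rewrite subrK sqrtr1.
Qed.

Lemma ball_weight_top u y : shadow ball u y ->
  weight ball u (top ball u y) = Num.sqrt (1 - enorm y ^+ 2).
Proof.
move=> sy; have /ball_shadow[uy y1] := sy.
rewrite /weight gaussE; last exact: top_bdry.
rewrite /= ball_top// dotpDl dotpZl dotp_uu uy add0r mulr1.
by apply/max_idPr; exact: sqrtr_ge0.
Qed.

Section Function.
Variable f : V -> \bar R.
Hypotheses (mf : measurable_fun setT f) (f0 : forall x, 0 <= f x).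

(** The inner integral of polar coordinates, with Jacobian t^(d+1) in dimension [d.+2]; the maximum
    cuts off negative radii. *)
Definition radial_integral x : \bar R := \int[leb]_t (((Num.max 0 t) ^+ d.+1)%:E * f (t *: x)%R).

Let pospow_ge0 (t : R) : (0 <= (Num.max 0 t) ^+ d.+1)%R.
Proof. by rewrite exprn_ge0// le_max lexx. Qed.

Let measurable_pospow : measurable_fun setT (fun t : R => (Num.max 0 t) ^+ d.+1)%R.
Proof. by apply: measurable_funX; apply: measurable_maxr. Qed.

Lemma radial_integral_ge0 x : 0 <= radial_integral x.
Proof. by apply: integral_ge0 => t _; rewrite mule_ge0 ?lee_fin. Qed.

Lemma measurable_radial_integral : measurable_fun setT radial_integral.
Proof.
apply: (@measurable_fun_fubini_tonelli_F _ _ _ _ _ leb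
  (fun p : V * measurableTypeR R => ((Num.max 0 (p.2 : R)) ^+ d.+1)%:E * f ((p.2 : R) *: p.1)%R)).
  apply: emeasurable_funM.
    by apply/measurable_EFinP; apply: (measurableT_comp measurable_pospow); exact: measurable_snd.
  apply: measurableT_comp => //.
  by apply: measurable_rV_scale; [exact: measurable_snd|exact: measurable_fst].
by move=> p; rewrite mule_ge0 ?lee_fin.
Qed.

(** The integrand produced by Cauchy's formula for the ball: [y] is in the unit disc, the upper
    hemisphere over it is scaled to radius t. *)
Let Q u (p : V * measurableTypeR R) : \bar R :=
  (Num.sqrt (1 - enorm p.1 ^+ 2) * (Num.max 0 (p.2 : R)) ^+ d.+1)%:E *
  f ((p.2 : R) *: (p.1 + Num.sqrt (1 - enorm p.1 ^+ 2) *: (u : V)))%R.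

(** The same integrand with [y] rescaled by t: now the point is on the sphere of radius t directly
    over [y]. *)
Let Q' u (p : V * measurableTypeR R) : \bar R :=
  (leg (enorm p.1) p.2 / Num.max 0 (p.2 : R))%:E *
  f (p.1 + leg (enorm p.1) p.2 *: (u : V))%R.

Let measurable_sqrt : measurable_fun setT (@Num.sqrt R).
Proof. exact: continuous_measurable_fun (@sqrt_continuous R). Qed.

Let measurable_fst_norm : measurable_fun setT (fun p : V * measurableTypeR R => enorm p.1).
Proof. by apply: measurable_enorm; exact: measurable_fst. Qed.

Let mQ u : measurable_fun setT (Q u).
Proof.
have ms : measurable_fun setT (fun p : V * measurableTypeR R => Num.sqrt (1 - enorm p.1 ^+ 2)%R).
  apply: (measurableT_comp measurable_sqrt); apply: measurable_funB => //.
  exact: measurable_funX.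
apply: emeasurable_funM.
  apply/measurable_EFinP/measurable_funM => //.
  by apply: (measurableT_comp measurable_pospow); exact: measurable_snd.
apply: measurableT_comp => //; apply: measurable_rV_scale; first exact: measurable_snd.
apply: measurable_rV_addr; first exact: measurable_fst.
by apply: measurable_rV_scale => //; exact: measurable_cst.
Qed.

Let mQ' u : measurable_fun setT (Q' u).
Proof.
have m2 : measurable_fun setT (fun p : V * measurableTypeR R => (p.2 : R)) by exact: measurable_snd.
have ml : measurable_fun setT (fun p : V * measurableTypeR R => leg (enorm p.1) p.2).
  apply: (measurableT_comp measurable_sqrt); by apply: measurable_funB; apply: measurable_funX.
apply: emeasurable_funM.
  apply/measurable_EFinP/measurable_funM => //.
  by apply: (measurableT_comp (@measurable_inv R)); exact: measurable_maxr.
apply: measurableT_comp => //; apply: measurable_rV_addr; first exact: measurable_fst.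
by apply: measurable_rV_scale => //; exact: measurable_cst.
Qed.

Let Q0 u p : 0 <= Q u p.
Proof. by rewrite mule_ge0// lee_fin mulr_ge0 ?sqrtr_ge0. Qed.

Let Q'0 u p : 0 <= Q' u p.
Proof. by rewrite mule_ge0// lee_fin divr_ge0 ?sqrtr_ge0// le_max lexx. Qed.

Let slice_scale u (t : R) :
  \int[plane_measure u]_y Q u (y, t) = \int[plane_measure u]_y Q' u (y, t).
Proof.
have [t0|t0] := leP t 0%R.
  have m0 : Num.max 0%R t = 0%R by apply/max_idPl.
  rewrite !integral0_eq// => y _; rewrite /Q /Q'/= m0 ?invr0 ?expr0n/= mulr0 mul0e//.
have mt : Num.max 0%R t = t by apply/max_idPr/ltW.
rewrite [RHS](plane_measure_scale u t0)//; last by apply: measurableT_comp; [exact: mQ'|exact: measurable_pair2].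
apply: eq_integral => y _; rewrite /Q /Q'/= mt.
have -> : leg (enorm (t *: y)) t = (t * Num.sqrt (1 - enorm y ^+ 2))%R.
  rewrite /leg enormZ (gtr0_norm t0) exprMn -{1}(mulr1 (t ^+ 2)%R) -mulrBr sqrtrM ?sqr_ge0//.
  by rewrite sqrtr_sqr gtr0_norm.
rewrite muleA -EFinM; congr (_%:E * f _); last by rewrite scalerDr scalerA.
by field; rewrite gt_eqF.
Qed.

Let fibre_hypot u y :
  \int[leb]_t Q' u (y, t) =
  \int[leb]_t (((Num.max 0 t / hypot (enorm y) t) ^+ 2)%:E * f (y + t *: (u : V))%R).
Proof.
set a := enorm y; have a0 : (0 <= a)%R by exact: enorm_ge0.
have mG : measurable_fun setT (fun t : R => Q' u (y, t)).
  by apply: measurableT_comp; [exact: mQ'|exact: measurable_pair1].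
transitivity (\int[leb]_(t in `]a, +oo[) Q' u (y, t)).
  rewrite [RHS]integral_mkcond; apply: eq_integral => t _; rewrite patchE; case: ifPn => // /negP ta.
  rewrite /Q'/= -/a; have {}ta : (t <= a)%R.
    by rewrite leNgt; apply/negP => h; apply: ta; rewrite inE/= in_itv/= andbT.
  have [t0|t0] := leP t 0%R.
    by rewrite invr0 mulr0 mul0e.
  have -> : leg a t = 0%R; last by rewrite mul0r mul0e.
  by rewrite /leg ler0_sqrtr// subr_le0 lerXn2r ?nnegrE// ltW.
rewrite (ge0_integral_hypot a0 mG)//.
rewrite integral_mkcond; apply: eq_integral => t _; rewrite patchE; case: ifPn => [|/negP t0].
  rewrite inE/= in_itv/= andbT => t0; have h0 := hypot_gt0 a0 t0.
  rewrite /Q'/= -/a hypotK ?(ltW t0)// (max_idPr (ltW h0)) (max_idPr (ltW t0)).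
  by rewrite muleA -EFinM /hypot_slope gtr0_norm// expr2.
have {}t0 : (t <= 0)%R.
  by rewrite leNgt; apply/negP => h; apply: t0; rewrite inE/= in_itv/= andbT.
by rewrite (max_idPl t0) mul0r expr0n mul0e.
Qed.

(** One factor of the squared weight is consumed by Cauchy's formula, the other survives as (x.u)^+
    / |x|. The square appears on the right because the substitution by [hypot] contributes the same
    quotient a second time. *)
Lemma polar_half u :
  \int[surface ball]_x ((weight ball u x ^+ 2)%:E * radial_integral x) =
  \int[volume_along u]_x (((Num.max 0 (dotp x u) / enorm x) ^+ 2)%:E * f x).
Proof.
have mw : measurable_fun setT (fun x => (weight ball u x)%:E).
  by apply/measurable_EFinP; exact: measurable_weight.
transitivity (\int[surface ball]_x ((weight ball u x)%:E * ((weight ball u x)%:E * radial_integral x))).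
  by apply: eq_integral => x _; rewrite expr2 EFinM muleA.
rewrite ge0_flux; first last.
- by move=> x; rewrite mule_ge0 ?radial_integral_ge0// lee_fin weight_ge0.
- by apply: emeasurable_funM => //; exact: measurable_radial_integral.
have mQy : measurable_fun setT (fun y : V => \int[leb]_t Q u (y, t)).
  by apply: (@measurable_fun_fubini_tonelli_F _ _ _ _ _ leb (Q u)).
have mS := measurable_shadow ball u.
transitivity (\int[plane_measure u]_y \int[leb]_t Q u (y, t)).
  transitivity (\int[plane_measure u]_(y in shadow ball u) \int[leb]_t Q u (y, t)).
    apply: eq_integral => y /set_mem sy; rewrite ball_weight_top// ball_top// /radial_integral.
    rewrite -ge0_integralZl//; first last.
    - by move=> t _; rewrite mule_ge0 ?lee_fin.
    - apply: emeasurable_funM; first exact/measurable_EFinP.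
      apply: measurableT_comp => //; apply: measurable_rV_scale; first exact: measurable_id.
      exact: measurable_cst.
    by apply: eq_integral => t _; rewrite /Q/= muleA -EFinM.
  rewrite integral_mkcond; apply: eq_plane_integral => //.
    by apply/(measurable_restrictT _ mS); exact: measurable_funTS.
  move=> y uy; rewrite patchE; case: ifPn => // /negP sy.
  rewrite integral0_eq// => t _; rewrite /Q/= ler0_sqrtr ?mul0r ?mul0e//.
  rewrite subr_le0 -{1}(expr1n _ 2) lerXn2r ?nnegrE ?enorm_ge0//.
  by rewrite leNgt; apply/negP => y1; apply: sy; rewrite inE; apply/ball_shadow; split => //; exact: ltW.
(* The order is exchanged to rescale [y] at fixed radius, and exchanged back to substitute the
   radius at fixed [y]. *)
transitivity (\int[leb]_t \int[plane_measure u]_y Q u (y, t)).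
  by rewrite -fubini_tonelli1// fubini_tonelli2.
under eq_integral do rewrite slice_scale.
transitivity (\int[plane_measure u]_y \int[leb]_t Q' u (y, t)).
  by rewrite -fubini_tonelli2// fubini_tonelli1.
under eq_integral do rewrite fibre_hypot.
pose g x := ((Num.max 0 (dotp x u) / enorm x) ^+ 2)%:E * f x.
have mg : measurable_fun setT g.
  apply: emeasurable_funM => //; apply/measurable_EFinP/measurable_funX/measurable_funM.
    by apply: measurable_maxr => //; apply: measurable_dotp; [exact: measurable_id|exact: measurable_cst].
  by apply: (measurableT_comp (@measurable_inv R)); apply: measurable_enorm; exact: measurable_id.
rewrite [RHS](volume_integral u mg); last by move=> x; rewrite mule_ge0// lee_fin sqr_ge0.
apply: eq_plane_integral.
- apply: (eq_measurable_fun (fun y : V => \int[leb]_t Q' u (y, t))).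
    by move=> y _; exact: fibre_hypot.
  by apply: (@measurable_fun_fubini_tonelli_F _ _ _ _ _ leb (Q' u)).
- exact: (measurable_line_integral u mg).
move=> y uy; apply: eq_integral => t _.
by rewrite /g dotpDl dotpZl dotp_uu uy add0r mulr1 enorm_plane_line.
Qed.

Lemma volume_point u : volume_along u [set 0%R] = 0.
Proof.
rewrite volume_alongE integral0_eq// => y _; apply/eqP; rewrite eq_le measure_ge0 andbT.
rewrite -(lebesgue_measure_set1 (- dotp y u)%R); apply: le_measure; rewrite ?inE//.
  by apply: measurable_fibre; apply: closed_measurable_rV; exact: accessible_closed_set1 (hausdorff_accessible (@norm_hausdorff _ _)) _.
move=> t /= yt; have : dotp (y + t *: (u : V))%R u = 0%R by rewrite yt dotp0l.
by rewrite dotpDl dotpZl dotp_uu mulr1 => /eqP; rewrite addrC addr_eq0 => /eqP.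
Qed.

(** The squared positive parts of x.u over u = e_i and u = -e_i sum to |x|^2. So the factors add up
    to 1 on the sphere, and also in the volume away from the origin, which is null. *)
Lemma polar u0 :
  \int[volume_along u0]_x f x = \int[surface ball]_x radial_integral x.
Proof.
have mR := measurable_radial_integral.
have mw u : measurable_fun setT (fun x => (weight ball u x ^+ 2)%:E).
  by apply/measurable_EFinP/measurable_funX; exact: measurable_weight.
have mwR u : measurable_fun setT (fun x => (weight ball u x ^+ 2)%:E * radial_integral x).
  exact: emeasurable_funM.
have wR0 u x : 0 <= (weight ball u x ^+ 2)%:E * radial_integral x.
  by rewrite mule_ge0 ?radial_integral_ge0// lee_fin sqr_ge0.
have mg u : measurable_fun setT (fun x => ((Num.max 0 (dotp x u) / enorm x) ^+ 2)%:E * f x).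
  apply: emeasurable_funM => //; apply/measurable_EFinP/measurable_funX/measurable_funM.
    by apply: measurable_maxr => //; apply: measurable_dotp; [exact: measurable_id|exact: measurable_cst].
  by apply: (measurableT_comp (@measurable_inv R)); apply: measurable_enorm; exact: measurable_id.
have g0 u x : 0 <= ((Num.max 0 (dotp x u) / enorm x) ^+ 2)%:E * f x.
  by rewrite mule_ge0// lee_fin sqr_ge0.
have sq (t : R) : (Num.max 0 t ^+ 2 + Num.max 0 (- t) ^+ 2 = t ^+ 2)%R.
  by rewrite /Order.max oppr_gt0; case: ltrgt0P => [||->]; rewrite ?sqrrN ?expr0n/= ?addr0 ?add0r.
have sum1 x : (\sum_(i < d.+2) (Num.max 0 (dotp x (axis i)) ^+ 2 + Num.max 0 (dotp x (opp_unit (axis i))) ^+ 2) = enorm x ^+ 2)%R.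
  rewrite sqr_enorm; apply: eq_bigr => i _; rewrite /= dotpNr sq dotp_deltar expr2//.
transitivity (\int[surface ball]_x \sum_(i < d.+2)
    ((weight ball (axis i) x ^+ 2)%:E * radial_integral x +
     (weight ball (opp_unit (axis i)) x ^+ 2)%:E * radial_integral x)); last first.
  apply: eq_surface_integral => //.
    by apply: emeasurable_sum => i; exact: emeasurable_funD.
  move=> x bx.
  under eq_bigr do rewrite -ge0_muleDl ?lee_fin ?sqr_ge0// -EFinD.
  rewrite -ge0_sume_distrl; last by move=> i _; rewrite lee_fin addr_ge0// sqr_ge0.
  rewrite sumEFin; under eq_bigr do rewrite /weight gaussE//.
  by rewrite sum1 (normal_norm bx) expr1n mul1e.
rewrite ge0_integral_sum//; first last.
- by move=> i x _; exact: adde_ge0.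
- by move=> i; exact: emeasurable_funD.
under eq_bigr do rewrite ge0_integralD// !polar_half.
have indep u (h : V -> \bar R) : \int[volume_along u]_x h x = \int[volume_along u0]_x h x.
  by apply: eq_measure_integral => A mA _; exact: volume_along_indep.
transitivity (\sum_(i < d.+2) \int[volume_along u0]_x
    (((Num.max 0 (dotp x (axis i)) / enorm x) ^+ 2)%:E * f x +
     ((Num.max 0 (dotp x (opp_unit (axis i))) / enorm x) ^+ 2)%:E * f x)); last first.
  apply: eq_bigr => i _; apply: (etrans (@ge0_integralD _ _ _ (volume_along u0) setT measurableT _ _
    (fun x _ => g0 (axis i) x) (mg (axis i)) (fun x _ => g0 (opp_unit (axis i)) x) (mg (opp_unit (axis i))))).
  exact: (esym (congr2 adde (indep (axis i) _) (indep (opp_unit (axis i)) _))).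
rewrite -ge0_integral_sum//; first last.
- by move=> i x _; exact: adde_ge0.
- by move=> i; exact: emeasurable_funD.
apply: ae_eq_integral => //.
  by apply: emeasurable_sum => i; exact: emeasurable_funD.
exists [set 0%R]; split.
- by apply: closed_measurable_rV; exact: accessible_closed_set1 (hausdorff_accessible (@norm_hausdorff _ _)) _.
- exact: volume_point.
move=> x /=; apply: contra_notP => /eqP x0 _.
under eq_bigr do rewrite -ge0_muleDl ?lee_fin ?sqr_ge0// -EFinD !expr_div_n -mulrDl.
rewrite -ge0_sume_distrl; last by move=> i _; rewrite lee_fin divr_ge0 ?addr_ge0 ?sqr_ge0.
rewrite sumEFin -mulr_suml sum1 mulfV ?mul1e//.
by rewrite sqrf_eq0 enorm_eq0.
Qed.

End Function.

End Polar.

(** * Integrability of the kernels *)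

Section Singular.
Context {R : realType} {d : nat}.
Local Notation V := 'rV[R]_d.+2.
Local Notation leb := (@lebesgue_measure R).
Local Notation ball := (@ball_body R d).
Local Open Scope ereal_scope.
Implicit Types (u : @unit_vector R d) (x y z p : V).

Lemma surface_integral_bdry (B : smooth_body R d) (f : V -> \bar R) : measurable_fun setT f ->
  \int[surface B]_x f x = \int[surface B]_(x in bdry B) f x.
Proof.
move=> mf; have mb := measurable_bdry B.
rewrite [RHS]integral_mkcond; apply: eq_surface_integral => //.
  by apply/(measurable_restrictT _ mb); exact: measurable_funTS.
by move=> x bx; rewrite patchE mem_set.
Qed.

Lemma polar_at p u0 (f : V -> \bar R) : measurable_fun setT f -> (forall x, 0 <= f x) ->
  \int[volume_along u0]_x f x =
  \int[surface ball]_x \int[leb]_t (((Num.max 0 t) ^+ d.+1)%:E * f (p + t *: x)%R).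
Proof.
move=> mf f0.
have mp : measurable_fun setT (fun x : V => (p + x)%R).
  by apply: measurable_rV_addr; [exact: measurable_cst|exact: measurable_id].
transitivity (\int[volume_along u0]_x f (p + x)%R); last first.
  exact: (@polar _ _ (fun x => f (p + x)%R) (measurableT_comp mf mp) (fun x => f0 _) u0).
have vs A : measurable A -> volume_along u0 A = volume_along u0 ((fun x => p + x)%R @^-1` A).
  move=> mA; apply: (etrans (esym (@volume_along_shift _ _ u0 A p mA))); congr (volume_along u0 _).
  by apply/seteqP; split => x /=; rewrite addrC.
exact: (@ge0_integral_image _ _ _ _ _ (volume_along u0) (volume_along u0) (fun x => (p + x)%R) f mp vs mf f0).
Qed.

Lemma measurable_ball_at p (rho : R) : measurable [set x : V | (enorm (x - p) <= rho)%R].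
Proof. by apply: closed_measurable_rV; exact: closed_enorm_le. Qed.

(** At x = p the value is 0 for n > 0, since the inverse of 0 is 0, and 1 for n = 0. *)
Definition singular p (n : nat) x : R := ((enorm (x - p))^-1 ^+ n)%R.

Lemma singular_ge0 p n x : (0 <= singular p n x)%R.
Proof. by rewrite exprn_ge0// invr_ge0 enorm_ge0. Qed.

Lemma measurable_dist p : measurable_fun setT (fun x : V => enorm (x - p)).
Proof.
by apply: measurable_enorm; apply: measurable_rV_sub; [exact: measurable_id|exact: measurable_cst].
Qed.

Lemma measurable_singular p n : measurable_fun setT (singular p n).
Proof.
apply: measurable_funX; apply: (measurableT_comp (@measurable_inv R)); exact: measurable_dist.
Qed.

(** The Jacobian t^(d+1) cancels the kernel, so each radial integral is at most [rho]. *)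
Lemma volume_singular_fin p (rho : R) u : (0 <= rho)%R ->
  \int[volume_along u]_(x in [set x | (enorm (x - p) <= rho)%R]) (singular p d.+1 x)%:E < +oo.
Proof.
move=> rho0; have mB := measurable_ball_at p rho.
rewrite integral_mkcond; set f := (_ \_ _).
have mf : measurable_fun setT f.
  apply/(measurable_restrictT _ mB); apply: measurable_funTS.
  by apply/measurable_EFinP; exact: measurable_singular.
have f0 x : 0 <= f x by rewrite /f patchE; case: ifP => // _; rewrite lee_fin singular_ge0.
have mfp : measurable_fun setT (fun x : V => f (p + x)%R).
  apply: measurableT_comp => //.
  by apply: measurable_rV_addr; [exact: measurable_cst|exact: measurable_id].
have mrad := measurable_radial_integral mfp (fun x => f0 _).
have rad0 := radial_integral_ge0 (fun x : V => f0 (p + x)%R).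
rewrite (polar_at p u mf f0) (surface_integral_bdry _ mrad).
apply: (@le_lt_trans _ _ (\int[surface ball]_(x in bdry ball) rho%:E)); last first.
  rewrite integral_cst; last exact: measurable_bdry.
  apply: lte_mul_pinfty => //; apply: le_lt_trans (surface_fin ball).
  by apply: le_measure; rewrite ?inE//; exact: measurable_bdry.
apply: ge0_le_integral => //.
- exact: measurable_bdry.
- exact: measurable_funTS.
move=> x /bdry_unit_ball x1.
apply: (@le_trans _ _ (\int[leb]_(t in `[0%R, rho]) 1)); last first.
  rewrite integral_cst//= mul1e lebesgue_measure_itv/= lte_fin.
  by case: ltP => // _; rewrite sube0.
rewrite [leRHS]integral_mkcond; apply: ge0_le_integral => //.
- by move=> t _; rewrite mule_ge0// lee_fin exprn_ge0// le_max lexx.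
- apply: emeasurable_funM; first by apply/measurable_EFinP; apply: measurable_funX; exact: measurable_maxr.
  apply: measurableT_comp => //; apply: measurable_rV_addr; first exact: measurable_cst.
  by apply: measurable_rV_scale; [exact: measurable_id|exact: measurable_cst].
- by apply/(measurable_restrictT _ (measurable_itv _)); exact: measurable_cst.
move=> t _; rewrite patchE.
have [t0|t0] := leP t 0%R.
  rewrite expr0n mul0e; case: ifP => // _; exact: lee01.
have dt : enorm (p + t *: x - p) = t by rewrite addrAC subrr add0r enormZ x1 mulr1 gtr0_norm.
rewrite {1}/f patchE; case: ifPn => [|_]; last by rewrite mule0; case: ifP => // _; exact: lee01.
rewrite inE/= dt => trho; rewrite mem_set; last by rewrite /= in_itv/= (ltW t0).
by rewrite /singular dt -EFinM -exprMn mulfV ?gt_eqF// expr1n.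
Qed.

Variable (B : smooth_body R d).
Local Notation K := (body B).

(** Cauchy's formula along the axes reduces the claim to an integral over shadows. There the value
    at a top point x is bounded by the integral of |.-p|^-(d+1) over a segment of length |x-p| above
    x, so the whole is bounded by the convergent volume integral. *)
Lemma surface_singular_fin p : K p -> \int[surface B]_x (singular p d x)%:E < +oo.
(* For d = 0 the kernel is 1 even at [p], and finite area suffices; for d > 0 its default value 0 at
   [p] disposes of the case x = p. *)
Proof.
move=> Kp; have [d0|d0] := eqVneq d 0%N.
  have s1 n x : n = 0%N -> singular p n x = 1%R by move=> ->; exact: expr0.
  have -> : \int[surface B]_x (singular p d x)%:E = \int[surface B]_x (cst 1 x).
    by apply: eq_integral => x _; rewrite s1.
  by rewrite integral_cst// mul1e; exact: surface_fin.
have [r r0 Kr] := body_bounded B.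
have msing : measurable_fun setT (fun x : V => (singular p d x)%:E).
  by apply/measurable_EFinP; exact: measurable_singular.
have mw u : measurable_fun setT (fun x => (weight B u x)%:E).
  by apply/measurable_EFinP; exact: measurable_weight.
have mws u : measurable_fun setT (fun x => (weight B u x)%:E * (singular p d x)%:E).
  exact: emeasurable_funM.
have s0 n x : 0 <= (singular p n x)%:E by rewrite lee_fin singular_ge0.
have ws0 u x : 0 <= (weight B u x)%:E * (singular p d x)%:E.
  by rewrite mule_ge0// lee_fin weight_ge0.
have mb := measurable_bdry B.
apply: (@le_lt_trans _ _ (\int[surface B]_x
    \sum_(i < d.+2) ((weight B (axis i) x)%:E * (singular p d x)%:E +
      (weight B (opp_unit (axis i)) x)%:E * (singular p d x)%:E))).
  have msum : measurable_fun setT (fun x => \sum_(i < d.+2)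
      ((weight B (axis i) x)%:E * (singular p d x)%:E +
       (weight B (opp_unit (axis i)) x)%:E * (singular p d x)%:E)).
    by apply: emeasurable_sum => i; exact: emeasurable_funD.
  rewrite !surface_integral_bdry//; apply: ge0_le_integral => //.
  - exact: measurable_funTS.
  - exact: measurable_funTS.
  move=> x bx; under eq_bigr do rewrite -!EFinM -EFinD -mulrDl.
  by rewrite sumEFin lee_fin -mulr_suml ler_peMl ?singular_ge0// sum_weight_ge1.
rewrite ge0_integral_sum//; first last.
- by move=> i x _; exact: adde_ge0.
- by move=> i; exact: emeasurable_funD.
suff fin u : \int[surface B]_x ((weight B u x)%:E * (singular p d x)%:E) < +oo.
  apply: lte_sum_pinfty => i _; rewrite ge0_integralD//.
  by rewrite lte_add_pinfty.
rewrite ge0_flux//.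
(* Two points of the body are at most 2r apart, and the segment above x reaches at most twice as far
   from [p]. *)
pose D := [set x : V | (enorm (x - p) <= 4 * r)%R].
have mD : measurable D := measurable_ball_at p _.
pose F := (fun x => (singular p d.+1 x)%:E) \_ D.
have F0 x : 0 <= F x by rewrite /F patchE; case: ifP.
have mF : measurable_fun setT F.
  apply/(measurable_restrictT _ mD); apply: measurable_funTS.
  by apply/measurable_EFinP; exact: measurable_singular.
have mline : measurable_fun setT (fun y : V => \int[leb]_t F (y + t *: (u : V))%R).
  exact: measurable_line_integral.
have line0 y : 0 <= \int[leb]_t F (y + t *: (u : V))%R by exact: integral_ge0.
have mS := measurable_shadow B u.
apply: (@le_lt_trans _ _ ((2 ^+ d.+1)%:E * \int[volume_along u]_x F x)); last first.
  rewrite lte_mul_pinfty ?lee_fin ?exprn_ge0//.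
  by rewrite -integral_mkcond volume_singular_fin// mulr_ge0// ltW.
rewrite volume_integral// -ge0_integralZl ?lee_fin ?exprn_ge0//.
apply: (@le_trans _ _ (\int[plane_measure u]_(y in shadow B u)
    ((2 ^+ d.+1)%:E * \int[leb]_t F (y + t *: (u : V))%R))); last first.
  apply: ge0_subset_integral => //.
    by apply: emeasurable_funM => //; exact: measurable_cst.
  by move=> y _; rewrite mule_ge0// lee_fin exprn_ge0.
apply: ge0_le_integral => //.
- by apply/measurable_EFinP; apply: (measurableT_comp (measurable_singular p d)); exact: measurable_top.
- by apply: measurable_funTS; apply: emeasurable_funM => //; exact: measurable_cst.
move=> y sy; set x := top B u y; set a := enorm (x - p).
have [a0|a0] := eqVneq a 0%R.
  by rewrite /singular -/a a0 invr0 expr0n (negPf d0) mule_ge0// lee_fin exprn_ge0.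
have {}a0 : (0 < a)%R by rewrite lt_def a0 enorm_ge0.
have a2 : (a <= 2 * r)%R.
  by have := enormB x p; have := Kr _ (top_body sy); have := Kr _ Kp; rewrite -/x -/a; lra.
(* The identity a^-d = 2^(d+1) a (2a)^-(d+1): length of the segment times the least value of the
   kernel allowed on it. *)
have h1 : (singular p d x)%:E <= (2 ^+ d.+1)%:E * \int[leb]_(t in `[height B u y, (height B u y + a)%R[)
    ((2 * a)^-1 ^+ d.+1)%:E.
  rewrite integral_cst//= lebesgue_measure_itv/= lte_fin ltrDl a0 -EFinD addrAC subrr add0r.
  rewrite -!EFinM lee_fin /singular -/a le_eqVlt; apply/orP; left; apply/eqP.
  by rewrite mulrA -exprMn invfM mulrA mulfV// mul1r exprS mulrAC mulVf ?mul1r// gt_eqF.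
apply: le_trans h1 _; apply: lee_wpmul2l; first by rewrite lee_fin exprn_ge0.
rewrite integral_mkcond; apply: ge0_le_integral => //.
- by move=> t _; rewrite patchE; case: ifP => // _; rewrite lee_fin exprn_ge0// invr_ge0 mulr_ge0// ltW.
- by apply/(measurable_restrictT _ (measurable_itv _)); exact: measurable_cst.
- apply: measurableT_comp => //; apply: measurable_rV_addr; first exact: measurable_cst.
  by apply: measurable_rV_scale; [exact: measurable_id|exact: measurable_cst].
move=> t _; rewrite patchE; case: ifPn => // /set_mem /=; rewrite in_itv/= => /andP[ht th].
have e : (y + t *: (u : V) - p = (x - p) + (t - height B u y) *: (u : V))%R.
  by rewrite /x /top; apply/rowP => i; rewrite !mxE; ring.
have eu : enorm ((t - height B u y) *: (u : V)) = (t - height B u y)%R.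
  by rewrite enormZ uvecP mulr1 ger0_norm// subr_ge0.
have h2 : (enorm (y + t *: (u : V) - p) <= 2 * a)%R.
  by rewrite e; apply: le_trans (enormD _ _) _; rewrite eu -/a; lra.
(* The half-open interval keeps the point away from [p], where the kernel has its default value
   0. *)
have h3 : (0 < enorm (y + t *: (u : V) - p))%R.
  rewrite e; have := enormB (x - p + (t - height B u y) *: (u : V)) ((t - height B u y) *: (u : V)).
  by rewrite addrK eu -/a; lra.
rewrite /F patchE mem_set; last by rewrite /D/= (le_trans h2)//; lra.
rewrite lee_fin /singular lerXn2r ?nnegrE ?invr_ge0 ?enorm_ge0//.
  by rewrite mulr_ge0// ltW.
by rewrite lef_pV2// posrE mulr_gt0.
Qed.

End Singular.

(** * Chords from a boundary point *)

Section Reach.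
Context {R : realType} {d : nat} (B : smooth_body R d).
Local Notation K := (body B).
Local Notation V := 'rV[R]_d.+2.
Local Notation leb := (@lebesgue_measure R).
Local Notation ball := (@ball_body R d).
Local Open Scope ereal_scope.
Implicit Types (u : @unit_vector R d) (x y z p : V).

Lemma measurable_body : measurable K.
Proof. by apply: closed_measurable_rV; exact: body_closed. Qed.

(** The chord length from [p] in direction [v], written as the measure of a section so that joint
    measurability in [p] and [v] follows from Tonelli. *)
Definition reach p v : R := fine (leb [set t : R | (0 <= t)%R /\ K (p + t *: v)%R]).

Lemma reach_set p u (t : R) : K p ->
  ((0 <= t)%R /\ K (p + t *: (u : V))%R) <-> (0 <= t <= height B u (project u p) - dotp p u)%R.
Proof.
move=> Kp; have sp : shadow B u (project u p) by exists p.
have e : (p + t *: (u : V) = project u p + (dotp p u + t) *: (u : V))%R.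
  by rewrite -[in LHS](projectK u p) scalerDl addrA.
have /(fibreP _ sp)/andP[h1 _] : K (project u p + dotp p u *: (u : V))%R by rewrite projectK.
rewrite e fibreP//; split => [[t0 /andP[_ h2]]|/andP[t0 h2]]; first by rewrite t0/=; lra.
by split => //; apply/andP; split; lra.
Qed.

Lemma reachE p u : K p -> reach p u = (height B u (project u p) - dotp p u)%R.
Proof.
move=> Kp; rewrite /reach (_ : [set t : R | _] = `[0%R, (height B u (project u p) - dotp p u)%R]%classic).
  have := (reach_set u 0%R Kp).1; rewrite scale0r addr0 lexx => /(_ (conj isT Kp))/= h.
  rewrite lebesgue_measure_itv/= lte_fin; case: ltP => h'; first by rewrite sube0.
  by apply/eqP; rewrite eq_le h.
by apply/seteqP; split => t; rewrite /= in_itv/= reach_set.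
Qed.

Lemma reachP p u (t : R) : K p ->
  ((0 <= t)%R /\ K (p + t *: (u : V))%R) <-> (0 <= t <= reach p u)%R.
Proof. by move=> Kp; rewrite reachE//; exact: reach_set. Qed.

Lemma reach_ge0 p v : (0 <= reach p v)%R.
Proof. exact: fine_ge0. Qed.

Lemma reach_le p u (r : R) : K p -> (forall x, K x -> enorm x <= r)%R -> (reach p u <= 2 * r)%R.
Proof.
move=> Kp Kr; have [_ Kq] : (0 <= reach p u)%R /\ K (p + reach p u *: (u : V))%R.
  by apply/reachP => //; rewrite reach_ge0 lexx.
have := enormB (p + reach p u *: (u : V)) p; have := Kr _ Kp; have := Kr _ Kq.
by rewrite addrAC subrr add0r enormZ uvecP mulr1 ger0_norm ?reach_ge0//; lra.
Qed.

Lemma measurable_reach : measurable_fun setT (fun q : V * V => reach q.1 q.2).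
Proof.
pose E : set ((V * V) * measurableTypeR R) :=
  [set q | (0 <= (q.2 : R))%R] `&` (fun q => q.1.1 + (q.2 : R) *: q.1.2)%R @^-1` K.
have m2 : measurable_fun setT (fun q : (V * V) * measurableTypeR R => (q.2 : R)) by exact: measurable_snd.
have mE : measurable E.
  apply: measurableI.
    have := measurable_preimage m2 (measurable_itv `[0%R, +oo[).
    by congr measurable; apply/seteqP; split => x /=; rewrite in_itv/= andbT.
  apply: measurable_preimage measurable_body; apply: measurable_rV_addr.
    by apply: (measurableT_comp measurable_fst); exact: measurable_fst.
  by apply: measurable_rV_scale => //; apply: (measurableT_comp measurable_snd); exact: measurable_fst.
have mx := @measurable_fun_xsection _ _ _ _ _ leb E mE.
apply: (eq_measurable_fun (fun q : V * V => fine (leb (xsection E q)))).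
  move=> q _; rewrite /reach; congr (fine (leb _)).
  by apply/seteqP; split => t; rewrite /xsection/= inE.
by apply: (measurableT_comp _ mx); exact: fine_measurable.
Qed.

(** The [weight] of the direction -v as a function of both variables, for the exchange of
    integrals. *)
Definition back_weight p v : R := Num.max 0%R (- dotp (gauss B p) v)%R.

Lemma back_weight_ge0 p v : (0 <= back_weight p v)%R.
Proof. by rewrite le_max lexx. Qed.

Lemma back_weight_le1 p v : bdry K p -> enorm v = 1%R -> (back_weight p v <= 1)%R.
Proof.
move=> bp v1; rewrite /back_weight ge_max ler01/= gaussE//.
apply: le_trans (ler_norm _) _; rewrite normrN; apply: le_trans (cauchy_schwarz _ _) _.
by rewrite v1 normal_norm// mul1r.
Qed.

Lemma measurable_back_weight : measurable_fun setT (fun q : V * V => back_weight q.1 q.2).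
Proof.
apply: measurable_maxr => //; apply: measurableT_comp => //; apply: measurable_dotp.
  by apply: (measurableT_comp (measurable_gauss B)); exact: measurable_fst.
exact: measurable_snd.
Qed.

Section Antiderivative.
Variables (h k : R -> R).
Hypotheses (ck : continuous k) (dh : forall t : R, is_derive t 1%R h (k t)) (h0 : h 0%R = 0%R).

Lemma continuous_antiderivative : continuous h.
Proof. by move=> t; apply: differentiable_continuous; apply/derivable1_diffP; have [] := dh t. Qed.

Lemma integral_antiderivative (b : R) : (0 <= b)%R ->
  \int[leb]_(t in `[0%R, b]) (k t)%:E = (h b)%:E.
Proof.
rewrite le_eqVlt => /predU1P[<-|b0]; first by rewrite set_itv1 integral_set1 h0.
rewrite (@continuous_FTC2 _ k h)//.
- by rewrite h0 sube0.
- exact: continuous_subspaceT.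
- split => [t _||]; first by have [] := dh t.
  + by apply: cvg_at_right_filter; exact: continuous_antiderivative.
  + by apply: cvg_at_left_filter; exact: continuous_antiderivative.
- by move=> t _; rewrite derive1E; exact: derive_val.
Qed.

Lemma measurable_reach_comp : measurable_fun setT (fun q : V * V => (back_weight q.1 q.2 * h (reach q.1 q.2))%R).
Proof.
apply: measurable_funM; first exact: measurable_back_weight.
apply: (measurableT_comp (continuous_measurable_fun continuous_antiderivative)).
exact: measurable_reach.
Qed.

Lemma measurable_reach_comp1 p :
  measurable_fun setT (fun v : V => (back_weight p v * h (reach p v))%R).
Proof. exact: (measurableT_comp measurable_reach_comp (measurable_pair1 p)). Qed.

Lemma bounded_segment (g : R -> R) (b : R) : continuous g -> exists2 M : R, (0 < M)%R &
  forall t, (0 <= t <= b)%R -> (`|g t| <= M)%R.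
Proof.
move=> cg; have : compact (g @` `[0%R, b]).
  by apply: continuous_compact; [exact: continuous_subspaceT|exact: segment_compact].
move=> /compact_bounded[M [_ gM]]; exists (`|M| + 1)%R; first by rewrite ltr_wpDl.
move=> t tb; apply: gM; last by exists t => //=; rewrite in_itv.
by apply: le_lt_trans (ler_norm _) _; rewrite ltrDl.
Qed.

Lemma bounded_reach_comp : exists2 M : R, (0 < M)%R &
  forall p u, bdry K p -> (`|back_weight p u * h (reach p u)| <= M)%R.
Proof.
have [r r0 Kr] := body_bounded B.
have [M M0 hM] := bounded_segment (2 * r)%R continuous_antiderivative.
exists M => // p u bp; rewrite normrM -[leRHS]mul1r ler_pM//.
  by rewrite ger0_norm ?back_weight_ge0// back_weight_le1// uvecP.
apply: hM; rewrite reach_ge0/=; apply: reach_le Kr; exact: bdry_sub.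
Qed.

Definition volume_density p x : R :=
  (k (enorm (x - p)) * singular p d.+2 x * dotp (gauss B p) (p - x))%R.

Lemma measurable_volume_density p : measurable_fun setT (volume_density p).
Proof.
apply: measurable_funM; first apply: measurable_funM.
- by apply: (measurableT_comp (continuous_measurable_fun ck)); exact: measurable_dist.
- exact: measurable_singular.
apply: measurable_dotp; first exact: measurable_cst.
by apply: measurable_rV_sub; [exact: measurable_cst|exact: measurable_id].
Qed.

Lemma volume_density_le p x (M : R) : bdry K p -> (`|k (enorm (x - p))| <= M)%R ->
  (`|volume_density p x| <= M * singular p d.+1 x)%R.
Proof.
move=> bp kM; rewrite /volume_density (normrM (_ * _)%R) (normrM (k _)) (ger0_norm (singular_ge0 _ _ _)) -mulrA.
apply: ler_pM => //; first by rewrite mulr_ge0 ?singular_ge0.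
have : (`|dotp (gauss B p) (p - x)| <= enorm (x - p))%R.
  by apply: le_trans (cauchy_schwarz _ _) _; rewrite gaussE// normal_norm// mul1r enormC.
have [->|a0] := eqVneq (enorm (x - p)) 0%R.
  by rewrite normr_le0 => /eqP ->; rewrite normr0 mulr0 singular_ge0.
move=> hh; apply: le_trans (_ : _ <= singular p d.+2 x * enorm (x - p))%R _.
  by rewrite ler_wpM2l ?singular_ge0.
by rewrite /singular exprSr -mulrA mulVf ?mulr1.
Qed.

Lemma integrable_volume_density p u : bdry K p ->
  (volume_along u).-integrable K (fun x => (volume_density p x)%:E).
Proof.
move=> bp; have [r r0 Kr] := body_bounded B.
have [M M0 kM] := bounded_segment (2 * r)%R ck.
have mK := measurable_body.
have KD x : K x -> (enorm (x - p) <= 2 * r)%R.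
  by move=> Kx; have := enormB x p; have := Kr _ Kx; have := Kr _ (bdry_sub bp); lra.
apply: (@le_integrable _ _ _ (volume_along u) K mK _ (fun x => (M * singular p d.+1 x)%:E)).
- by apply/measurable_EFinP; apply: measurable_funTS; exact: measurable_volume_density.
- move=> x Kx; rewrite lee_fin (le_trans (volume_density_le bp (M := M) _))// ?ler_norm//.
  by apply: kM; rewrite enorm_ge0 KD.
have ms : measurable_fun setT (fun x => (singular p d.+1 x)%:E).
  by apply/measurable_EFinP; exact: measurable_singular.
under eq_fun do rewrite EFinM; apply: integrableZl => //.
apply/integrableP; split; first exact: measurable_funTS.
under eq_integral do rewrite gee0_abs ?lee_fin ?singular_ge0//.
apply: le_lt_trans (@volume_singular_fin _ _ p (2 * r)%R u _); last by rewrite mulr_ge0// ltW.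
apply: ge0_subset_integral => //.
- exact: measurable_ball_at.
- exact: measurable_funTS.
- by move=> x _; rewrite lee_fin singular_ge0.
Qed.

(** In polar coordinates about [p] the powers of t cancel, leaving k(t) times -n(p).v for t up to
    [reach p v]; integrating k gives h. Nonnegativity is required because [polar_at] is a Tonelli
    statement. *)
Lemma ge0_volume_density_polar p u0 : bdry K p ->
  (forall t u, (0 <= t <= reach p u)%R -> (0 <= k t)%R) ->
  (forall x, K x -> (0 <= volume_density p x)%R) ->
  \int[volume_along u0]_(x in K) (volume_density p x)%:E =
  \int[surface ball]_v (back_weight p v * h (reach p v))%:E.
Proof.
move=> bp k0 D0; have mK := measurable_body.
rewrite integral_mkcond; set f := (_ \_ _).
have mf : measurable_fun setT f.
  apply/(measurable_restrictT _ mK); apply: measurable_funTS.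
  by apply/measurable_EFinP; exact: measurable_volume_density.
have f0 x : 0 <= f x by rewrite /f patchE; case: ifPn => // /set_mem /D0.
have mfp : measurable_fun setT (fun x : V => f (p + x)%R).
  apply: measurableT_comp => //.
  by apply: measurable_rV_addr; [exact: measurable_cst|exact: measurable_id].
have mrad := measurable_radial_integral mfp (fun x => f0 _).
have mr : measurable_fun setT (fun v : V => (back_weight p v * h (reach p v))%:E).
  by apply/measurable_EFinP; exact: measurable_reach_comp1.
rewrite (polar_at p u0 mf f0); apply: eq_surface_integral => // v /bdry_unit_ball v1.
pose u := UnitVector v1; have Kp := bdry_sub bp.
transitivity (\int[leb]_(t in `]0%R, reach p u]) ((back_weight p u)%:E * (k t)%:E)); last first.
  have mk : measurable_fun `]0%R, reach p u] (fun t => (k t)%:E).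
    by apply/measurable_EFinP; apply: measurable_funTS; exact: continuous_measurable_fun.
  rewrite ge0_integralZl//; first last.
  - by rewrite lee_fin back_weight_ge0.
  - by move=> t /=; rewrite in_itv/= => /andP[t0 tr]; rewrite lee_fin (k0 t u)// (ltW t0).
  rewrite integral_itv_obnd_cbnd// integral_antiderivative ?reach_ge0//.
rewrite [RHS]integral_mkcond; apply: eq_integral => t _; rewrite patchE.
have [t0|t0] := leP t 0%R.
  rewrite expr0n mul0e; case: ifPn => // /set_mem /=; rewrite in_itv/= => /andP[].
  by rewrite ltNge t0.
have dt : enorm (p + t *: v - p) = t by rewrite addrAC subrr add0r enormZ v1 mulr1 gtr0_norm.
rewrite /f patchE; case: ifPn => [/set_mem Kt|/negP Kt]; last first.
  rewrite mule0; case: ifPn => // /set_mem /=; rewrite in_itv/= => /andP[_ tr].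
  case: Kt; rewrite inE; have [//] : (0 <= t)%R /\ K (p + t *: (u : V))%R.
  by apply/reachP => //; rewrite (ltW t0).
have /andP[_ tr] : (0 <= t <= reach p u)%R by apply/reachP => //; split => //; exact: ltW.
rewrite mem_set; last by rewrite /= in_itv/= t0.
rewrite -!EFinM /volume_density dt /singular dt; congr EFin.
have -> : (p - (p + t *: v) = - (t *: v))%R by rewrite opprD addNKr.
(* A point of the body on the ray forces [v] to point inwards, so the positive part is attained. *)
have b : back_weight p u = (- dotp (gauss B p) v)%R.
  rewrite /back_weight; apply/max_idPr; rewrite -(pmulr_rge0 _ t0) -dotpNr -dotpZr scalerN gaussE//.
  by have := normal_le bp Kt; rewrite addrAC subrr add0r dotpNr oppr_ge0.
rewrite dotpNr dotpZr b !exprVn (exprS t d.+1) (exprS t d).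
by field; rewrite expf_neq0 ?gt_eqF.
Qed.

End Antiderivative.

(* Adding a large constant c to k makes both k + c and c nonnegative on the relevant range. *)
Lemma volume_density_polar (h k : R -> R) p u0 : continuous k ->
  (forall t : R, is_derive t 1%R h (k t)) -> h 0%R = 0%R -> bdry K p ->
  \int[volume_along u0]_(x in K) (volume_density k p x)%:E =
  \int[surface ball]_v (back_weight p v * h (reach p v))%:E.
Proof.
move=> ck dh h0 bp; have [r r0 Kr] := body_bounded B.
have [M M0 kM] := bounded_segment (2 * r)%R ck.
have Kp := bdry_sub bp.
pose k2 (t : R) := M; pose k1 t := (k t + M)%R.
pose h2 (t : R) := (M * t)%R; pose h1 t := (h t + M * t)%R.
have c2 : continuous k2 by move=> t; exact: cst_continuous.
have c1 : continuous k1.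
  by move=> t; apply: (@cvgD _ _ _ _ _ k (fun=> M)); [exact: ck|exact: cvg_cst].
have d2 (t : R) : is_derive t 1%R h2 (k2 t).
  by apply: is_derive_eq; rewrite -[_ *: _]/(M * 1)%R mulr1.
have d1 (t : R) : is_derive t 1%R h1 (k1 t) by exact: is_deriveD.
have h20 : h2 0%R = 0%R by rewrite /h2 mulr0.
have h10 : h1 0%R = 0%R by rewrite /h1 h0 mulr0 addr0.
have dens_ge0 (g : R -> R) x : (forall t, 0 <= t <= 2 * r -> 0 <= g t)%R -> K x ->
    (0 <= volume_density g p x)%R.
  move=> g0 Kx; rewrite /volume_density mulr_ge0//.
    rewrite mulr_ge0 ?singular_ge0// g0// enorm_ge0/=.
    by have := enormB x p; have := Kr _ Kx; have := Kr _ Kp; lra.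
  rewrite gaussE//; have := normal_le bp Kx.
  by rewrite -opprB dotpNr oppr_le0.
have k10 t : (0 <= t <= 2 * r)%R -> (0 <= k1 t)%R.
  by move=> /kM; rewrite ler_norml /k1 => /andP[? _]; lra.
have k20 t : (0 <= t <= 2 * r)%R -> (0 <= k2 t)%R by move=> _; exact: ltW.
have sub (g : R -> R) : (forall t, 0 <= t <= 2 * r -> 0 <= g t)%R ->
    forall t u, (0 <= t <= reach p u)%R -> (0 <= g t)%R.
  move=> g0 t u /andP[t0 tr]; apply: g0; rewrite t0/= (le_trans tr)//.
  exact: reach_le Kr.
transitivity (\int[volume_along u0]_(x in K) ((volume_density k1 p x)%:E - (volume_density k2 p x)%:E)).
  by apply: eq_integral => x _; rewrite -EFinB /volume_density /k1 /k2 !mulrDl addrK.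
rewrite integralB//; [|exact: measurable_body|exact: integrable_volume_density..].
rewrite (ge0_volume_density_polar c1 d1 h10 u0 bp (sub _ k10) (fun x => dens_ge0 _ x k10)).
rewrite (ge0_volume_density_polar c2 d2 h20 u0 bp (sub _ k20) (fun x => dens_ge0 _ x k20)).
have mb := measurable_bdry ball.
have I (g f : R -> R) : (forall t : R, is_derive t 1%R g (f t)) ->
    (surface ball).-integrable (bdry ball) (fun v => (back_weight p v * g (reach p v))%:E).
  move=> dg; have [M' _ gM'] := bounded_reach_comp dg.
  apply: (@bounded_integrable _ _ _ _ _ _ M') => //.
  - apply: le_lt_trans (surface_fin ball); apply: le_measure; rewrite ?inE//.
  - by apply: measurable_funTS; exact: measurable_reach_comp1 dg p.
  - by move=> v /bdry_unit_ball v1; exact: (gM' p (UnitVector v1) bp).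
rewrite !surface_integral_bdry; [|by apply/measurable_EFinP; first [exact: measurable_reach_comp1 d1 p|exact: measurable_reach_comp1 d2 p|exact: measurable_reach_comp1 dh p]..].
rewrite -integralB//; [|exact: I d1|exact: I d2].
by apply: eq_integral => v _; rewrite -EFinB -mulrBr /h1 /h2 addrK.
Qed.

End Reach.

(** * The flux through the boundary *)

Lemma exists_antiderivative (R : realType) (f : R -> R) : continuous f ->
  exists G : R -> R, forall x : R, 0 < x -> is_derive x 1 G (f x).
Proof.
move=> cf; exists (fun x => \int[lebesgue_measure]_(t in [set` `[0, x]]) f t)%R => x x0.
have x1 : x < x + 1 by rewrite ltrDl.
have I : lebesgue_measure.-integrable `[0, x + 1] (EFin \o f).
  apply: continuous_compact_integrable; first exact: segment_compact.
  exact: continuous_subspaceT.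
have [D E] := continuous_FTC1_closed x1 I x0 (cf x).
exact: (DeriveDef D (etrans (esym (derive1E _ _)) E)).
Qed.

Section DivergenceIdentity.
Context {R : realType} {d : nat} (B : smooth_body R d).
Local Notation K := (body B).
Local Notation V := 'rV[R]_d.+2.
Implicit Types (u : @unit_vector R d) (x y z : V).

Let continuousMV (f g : V -> R) : continuous f -> continuous g -> continuous (fun x => f x * g x).
Proof. by move=> cf cg x; exact: continuousM (cf x) (cg x). Qed.

Let continuousDV (f g : V -> R) : continuous f -> continuous g -> continuous (fun x => f x + g x).
Proof. by move=> cf cg x; exact: continuousD (cf x) (cg x). Qed.

Let continuousNV (f : V -> R) : continuous f -> continuous (fun x => - f x).
Proof. by move=> cf x; exact: continuousN (cf x). Qed.

Let continuousCV (a : R) : continuous (fun x : V => a).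
Proof. by move=> x; exact: cst_continuous. Qed.

Variables (A A' : R -> R).
Hypotheses (dA : forall q : R, 0 <= q -> is_derive q 1 A (A' q))
  (cA' : forall q : R, 0 <= q -> {for q, continuous A'}).
Variables (p w : V).

Let Q x := dotp (x - p) (x - p).

Let cz : continuous (fun x : V => x - p).
Proof. exact: continuous_subr. Qed.

Let cQ : continuous Q.
Proof. exact: continuous_dotp. Qed.

Let clin (v : V) : continuous (fun x => dotp v (x - p)).
Proof. by apply: continuous_dotp => // x; exact: cst_continuous. Qed.

Let cAQ : continuous (fun x => A (Q x)).
Proof.
move=> x; apply: (@continuous_comp _ _ _ Q A); first exact: cQ.
apply: differentiable_continuous; apply/derivable1_diffP.
by have [] := dA (dotp_ge0 (x - p)).
Qed.

Let cA'Q : continuous (fun x => A' (Q x)).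
Proof.
move=> x; apply: (@continuous_comp _ _ _ Q A'); first exact: cQ.
by apply: cA'; exact: dotp_ge0.
Qed.

(* Since A only multiplies fields of the form w Q - (w.z) z, its derivative cancels in
   the divergence. *)
Definition tangent_field (v : V) x : R :=
  A (Q x) * (dotp w v * Q x - dotp w (x - p) * dotp v (x - p)).

(** The derivative of [tangent_field v] in direction [v], for a unit vector [v]. *)
Let partial (v : V) x : R :=
  2 * dotp v (x - p) * A' (Q x) * (dotp w v * Q x - dotp w (x - p) * dotp v (x - p)) +
  A (Q x) * (dotp w v * dotp v (x - p) - dotp w (x - p)).

Let continuous_field v : continuous (tangent_field v).
Proof.
apply: (@continuousMV (fun x => A (Q x))) => //.
apply: (@continuousDV (fun x => dotp w v * Q x)); first exact: (@continuousMV (fun=> dotp w v)).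
apply: (@continuousNV (fun x => dotp w (x - p) * dotp v (x - p))).
exact: (@continuousMV (fun x => dotp w (x - p))).
Qed.

Let continuous_partial v : continuous (partial v).
Proof.
apply: (@continuousDV (fun x => 2 * dotp v (x - p) * A' (Q x) * (dotp w v * Q x - dotp w (x - p) * dotp v (x - p)))).
  apply: (@continuousMV (fun x => 2 * dotp v (x - p) * A' (Q x))).
    apply: (@continuousMV (fun x => 2 * dotp v (x - p))) => //.
    exact: (@continuousMV (fun x => 2)).
  apply: (@continuousDV (fun x => dotp w v * Q x)); first exact: (@continuousMV (fun=> dotp w v)).
  apply: (@continuousNV (fun x => dotp w (x - p) * dotp v (x - p))).
  exact: (@continuousMV (fun x => dotp w (x - p))).
apply: (@continuousMV (fun x => A (Q x))) => //.
apply: (@continuousDV (fun x => dotp w v * dotp v (x - p))); first exact: (@continuousMV (fun=> dotp w v)).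
exact: (@continuousNV (fun x => dotp w (x - p))).
Qed.

Let derive_field u x (t : R) :
  is_derive t 1 (fun s : R => tangent_field u (x + s *: (u : V))) (partial u (x + t *: (u : V))).
Proof.
pose a := dotp w (x - p); pose b := dotp (u : V) (x - p); pose c := dotp w u; pose q0 := Q x.
have zE s : x + s *: (u : V) - p = (x - p) + s *: (u : V) by rewrite addrAC.
have aE s : dotp w (x + s *: (u : V) - p) = a + s * c by rewrite zE dotpDr dotpZr.
have bE s : dotp (u : V) (x + s *: (u : V) - p) = b + s by rewrite zE dotpDr dotpZr dotp_uu mulr1.
pose q (s : R) := q0 + 2 * b * s + s ^+ 2.
have qE s : Q (x + s *: (u : V)) = q s.
  rewrite /Q zE /q /q0 /Q /b; move: (x - p) => z.
  by rewrite dotpDl !dotpDr !dotpZl !dotpZr dotp_uu (dotpC z u); ring.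
have -> : (fun s : R => tangent_field u (x + s *: (u : V))) =
    (A \o q) * (fun s : R => c * q s - (a + s * c) * (b + s)).
  by apply/funext => s; rewrite /tangent_field !qE aE bE.
have dq : is_derive t 1 q (2 * b + 2 * t).
  apply: is_derive_eq; rewrite ?scaler0 ?add0r ?addr0 -?[_ *: _]/(_ * _); ring.
have q_ge0 : 0 <= q t by rewrite -qE; exact: dotp_ge0.
have dAq : is_derive t 1 (A \o q) (A' (q t) * (2 * b + 2 * t)).
  by apply: is_derive1_comp; exact: dA.
have dR : is_derive t 1 (fun s : R => c * q s - (a + s * c) * (b + s))
    (c * (2 * b + 2 * t) - (a + t * c) - (b + t) * c).
  apply: is_derive_eq; rewrite ?scaler0 ?add0r ?addr0 -?[_ *: _]/(_ * _); ring.
apply: is_derive_eq; rewrite /partial !qE aE bE -![_ *: _]/(_ * _) /= -/c; ring.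
Qed.

Local Open Scope ereal_scope.

(** The field is linear in its vector argument, so its normal component is a sum over the axes, each
    term treated by [flux_divergence]. In the divergence the terms with A' cancel; those with A
    contribute 1 - (d+2) = -(d+1) times w.(x - p). *)
Lemma divergence_identity u0 :
  \int[surface B]_(x in bdry K) (tangent_field (gauss B x) x)%:E =
  \int[volume_along u0]_(x in K) (d.+1%:R * (A (Q x) * dotp w (p - x)))%:E.
Proof.
have mK := measurable_body B; have mb := measurable_bdry B.
have indep v (h : V -> \bar R) : \int[volume_along v]_(x in K) h x = \int[volume_along u0]_(x in K) h x.
  by apply: eq_measure_integral => C mC _; exact: volume_along_indep.
have key (v : @unit_vector R d) := flux_divergence B (@continuous_field v) (@continuous_partial v) (@derive_field v).
have mF v : measurable_fun setT (fun x => (dotp (gauss B x) v * tangent_field v x)%:E).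
  apply/measurable_EFinP/measurable_funM.
    by apply: measurable_dotp; [exact: measurable_gauss|exact: measurable_cst].
  exact: continuous_measurable_rV.
transitivity (\int[surface B]_(x in bdry K) \sum_(i < d.+2)
    (dotp (gauss B x) (axis i) * tangent_field (axis i) x)%:E).
  apply: eq_integral => x _; rewrite sumEFin; congr EFin.
  under eq_bigr => i _ do rewrite dotp_deltar /tangent_field dotp_deltar dotp_deltal mulrCA mulrBr.
  rewrite -mulr_sumr sumrB /tangent_field; congr (_ * (_ - _))%R.
    rewrite /dotp mulr_suml; apply: eq_bigr => i _; ring.
  rewrite /dotp mulr_sumr; apply: eq_bigr => i _; ring.
rewrite integral_sum//; last first.
  move=> i; have [M M0 FM] := bounded_on_body B (@continuous_field (axis i)).
  apply: (@bounded_integrable _ _ _ _ _ _ M) => //.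
  - by apply: le_lt_trans (surface_fin B); apply: le_measure; rewrite ?inE.
  - by apply: measurable_funTS; apply/measurable_EFinP; exact: mF.
  move=> x bx; rewrite normrM -[leRHS]mul1r ler_pM//; last by apply: FM; exact: bdry_sub.
  apply: le_trans (cauchy_schwarz _ _) _; rewrite uvecP mulr1 gaussE//.
  by rewrite normal_norm.
under eq_bigr => i _ do rewrite -surface_integral_bdry// key indep.
rewrite -integral_sum//; last first.
  move=> i; have [M M0 FM] := bounded_on_body B (@continuous_partial (axis i)).
  apply: (@bounded_integrable _ _ _ _ _ _ M) => //; first exact: volume_body_fin.
  by apply: measurable_funTS; exact: continuous_measurable_rV.
apply: eq_integral => x _; rewrite sumEFin; congr EFin.
rewrite /partial; under eq_bigr => i _ do rewrite !dotp_deltar !dotp_deltal.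
have e1 : (\sum_(i < d.+2) w 0 i * (x - p) 0 i = dotp w (x - p))%R by [].
have e2 : (\sum_(i < d.+2) (x - p) 0 i * (x - p) 0 i = Q x)%R by [].
have -> : dotp w (p - x) = (- dotp w (x - p))%R by rewrite -dotpNr opprB.
rewrite big_split/=.
transitivity (2 * A' (Q x) * (Q x * \sum_(i < d.+2) w 0 i * (x - p) 0 i -
    dotp w (x - p) * \sum_(i < d.+2) (x - p) 0 i * (x - p) 0 i) +
  A (Q x) * (\sum_(i < d.+2) w 0 i * (x - p) 0 i - \sum_(i < d.+2) dotp w (x - p)))%R.
  congr (_ + _)%R.
    rewrite !mulr_sumr -sumrB mulr_sumr; apply: eq_bigr => i _; ring.
  by rewrite -sumrB mulr_sumr.
rewrite e1 e2 sumr_const card_ord -(mulr_natl (dotp w (x - p)) d.+2) -(natr1 d.+1); ring.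
Qed.

End DivergenceIdentity.

(** * Removing the singularity of the kernel *)

Section Regularize.
Context {R : realType} (n : nat) (k : R -> R).
Hypothesis ck : continuous k.

(** k(r) r^-n as a function of q = r^2, because the squared distance, unlike the distance, is
    differentiable at [p]. *)
Definition kernel (q : R) : R := k (Num.sqrt q) * (Num.sqrt q)^-1 ^+ n.

Lemma continuous_kernel (q : R) : 0 < q -> {for q, continuous kernel}.
Proof.
move=> q0; apply: continuousM.
  by apply: (@continuous_comp _ _ _ (@Num.sqrt R) k); [exact: sqrt_continuous|exact: ck].
apply: (@continuous_comp _ _ _ (fun q : R => (Num.sqrt q)^-1) (fun t : R => t ^+ n)); last exact: exprn_continuous.
apply: (@continuous_comp _ _ _ (@Num.sqrt R) (fun t : R => t^-1)); first exact: sqrt_continuous.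
by apply: inv_continuous; rewrite gt_eqF// sqrtr_gt0.
Qed.

(** The truncation makes the kernel continuous on the whole line, so that it has an antiderivative;
    only arguments above [e] are sampled later, where nothing was changed. *)
Lemma continuous_truncated_kernel (e : R) : 0 < e -> continuous (fun q => kernel (Num.max q e)).
Proof.
move=> e0 q; apply: (@continuous_comp _ _ _ (fun q : R => Num.max q e) kernel).
  apply: (@continuous_max _ _ (fun q : R => q) (fun=> e)); [exact: cvg_id|exact: cst_continuous].
by apply: continuous_kernel; rewrite lt_max e0 orbT.
Qed.

(* Difference quotients of an antiderivative: by the mean value theorem they take values of
   the kernel at points slightly to the right. *)
Lemma regularize (e : R) : 0 < e -> exists A A' : R -> R,
  [/\ forall q : R, 0 <= q -> is_derive q 1 A (A' q), forall q : R, 0 <= q -> {for q, continuous A'} &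
   forall q, 0 <= q -> exists2 xi, q < xi <= q + 2 * e & A q = kernel xi].
Proof.
move=> e0; have ca := continuous_truncated_kernel e0.
have [G dG] := exists_antiderivative ca.
pose a q := kernel (Num.max q e).
exists (fun q => (G (q + 2 * e) - G (q + e)) / e), (fun q => (a (q + 2 * e) - a (q + e)) / e).
have dGs (c q : R) : 0 < c -> 0 <= q -> is_derive q 1 (fun q : R => G (q + c)) (a (q + c)).
  move=> c0 q0; rewrite -[a _]mulr1; apply: (@is_derive1_comp _ G (fun q : R => q + c)).
    by apply: dG; rewrite ltr_wpDl.
  by apply: is_derive_eq; rewrite addr0.
have cas c : continuous (fun q : R => a (q + c)).
  move=> q; apply: (@continuous_comp _ _ _ (fun q : R => q + c) a); last exact: ca.
  by apply: (@cvgD _ _ _ _ _ (fun q : R => q) (fun=> c)); [exact: cvg_id|exact: cvg_cst].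
split.
- move=> q q0; have d1 := dGs _ q (mulr_gt0 (ltr0Sn _ 1) e0) q0; have d2 := dGs _ q e0 q0.
  have -> : (fun q => (G (q + 2 * e) - G (q + e)) / e) =
      e^-1 *: ((fun q => G (q + 2 * e)) - (fun q => G (q + e))).
    by apply/funext => s; rewrite /= mulrC.
  by apply: is_derive_eq; rewrite -[_ *: _]/(_ * _) mulrC.
- move=> q q0; apply: (@continuousM _ _ (fun q => a (q + 2 * e) - a (q + e)) (fun=> e^-1)); last exact: cst_continuous.
  by apply: (@continuousB _ _ _ (fun q => a (q + 2 * e)) (fun q => a (q + e))); exact: cas.
move=> q q0.
have lt1 : q + e < q + 2 * e by lra.
have cG t : 0 < t -> {for t, continuous G}.
  by move=> t0; apply: differentiable_continuous; apply/derivable1_diffP; have [] := dG t t0.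
have [||xi] := @MVT _ G a _ _ lt1.
- by move=> t; rewrite in_itv/= => /andP[t1 _]; apply: dG; lra.
- apply: continuous_in_subspaceT => t /set_mem /=; rewrite in_itv/= => /andP[t1 _].
  by apply: cG; lra.
rewrite in_itv/= => /andP[x1 x2] E; exists xi; first by apply/andP; split; lra.
rewrite E /a (max_idPl _); last by lra.
by field; rewrite gt_eqF.
Qed.

Lemma cvg_kernel (q : R) (xi : nat -> R) : 0 < q ->
  (forall m, q < xi m <= q + 2 * m.+1%:R^-1) -> kernel (xi m) @[m --> \oo] --> kernel q.
Proof.
move=> q0 xq; apply: (continuous_cvg _ (continuous_kernel q0)).
apply: (@squeeze_cvgr _ _ _ _ (fun=> q) (fun m => q + 2 * m.+1%:R^-1)); last 2 first.
- exact: cvg_cst.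
- rewrite -[X in _ --> X]addr0 -[X in _ --> _ + X](mulr0 2).
  by apply: cvgD; [exact: cvg_cst|apply: cvgMr; exact: cvg_harmonic].
by apply: nearW => m; have /andP[/ltW -> ->] := xq m.
Qed.

(** Sampling to the right of [q] only decreases the singular factor; this makes the domination
    uniform in the regularisation. *)
Lemma kernel_le (q xi M : R) : 0 < q -> q < xi -> `|k (Num.sqrt xi)| <= M ->
  `|kernel xi| <= M * (Num.sqrt q)^-1 ^+ n.
Proof.
move=> q0 qx kM; rewrite /kernel normrM ler_pM//.
rewrite ger0_norm ?exprn_ge0 ?invr_ge0 ?sqrtr_ge0//.
rewrite lerXn2r ?nnegrE ?invr_ge0 ?sqrtr_ge0// lef_pV2 ?posrE ?sqrtr_gt0//.
  by rewrite ler_sqrt ltW// (lt_trans q0).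
exact: lt_trans qx.
Qed.

End Regularize.

Section SurfaceVolume.
Context {R : realType} {d : nat} (B : smooth_body R d).
Local Notation K := (body B).
Local Notation V := 'rV[R]_d.+2.
Implicit Types (u : @unit_vector R d) (x y z p : V).
Variable k : R -> R.
Hypothesis ck : continuous k.

Definition surface_density p x : R :=
  k (enorm (x - p)) * singular p d.+2 x *
  (dotp (gauss B p) (gauss B x) * enorm (x - p) ^+ 2 -
   dotp (gauss B p) (x - p) * dotp (gauss B x) (x - p)).

Let field_bound p x : bdry K p -> bdry K x ->
  `|dotp (gauss B p) (gauss B x) * enorm (x - p) ^+ 2 -
    dotp (gauss B p) (x - p) * dotp (gauss B x) (x - p)| <= 2 * enorm (x - p) ^+ 2.
Proof.
move=> bp bx; rewrite !gaussE//; have n1 := normal_norm bp; have n2 := normal_norm bx.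
apply: le_trans (ler_normB _ _) _; rewrite mulr_natl mulr2n; apply: lerD.
  rewrite normrM [X in _ * X]ger0_norm ?sqr_ge0// -[leRHS]mul1r ler_wpM2r ?sqr_ge0//.
  by apply: le_trans (cauchy_schwarz _ _) _; rewrite n1 n2 mulr1.
rewrite normrM expr2 ler_pM//; apply: le_trans (cauchy_schwarz _ _) _.
  by rewrite n1 mul1r.
by rewrite n2 mul1r.
Qed.

(** An equality away from [p]; at x = p the left side is 0, while the right side is 1 when d = 0. *)
Let singular_sqr p x : singular p d.+2 x * enorm (x - p) ^+ 2 <= singular p d x.
Proof.
have [e0|e0] := eqVneq (enorm (x - p)) 0.
  by rewrite e0 expr0n mulr0 singular_ge0.
rewrite /singular; move: (enorm (x - p)) e0 => a a0.
by rewrite -[d.+2]addn2 exprD -mulrA -exprMn mulVf// expr1n mulr1.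
Qed.

Lemma measurable_surface_density :
  measurable_fun setT (fun q : V * V => surface_density q.1 q.2).
Proof.
have mz : measurable_fun setT (fun q : V * V => q.2 - q.1).
  by apply: measurable_rV_sub; [exact: measurable_snd|exact: measurable_fst].
have mr : measurable_fun setT (fun q : V * V => enorm (q.2 - q.1)) by exact: measurable_enorm.
have m1 : measurable_fun setT (fun q : V * V => gauss B q.1).
  by apply: (measurableT_comp (measurable_gauss B)); exact: measurable_fst.
have m2 : measurable_fun setT (fun q : V * V => gauss B q.2).
  by apply: (measurableT_comp (measurable_gauss B)); exact: measurable_snd.
apply: measurable_funM.
  apply: measurable_funM.
    exact: (measurableT_comp (continuous_measurable_fun ck) mr).
  by apply: measurable_funX; exact: (measurableT_comp (@measurable_inv R) mr).
apply: measurable_funB; apply: measurable_funM.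
- exact: measurable_dotp.
- exact: measurable_funX.
- exact: measurable_dotp.
- exact: measurable_dotp.
Qed.

Lemma measurable_surface_density1 p : measurable_fun setT (surface_density p).
Proof. exact: (measurableT_comp measurable_surface_density (measurable_pair1 p)). Qed.

Local Open Scope ereal_scope.

(** The divergence identity for the regularised kernels [A m], passed to the limit. The dominating
    functions are 2M |x-p|^-d on the boundary and (d+1) M |x-p|^-(d+1) on the body; at x = p both
    integrands vanish before and after the limit. *)
Theorem surface_volume p u0 : bdry K p ->
  \int[surface B]_(x in bdry K) (surface_density p x)%:E =
  \int[volume_along u0]_(x in K) (d.+1%:R * volume_density B k p x)%:E.
Proof.
move=> bp; have Kp := bdry_sub bp.
have mK := measurable_body B; have mb := measurable_bdry B.
have [r r0 Kr] := body_bounded B.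
have KD x : K x -> (enorm (x - p) <= 2 * r)%R.
  by move=> Kx; have := enormB x p; have := Kr _ Kx; have := Kr _ Kp; lra.
(* The kernels are sampled at xi <= (2r)^2 + 2 <= (2r + 2)^2, so sqrt xi stays in this segment. *)
have [M M0 kM] := bounded_segment (2 * r + 2)%R ck.
have e0 m : (0 < m.+1%:R^-1 :> R)%R by rewrite invr_gt0.
have [A AP] := choice (fun m => regularize d.+2 ck (e0 m)).
pose Q x := dotp (x - p) (x - p).
have QE x : Q x = (enorm (x - p) ^+ 2)%R by rewrite sqr_enorm.
have sQ x : Num.sqrt (Q x) = enorm (x - p) by [].
have Q0 x : (0 <= Q x)%R by exact: dotp_ge0.
have A_le m x : K x -> (0 < Q x)%R -> (`|A m (Q x)| <= M * singular p d.+2 x)%R.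
  move=> Kx Qx; have [A' [_ _ /(_ _ (Q0 x))[xi /andP[x1 x2] ->]]] := AP m.
  apply: (kernel_le _ Qx x1); apply: kM; rewrite sqrtr_ge0/=.
  have c0 : (0 <= 2 * r + 2)%R by move: r0; lra.
  rewrite -ler_sqr ?nnegrE ?sqrtr_ge0// sqr_sqrtr; last exact: ltW (lt_trans Qx x1).
  have : (m.+1%:R^-1 <= 1 :> R)%R by rewrite invf_le1// ler1n.
  have h : (Q x <= (2 * r) ^+ 2)%R by rewrite QE lerXn2r ?nnegrE ?enorm_ge0 ?KD// mulr_ge0// ltW.
  move=> em; apply: le_trans x2 _; apply: (@le_trans _ _ ((2 * r) ^+ 2 + 2 * 1))%R.
    by apply: lerD => //; rewrite ler_pM2l.
  rewrite -subr_ge0 (_ : _ - _ = 8 * r + 2)%R; last by ring.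
  by rewrite addr_ge0// mulr_ge0// ltW.
have A_cvg x : (0 < Q x)%R -> A m (Q x) @[m --> \oo] --> kernel d.+2 k (Q x).
  move=> Qx; have xiP m : exists xi, (Q x < xi <= Q x + 2 * m.+1%:R^-1)%R /\ A m (Q x) = kernel d.+2 k xi.
    by have [A' [_ _ /(_ _ (Q0 x))[xi ? ?]]] := AP m; exists xi.
  have [xi xiE] := choice xiP.
  have -> : (fun m => A m (Q x)) = (fun m => kernel d.+2 k (xi m)).
    by apply/funext => m; have [] := xiE m.
  by apply: (@cvg_kernel _ _ _ ck _ _ Qx) => m; have [] := xiE m.
have mA m : measurable_fun setT (fun x => A m (Q x)).
  apply: continuous_measurable_rV => x; apply: (@continuous_comp _ _ _ Q (A m)).
    by apply: continuous_dotp; exact: continuous_subr.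
  apply: differentiable_continuous; apply/derivable1_diffP.
  by have [A' [/(_ _ (Q0 x))[]]] := AP m.
have mz : measurable_fun setT (fun x : V => (x - p)%R).
  by apply: measurable_rV_sub; [exact: measurable_id|exact: measurable_cst].
have mz' : measurable_fun setT (fun x : V => (p - x)%R).
  by apply: measurable_rV_sub; [exact: measurable_cst|exact: measurable_id].
have mG := measurable_gauss B.
have mc (v : V) : measurable_fun setT (fun _ : V => v) by exact: measurable_cst.
have mf m : measurable_fun setT (fun x => tangent_field (A m) p (gauss B p) (gauss B x) x).
  apply: measurable_funM => //; apply: measurable_funB; apply: measurable_funM; exact: measurable_dotp.
have mg m : measurable_fun setT (fun x => (d.+1%:R * (A m (Q x) * dotp (gauss B p) (p - x)))%R).
  apply: measurable_funM; first exact: measurable_cst.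
  by apply: measurable_funM => //; exact: measurable_dotp.
have lhs : (\int[surface B]_(x in bdry K) (tangent_field (A m) p (gauss B p) (gauss B x) x)%:E)
    @[m --> \oo] --> \int[surface B]_(x in bdry K) (surface_density p x)%:E.
  have ms : measurable_fun setT (fun x => (singular p d x)%:E).
    by apply/measurable_EFinP; exact: measurable_singular.
  apply: (@dominated_cvg _ _ _ (surface B) _ mb _ _ (fun x => (2 * M)%:E * (singular p d x)%:E)).
  - by move=> m; apply: measurable_funTS; apply/measurable_EFinP.
  - move=> x bx; apply: cvg_EFin; first exact: nearW.
    have [Qx|Qx] := eqVneq (Q x) 0%R.
      have r1 : enorm (x - p) = 0%R by rewrite -sQ Qx sqrtr0.
      rewrite (_ : _ \o _ = fun=> surface_density p x); first exact: cvg_cst.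
      apply/funext => m; rewrite /= /tangent_field -/(Q x) Qx /surface_density r1.
      move/eqP: r1; rewrite enorm_eq0 => /eqP ->.
      by rewrite !dotp0r expr0n/= !mulr0 subr0 !mulr0.
    have {}Qx : (0 < Q x)%R by rewrite lt_def Qx Q0.
    rewrite /surface_density -QE -sQ.
    have -> : (singular p d.+2 x = (Num.sqrt (Q x))^-1 ^+ d.+2)%R by [].
    apply: cvgMl; exact: A_cvg.
  - by move=> x _.
  - apply: integrableZl => //; apply/integrableP; split; first exact: measurable_funTS.
    under eq_integral do rewrite gee0_abs ?lee_fin ?singular_ge0//.
    by rewrite -surface_integral_bdry//; exact: surface_singular_fin.
  move=> m x bx; rewrite -EFinM lee_fin /tangent_field -/(Q x) QE normrM.
  have [Qx|Qx] := eqVneq (Q x) 0%R.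
    have r1 : enorm (x - p) = 0%R by rewrite -sQ Qx sqrtr0.
    move/eqP: (r1); rewrite enorm_eq0 => /eqP ->.
    rewrite enorm0 !dotp0r expr0n/= !mulr0 subr0 normr0 mulr0.
    by rewrite !mulr_ge0 ?singular_ge0// ltW.
  have {}Qx : (0 < Q x)%R by rewrite lt_def Qx Q0.
  rewrite -QE; apply: (@le_trans _ _ (M * singular p d.+2 x * (2 * enorm (x - p) ^+ 2)))%R.
    by apply: ler_pM => //; [apply: A_le => //; exact: bdry_sub|rewrite QE field_bound].
  rewrite (_ : _ * (2 * _) = 2 * M * (singular p d.+2 x * enorm (x - p) ^+ 2))%R; last by ring.
  by rewrite ler_pM2l ?mulr_gt0//; exact: singular_sqr.
have rhs : (\int[volume_along u0]_(x in K) (d.+1%:R * (A m (Q x) * dotp (gauss B p) (p - x)))%:E)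
    @[m --> \oo] --> \int[volume_along u0]_(x in K) (d.+1%:R * volume_density B k p x)%:E.
  have ms : measurable_fun setT (fun x => (singular p d.+1 x)%:E).
    by apply/measurable_EFinP; exact: measurable_singular.
  apply: (@dominated_cvg _ _ _ (volume_along u0) _ mK _ _ (fun x => (d.+1%:R * M)%:E * (singular p d.+1 x)%:E)).
  - by move=> m; apply: measurable_funTS; apply/measurable_EFinP.
  - move=> x Kx; apply: cvg_EFin; first exact: nearW.
    have [Qx|Qx] := eqVneq (Q x) 0%R.
      have r1 : enorm (x - p) = 0%R by rewrite -sQ Qx sqrtr0.
      rewrite (_ : _ \o _ = fun=> (d.+1%:R * volume_density B k p x)%R); first exact: cvg_cst.
      apply/funext => m; rewrite /= /volume_density r1.
      move/eqP: r1; rewrite enorm_eq0 subr_eq0 => /eqP ->.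
      by rewrite subrr !dotp0r !mulr0.
    have {}Qx : (0 < Q x)%R by rewrite lt_def Qx Q0.
    rewrite /volume_density -sQ.
    have -> : (singular p d.+2 x = (Num.sqrt (Q x))^-1 ^+ d.+2)%R by [].
    apply: cvgMr; apply: cvgMl; exact: A_cvg.
  - by move=> x _.
  - apply: integrableZl => //; apply/integrableP; split; first exact: measurable_funTS.
    under eq_integral do rewrite gee0_abs ?lee_fin ?singular_ge0//.
    apply: le_lt_trans (@volume_singular_fin _ _ p (2 * r)%R u0 _); last by rewrite mulr_ge0// ltW.
    apply: ge0_subset_integral => //.
    + exact: measurable_ball_at.
    + exact: measurable_funTS.
    + by move=> x _; rewrite lee_fin singular_ge0.
  move=> m x Kx; rewrite -EFinM lee_fin normrM ger0_norm// -mulrA ler_pM2l//.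
  have [Qx|Qx] := eqVneq (Q x) 0%R.
    have r1 : enorm (x - p) = 0%R by rewrite -sQ Qx sqrtr0.
    move/eqP: (r1); rewrite enorm_eq0 subr_eq0 => /eqP ->.
    by rewrite subrr dotp0r mulr0 normr0 mulr_ge0 ?singular_ge0// ltW.
  have {}Qx : (0 < Q x)%R by rewrite lt_def Qx Q0.
  rewrite normrM; apply: (@le_trans _ _ (M * singular p d.+2 x * enorm (x - p)))%R.
    apply: ler_pM => //; first exact: A_le.
    by apply: le_trans (cauchy_schwarz _ _) _; rewrite gaussE// normal_norm// mul1r enormC.
  rewrite -mulrA ler_pM2l// /singular exprSr -mulrA mulVf ?mulr1//.
  by rewrite -sQ gt_eqF// sqrtr_gt0.
apply: (cvg_unique _ lhs) => //.
rewrite (_ : (fun m => _) = (fun m => \int[volume_along u0]_(x in K) (d.+1%:R * (A m (Q x) * dotp (gauss B p) (p - x)))%:E))//.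
apply/funext => m; have [A' [h1 h2 _]] := AP m.
exact: divergence_identity h1 h2 _ _ _.
Qed.

End SurfaceVolume.

(** * Cosines and normals *)

Section Cosines.
Context {R : realType} {n : nat}.
Local Notation V := 'rV[R]_n.
Implicit Types (a b e v w : V).

Let enorm_proj e v : enorm e = 1 -> enorm (proj_perp e v) = Num.sqrt (dotp v v - dotp v e ^+ 2).
Proof.
move=> e1; congr Num.sqrt; rewrite /proj_perp dotpBl !dotpBr !dotpZl !dotpZr (dotp_enorm1 e1) (dotpC e v).
ring.
Qed.

Let dotp_proj e v w : enorm e = 1 -> dotp (proj_perp e v) (proj_perp e w) = dotp v w - dotp v e * dotp w e.
Proof.
move=> e1; rewrite /proj_perp dotpBl !dotpBr !dotpZl !dotpZr (dotp_enorm1 e1) (dotpC e w).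
ring.
Qed.

(** The sine of the angle between line and normal. If the line is normal to the surface the
    projection is 0, and the default value 0 of [cos_angle] is the right one. *)
Let cos_proj e v : enorm e = 1 -> enorm v = 1 ->
  cos_angle e (proj_perp v e) = Num.sqrt (1 - dotp v e ^+ 2).
Proof.
move=> e1 v1; have E := enorm_proj e v1; rewrite (dotp_enorm1 e1) (dotpC e v) in E.
rewrite /cos_angle -!enorm_eq0 e1 oner_eq0/= E; case: ifPn => [/eqP ->//|s0].
have -> : dotp e (proj_perp v e) = Num.sqrt (1 - dotp v e ^+ 2) ^+ 2.
  rewrite -E sqr_enorm /proj_perp dotpBl !dotpBr !dotpZl !dotpZr (dotp_enorm1 e1) (dotp_enorm1 v1) (dotpC e v).
  ring.
by rewrite mul1r expr2 mulfK.
Qed.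

(** The first two cosines are the lengths of the projections of v and w onto the complement of e,
    exactly the denominators of the third; what remains is the inner product of these
    projections. *)
Lemma cos_product e v w : enorm e = 1 -> enorm v = 1 -> enorm w = 1 ->
  cos_angle e (proj_perp v e) * cos_angle e (proj_perp w e) *
  cos_angle (proj_perp e v) (proj_perp e w) = dotp v w - dotp v e * dotp w e.
Proof.
move=> e1 v1 w1; rewrite !cos_proj// -(dotp_proj v w e1).
have Ev := enorm_proj v e1; have Ew := enorm_proj w e1.
rewrite (dotp_enorm1 v1) in Ev; rewrite (dotp_enorm1 w1) in Ew.
rewrite /cos_angle -Ev -Ew; case: ifPn => [/orP[/eqP ->|/eqP ->]|].
- by rewrite dotp0l mulr0.
- by rewrite dotp0r mulr0.
rewrite negb_or -!enorm_eq0 => /andP[a0 b0].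
by rewrite mulrC divfK// mulf_neq0.
Qed.

End Cosines.

Lemma chord_integrandE (R : realType) (d : nat) (B : smooth_body R d) (k : R -> R) p x :
  bdry B p -> bdry B x -> chord_integrand (normal B) k p x = surface_density B k p x.
Proof.
move=> bp bx; rewrite /chord_integrand /surface_density !gaussE//.
have [->|px] := eqVneq p x.
  by rewrite subrr enorm0 !dotp0r expr0n/= !mulr0 subr0 mulr0.
have r0 : 0 < enorm (x - p).
  by rewrite enorm_gt0 subr_eq0 eq_sym.
set e := (enorm (x - p))^-1 *: (x - p).
have e1 : enorm e = 1 by rewrite enormZ gtr0_norm ?invr_gt0// mulVf ?gt_eqF.
rewrite (enormC p x) (_ : (d.+2 - 2)%N = d); last by rewrite !subSS subn0.
transitivity (k (enorm (x - p)) / enorm (x - p) ^+ d *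
  (cos_angle e (proj_perp (normal B p) e) * cos_angle e (proj_perp (normal B x) e) *
   cos_angle (proj_perp e (normal B p)) (proj_perp e (normal B x)))).
  by rewrite !mulrA.
rewrite cos_product ?normal_norm// !dotpZr.
have -> : singular p d.+2 x = (enorm (x - p))^-1 ^+ d * (enorm (x - p))^-1 ^+ 2.
  by rewrite -exprD addn2.
move: (dotp (normal B p) _) (dotp (normal B p) _) (dotp (normal B x) _) => s t1 t2.
move: (enorm (x - p)) r0 => a a0.
rewrite !exprVn; field.
by rewrite expf_neq0 ?gt_eqF.
Qed.

(** * Uniqueness of the normal from a C^1 defining function *)

Section NormalUnique.
Context {R : realType} {n : nat}.
Local Notation V := 'rV[R]_n.
Implicit Types (x y v w : V).
Variables (g : V -> R) (gC1 : C1fun g).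

Let part (i : 'I_n) x : R := derive g x (delta_mx 0 i).

Let derive_line i y (t : R) :
  is_derive t 1 (fun s : R => g (y + s *: delta_mx 0 i)) (part i (y + t *: delta_mx 0 i)).
Proof.
have [D _] := gC1 i; have {}D := D (y + t *: delta_mx 0 i).
have E : (fun h : R => h^-1 *: (((fun s : R => g (y + s *: delta_mx 0 i)) \o shift t) (h *: 1) - g (y + t *: delta_mx 0 i))) =
   (fun h : R => h^-1 *: ((g \o shift (y + t *: delta_mx 0 i)) (h *: delta_mx 0 i) - g (y + t *: delta_mx 0 i))).
  apply/funext => h; congr (_ *: (g _ - _)).
  by rewrite /= -[h *: 1]/(h * 1) mulr1 scalerDl addrCA.
apply: DeriveDef; first by rewrite /derivable E.
by rewrite /derive E.
Qed.

(** Only partial derivatives are given, so the point moves one coordinate at a time, with the mean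
    value theorem on each leg. The bound is uniform in [y] near [x] because each leg of the
    induction starts from a new point. *)
Lemma C1_increment x (w : V) (l : seq 'I_n) (e : R) : 0 < e ->
  exists2 delta : R, 0 < delta & forall y (t : R), enorm (y - x) < delta -> 0 < t < delta ->
    g (y + t *: \sum_(i <- l) w 0 i *: delta_mx 0 i) - g y <=
    t * (\sum_(i <- l) w 0 i * part i x + e).
Proof.
elim: l e => [|i l IH] e e0.
  exists 1 => // y t _ /andP[t0 _]; rewrite !big_nil scaler0 addr0 subrr add0r.
  by rewrite mulr_ge0// ltW.
have e2 : 0 < e / 2 by rewrite divr_gt0.
have [d1 d10 H1] := IH _ e2.
have [_ cpart] := gC1 i.
pose c := 1 + `|w 0 i|; have c0 : 0 < c by rewrite ltr_pwDl.
have [d2 d20 H2] : exists2 d2 : R, 0 < d2 & forall z, enorm (z - x) < d2 -> `|part i z - part i x| < e / 2 / c.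
  have : nbhs x [set z | `|part i z - part i x| < e / 2 / c].
    have /cvgrPdist_lt/(_ (e / 2 / c)) := cpart x.
    rewrite divr_gt0// => /(_ isT); apply: filterS => z.
    by rewrite distrC.
  by move=> /nbhs_enorm[d2 d20 H2]; exists d2.
(* Moving one coordinate by at most t |w_i| keeps the point within dl (1 + |w_i|) of [x], below both
   radii. *)
pose dl := Num.min (d1 / (2 * c)) (d2 / (2 * c)).
exists dl; first by rewrite lt_min !divr_gt0// mulr_gt0.
move=> y t yx /andP[t0 tdl].
have k1 : dl * (2 * c) <= d1 by rewrite -ler_pdivlMr ?mulr_gt0// ge_min lexx.
have k2 : dl * (2 * c) <= d2 by rewrite -ler_pdivlMr ?mulr_gt0// ge_min lexx orbT.
have c1 : 1 <= c by rewrite lerDl.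
have near s : 0 <= s <= t -> enorm (y + (s * w 0 i) *: delta_mx 0 i - x) < dl * (2 * c).
  move=> /andP[s0 st]; rewrite addrAC; apply: le_lt_trans (enormD _ _) _.
  rewrite enormZ enorm_delta mulr1 normrM (ger0_norm s0).
  have : s * `|w 0 i| <= t * `|w 0 i| by rewrite ler_wpM2r.
  have : t * `|w 0 i| <= dl * `|w 0 i| by rewrite ler_wpM2r// ltW.
  have : 0 <= dl by rewrite ltW// (lt_trans t0).
  have : 0 <= dl * `|w 0 i| by rewrite mulr_ge0// ltW// (lt_trans t0).
  by rewrite /c; nra.
pose y' := y + (t * w 0 i) *: delta_mx 0 i : V.
have -> : y + t *: (\sum_(j <- i :: l) w 0 j *: delta_mx 0 j) = y' + t *: (\sum_(j <- l) w 0 j *: delta_mx 0 j).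
  by rewrite big_cons scalerDr addrA scalerA.
have tt : 0 <= t <= t by rewrite lexx ltW.
have h1 := H1 y' t (lt_le_trans (near _ tt) k1).
have td1 : 0 < t < d1.
  rewrite t0/= (lt_le_trans tdl)// (le_trans _ k1)// ler_peMr ?(ltW (lt_trans t0 tdl))//.
  by move: c1; lra.
have {}h1 := h1 td1.
have dphi (s : R) : is_derive s 1 (fun s : R => g (y + (s * w 0 i) *: delta_mx 0 i))
    (part i (y + (s * w 0 i) *: delta_mx 0 i) * w 0 i).
  apply: (@is_derive1_comp _ (fun s : R => g (y + s *: delta_mx 0 i)) (fun s : R => s * w 0 i)).
    exact: derive_line.
  apply: is_derive_eq; rewrite scaler0 add0r -[_ *: _]/(_ * _) mulr1//.
have [|s] := @MVT _ (fun s : R => g (y + (s * w 0 i) *: delta_mx 0 i))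
    (fun s => part i (y + (s * w 0 i) *: delta_mx 0 i) * w 0 i) 0 t t0.
  apply: continuous_subspaceT => s; apply: differentiable_continuous; apply/derivable1_diffP.
  by have [] := dphi s.
rewrite in_itv/= => /andP[s0 st]; rewrite mul0r scale0r addr0 subr0 -/y' => E.
have h2 := H2 _ (lt_le_trans (near s _) k2); rewrite ltW//= ltW// in h2; have {}h2 := h2 isT.
rewrite big_cons.
have h3 : part i (y + (s * w 0 i) *: delta_mx 0 i) * w 0 i - w 0 i * part i x <= e / 2.
  rewrite (mulrC (w 0 i)) -mulrBl; apply: le_trans (ler_norm _) _; rewrite normrM.
  apply: (@le_trans _ _ (e / 2 / c * c)); last by rewrite divfK// gt_eqF.
  by apply: ler_pM => //; [exact: ltW|rewrite /c lerDr].
have -> : g (y' + t *: (\sum_(j <- l) w 0 j *: delta_mx 0 j)) - g y =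
  (g (y' + t *: (\sum_(j <- l) w 0 j *: delta_mx 0 j)) - g y') + (g y' - g y) by ring.
rewrite E.
apply: le_trans (lerD h1 (lexx _)) _; rewrite [_ * t]mulrC -mulrDr ler_pM2l//.
by move: h3; lra.
Qed.

Variables (K : set V) (x : V) (r : R).
Hypotheses (r0 : 0 < r) (Kx : K x) (gK : forall y, enorm (y - x) < r -> (K y <-> g y <= 0))
  (gx : exists i, part i x != 0).

Let grad : V := \row_i part i x.

Let grad0 : 0 < dotp grad grad.
Proof.
have [i gi] := gx; rewrite lt_def dotp_ge0 andbT; apply/negP; rewrite dotp_eq0 => /eqP E.
by move/eqP: gi; apply; have := congr1 (fun v : V => v 0 i) E; rewrite !mxE.
Qed.

(** A direction along which g decreases at first order leads from [x] into the body, where the outer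
    normal condition applies. *)
Let descend v w : outer_unit_normal K x v -> dotp w grad < 0 -> dotp v w <= 0.
Proof.
(* With this error the bound on the increment of g becomes exactly 0. *)
move=> [_ vK] wg; have e0 : 0 < - dotp w grad by rewrite oppr_gt0.
have [dl dl0 H] := C1_increment x w (index_enum 'I_n) e0.
pose c := 1 + enorm w; have c0 : 0 < c by rewrite ltr_pwDl ?enorm_ge0.
pose t := Num.min (dl / 2) (r / (2 * c)).
have t0 : 0 < t by rewrite lt_min !divr_gt0// mulr_gt0.
have tdl : t < dl by apply: le_lt_trans (_ : _ <= dl / 2) _; [rewrite ge_min lexx|lra].
have trc : t * (2 * c) <= r by rewrite -ler_pdivlMr ?mulr_gt0// ge_min lexx orbT.
have := H x t; rewrite subrr enorm0 t0 tdl -row_sum_delta => /(_ dl0 isT).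
have -> : \sum_(i <- index_enum 'I_n) w 0 i * part i x = dotp w grad.
  by apply: eq_bigr => i _; rewrite mxE.
rewrite subrr mulr0 subr_le0 => gt.
have gx0 : g x <= 0 by apply/gK => //; rewrite subrr enorm0.
have Kt : K (x + t *: w).
  apply/gK; last exact: le_trans gt gx0.
  rewrite addrAC subrr add0r enormZ (gtr0_norm t0); apply: lt_le_trans trc.
  by rewrite ltr_pM2l// /c; have := enorm_ge0 w; lra.
by have := vK _ Kt; rewrite addrAC subrr add0r dotpZr pmulr_rle0.
Qed.

(** With v' the component of v orthogonal to the gradient, all directions M v' - grad are
    descending, so M |v'|^2 <= v.grad for every M, which forces v' = 0. The case M = 0 gives the
    sign. *)
Let normal_grad v : outer_unit_normal K x v -> v = (enorm grad)^-1 *: grad.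
Proof.
move=> nv; pose G := dotp grad grad; pose l := dotp v grad / G.
pose v' := v - l *: grad.
have gv : dotp v' grad = 0 by rewrite /v' dotpBl dotpZl /l /G divfK ?subrr// gt_eqF.
have vv : dotp v v' = dotp v' v'.
  transitivity (dotp (v' + l *: grad) v'); first by rewrite subrK.
  by rewrite dotpDl dotpZl (dotpC grad) gv mulr0 addr0.
have H M : M * dotp v' v' - dotp v grad <= 0.
  rewrite -vv -dotpZr -dotpBr; apply: descend => //.
  by rewrite dotpBl dotpZl gv mulr0 sub0r oppr_lt0.
have v'0 : v' = 0.
  apply/eqP; rewrite -dotp_eq0 eq_le dotp_ge0 andbT leNgt; apply/negP => p.
  by have := H ((dotp v grad + 1) / dotp v' v'); rewrite divfK ?gt_eqF//; lra.
have vl : v = l *: grad by apply/eqP; rewrite -subr_eq0; apply/eqP.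
have l0 : 0 <= l.
  rewrite /l divr_ge0 ?dotp_ge0//; have := H 0; rewrite mul0r; lra.
rewrite vl; congr (_ *: _); have [v1 _] := nv.
have g1 : 0 < enorm grad by rewrite sqrtr_gt0.
have : l * enorm grad = 1 by rewrite -v1 [in RHS]vl enormZ ger0_norm.
by move=> /(canRL (mulfK (lt0r_neq0 g1))); rewrite mul1r.
Qed.

Lemma outer_unit_normal_unique v w :
  outer_unit_normal K x v -> outer_unit_normal K x w -> v = w.
Proof. by move=> /normal_grad -> /normal_grad ->. Qed.

End NormalUnique.

(** * Exchange of integrals *)

Section Crofton.
Context {R : realType} {d : nat} (B : smooth_body R d).
Local Notation K := (body B).
Local Notation V := 'rV[R]_d.+2.
Local Notation leb := (@lebesgue_measure R).
Local Notation ball := (@ball_body R d).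
Local Notation sphere := (@unit_sphere R d.+2).
Implicit Types (u : @unit_vector R d) (x y z p : V).
Variables (h k : R -> R).
Hypotheses (ck : continuous k) (dh : forall t : R, is_derive t 1 h (k t)) (h0 : h 0 = 0).
Local Open Scope ereal_scope.

Let sphereE : sphere = bdry ball.
Proof. by apply/seteqP; split => v /bdry_unit_ball. Qed.

(** Measuring the chord from its first point turns the integral over lines into one over boundary
    points. *)
Lemma chord_lengthE u y : shadow B u y -> chord_length K y u = reach B (bottom B u y) u.
Proof.
move=> sy; have /shadowP[uy _] := sy.
have sy' : shadow B (opp_unit u) y by rewrite shadow_opp.
have Kb : K (bottom B u y) by exact: top_body.
rewrite reachE// /chord_length -/(height B u y); congr (_ - _)%R.
  congr height; rewrite bottomE; exact/esym/project_line.
rewrite bottomE dotpDl dotpZl dotp_uu uy add0r mulr1 /inf; congr (- _)%R.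
rewrite /height; congr sup; apply/seteqP; split => t /=.
  by move=> [s Ks <-]; rewrite scaleNr scalerN opprK.
by move=> Kt; exists (- t)%R; rewrite ?opprK// scaleNr -scalerN.
Qed.

Lemma line_meets u y : plane u y -> (K `&` line y u !=set0) <-> shadow B u y.
Proof.
move=> uy; rewrite shadowP; split => [[z [Kz [t zt]]]|[_ [t Kt]]].
  by split => //; exists t; rewrite -zt.
by exists (y + t *: (u : V))%R; split => //; exists t.
Qed.

Let F (y v : V) : \bar R :=
  if `[< (K `&` line y v) !=set0 >] then (h (chord_length K y v))%:E else 0.

Let psi p v : R := (back_weight B p v * h (reach B p v))%R.

Let mh : measurable_fun setT h.
Proof. exact: continuous_measurable_fun (continuous_antiderivative dh). Qed.

Let mreach v : measurable_fun setT (fun p : V => reach B p v).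
Proof. exact: (measurableT_comp (measurable_reach B) (measurable_pair2 v)). Qed.

(** Cauchy's formula for the direction -u: each line meeting the body is represented by its first
    boundary point. *)
Lemma direction_integral u :
  ointegral (@sigma R d.+2) [set y | dotp y u = 0%R] (fun y => F y u) =
  \int[surface B]_p (psi p u)%:E.
Proof.
pose g := (fun y => (h (reach B (total_top B (opp_unit u) y) u))%:E) \_ (shadow B u).
have mS := measurable_shadow B u.
have mt : measurable_fun setT (fun y : V => (h (reach B (total_top B (opp_unit u) y) u))%:E).
  apply/measurable_EFinP; apply: (measurableT_comp mh); apply: (measurableT_comp (mreach u)).
  exact: measurable_total_top.
have mg : measurable_fun setT g.
  by apply/(measurable_restrictT _ mS); exact: measurable_funTS.
rewrite (@ointegralE _ _ _ (plane u) (plane_measure u) (fun y => F y u) g)//; first last.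
- move=> y uy; rewrite /F /g patchE; case: asboolP => [/(line_meets uy) sy|ns].
    rewrite mem_set// chord_lengthE// total_topE ?shadow_opp//.
  by rewrite memNset// => /(line_meets uy).
- by move=> C; rewrite setIC.
transitivity (\int[surface B]_x (weight B (opp_unit u) x * h (reach B x u))%:E); last first.
  by apply: eq_integral => x _; rewrite /psi /back_weight /weight /= dotpNr.
rewrite flux; last by apply: (measurableT_comp mh).
rewrite shadow_opp -integral_mkcond.
rewrite [RHS](@eq_measure_integral _ _ _ _ (plane_measure u) (plane_measure (opp_unit u : V))); last first.
  by move=> A mA _; exact: (plane_measure_opp u A).
by apply: eq_integral => y /set_mem sy; rewrite total_topE ?shadow_opp.
Qed.

(* psi vanishes for p off the boundary, so that cutting it off to the sphere makes it bounded. *)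
Let Psi (q : V * V) : \bar R := (psi q.1 q.2 * \1_(bdry ball) q.2)%:E.

Let Psi_measurable : measurable_fun setT Psi.
Proof.
apply/measurable_EFinP; apply: measurable_funM; first exact: measurable_reach_comp dh.
have mI : measurable_fun setT (\1_(bdry ball) : V -> R).
  by apply: measurable_indic; exact: measurable_bdry.
exact: (measurableT_comp mI measurable_snd).
Qed.

Let Psi_integrable : (surface B \x surface ball).-integrable setT Psi.
Proof.
have [M M0 hM] := bounded_reach_comp B dh.
apply: (@bounded_integrable _ _ _ _ _ _ M) => //.
- have E := @product_measure1E _ _ _ _ _ (surface B) (surface ball) setT setT measurableT measurableT.
  have fin : surface B setT * surface ball setT < +oo.
    by rewrite lte_mul_pinfty ?measure_ge0 ?ge0_fin_numE ?surface_fin.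
  by rewrite -E setXTT in fin.
- by apply/measurable_EFinP.
move=> [p v] _ /=; rewrite normrM; have [bv|bv] := pselect (bdry ball v); last first.
  by rewrite indicE memNset// normr0 mulr0 ltW.
rewrite indicE mem_set// normr1 mulr1; have /bdry_unit_ball v1 := bv.
have [bp|bp] := pselect (bdry K p); first exact: (hM p (UnitVector v1) bp).
by rewrite /psi /back_weight /gauss memNset// dotp0l oppr0 maxxx mul0r normr0 ltW.
Qed.

Let Phi p : \bar R := \int[surface ball]_v Psi (p, v).

Let Phi_integrable : (surface B).-integrable setT Phi.
Proof. exact: (integrable_fubini_F Psi_integrable). Qed.

(** [Psi] is bounded and both surfaces have finite area, so Fubini applies although h may change
    sign. *)
Lemma directions_integral :
  ointegral (@sigma R d.+2) sphere (fun v => ointegral (@sigma R d.+2) [set y | dotp y v = 0%R] (fun y => F y v)) =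
  \int[surface B]_p Phi p.
Proof.
rewrite (@ointegralE _ _ _ sphere (surface ball) _ (fun v => \int[surface B]_p Psi (p, v))).
- exact: (esym (Fubini Psi_integrable)).
- by move=> C; rewrite sphereE setIC.
- exact: (measurable_fubini_G Psi_integrable).
move=> v v1; rewrite (direction_integral (UnitVector v1)); apply: eq_integral => p _.
by rewrite /Psi /= indicE mem_set ?mulr1// -sphereE.
Qed.

(** For fixed [p] the divergence theorem passes from the boundary to the body, and polar coordinates
    about [p] pass from the body to the sphere of directions. *)
Lemma boundary_integral p : bdry K p ->
  \int[surface B]_x (surface_density B k p x)%:E = d.+1%:R%:E * Phi p.
Proof.
move=> bp; have u0 := @axis R d ord0.
rewrite surface_integral_bdry; last first.
  by apply/measurable_EFinP; exact: measurable_surface_density1.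
rewrite (surface_volume ck u0 bp).
under eq_integral do rewrite EFinM.
rewrite integralZl; [|exact: measurable_body|exact: integrable_volume_density].
rewrite (volume_density_polar u0 ck dh h0 bp); congr (_ * _).
have mpsi : measurable_fun setT (fun v => (psi p v)%:E).
  by apply/measurable_EFinP; exact: measurable_reach_comp1 dh p.
have mPsi : measurable_fun setT (fun v => Psi (p, v)).
  exact: (measurableT_comp Psi_measurable (measurable_pair1 p)).
apply: eq_surface_integral => // v bv.
by rewrite /Psi /= indicE mem_set// mulr1.
Qed.

Lemma boundaries_integral :
  ointegral (@sigma R d.+2) (bdry K) (fun p => ointegral (@sigma R d.+2) (bdry K)
    (fun x => (chord_integrand (normal B) k p x)%:E)) =
  d.+1%:R%:E * \int[surface B]_p Phi p.
Proof.
rewrite -integralZl//.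
rewrite (@ointegralE _ _ _ (bdry K) (surface B) _ (fun p => d.+1%:R%:E * Phi p)) => [|C||p bp].
- by [].
- by rewrite setIC.
- by apply: emeasurable_funM => //; exact: measurable_int Phi_integrable.
rewrite -boundary_integral//.
rewrite (@ointegralE _ _ _ (bdry K) (surface B) _ (fun x => (surface_density B k p x)%:E)) => [|C||x bx].
- by [].
- by rewrite setIC.
- by apply/measurable_EFinP; exact: measurable_surface_density1.
- by rewrite chord_integrandE.
Qed.

Lemma crofton_chord :
  lines_integral F = (((d.+1)%:R * omega R d.+2)^-1)%:E *
    ointegral (@sigma R d.+2) (bdry K) (fun p => ointegral (@sigma R d.+2) (bdry K)
      (fun x => (chord_integrand (normal B) k p x)%:E)).
Proof.
rewrite /lines_integral directions_integral boundaries_integral muleA -EFinM.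
congr (_%:E * _); by rewrite (invfM d.+1%:R) mulrAC mulVf ?mul1r.
Qed.

End Crofton.

Unset Implicit Arguments.

Theorem theorem1 (R : realType) (d : nat) (K : set 'rV[R]_d)
  (n : 'rV[R]_d -> 'rV[R]_d) (h : R -> R) :
  (2 <= d)%N ->
  convex_body K -> C1_boundary K ->
  (forall x, bdry K x -> outer_unit_normal K x (n x)) ->
  (forall x : R, derivable h x 1) -> continuous (derive1 h) -> h 0 = 0 ->
  lines_integral (fun y u =>
      if `[< (K `&` line y u) !=set0 >] then (h (chord_length K y u))%:E
      else 0%E)
  = ((((d.-1)%:R * omega R d)^-1)%:E *
     ointegral (sigma (R:=R) (d:=d)) (bdry K) (fun x1 =>
       ointegral (sigma (R:=R) (d:=d)) (bdry K) (fun x2 =>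
         (chord_integrand n (derive1 h) x1 x2)%:E)))%E.
Proof.
(* Writing the dimension as [d.+2] makes the dimension d+1 of the surface visibly positive. *)
move=> d2; case: d d2 K n => [|[|d]] d2 K n.
- by exfalso.
- by exfalso.
move=> [cK [kK [c Kc]]] C1 nK dh ch h0.
have clK : closed K by apply: compact_closed => //; exact: norm_hausdorff.
(* The C^1 hypothesis enters here, through a local defining function with nonzero gradient. *)
have uniq x v : bdry K x -> outer_unit_normal K x v -> v = n x.
  move=> bx nv; have [r [r0 [g [gC1 [gx gK]]]]] := C1 x bx.
  have Kx : K x by case: bx => + _; rewrite -((closure_id K).1 clK).
  exact: (outer_unit_normal_unique gC1 r0 Kx gK gx nv (nK x bx)).
pose B := @SmoothBody R d K n c cK kK Kc nK uniq.
apply: (@crofton_chord R d B h (derive1 h)) => // t.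
exact: (DeriveDef (dh t) (esym (derive1E _ _))).
Qed.
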